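(* Let $s\in(\frac12,1)$ and let $\Omega\subset\mathbb{R}^N$ be a bounded convex open set. Then $$\frac{c_{N,s}}{2}\iint_{\Omega\times\Omega}\frac{(u(x)-u(y))^2}{|x-y|^{N+2s}}\,dx\,dy\ \ge\ \mathfrak{h}_{N,s}\int_\Omega\frac{u^2}{\delta^{2s}}\,dx+\mathfrak{C}(\Omega,N,s)\int_\Omega u^2\,dx$$ for all $u\in H^s_0(\Omega)$, where $$\mathfrak{C}(\Omega,N,s)=\left(a(N,s)+b(N,s)\,\frac{|\Omega|^{\frac1N}}{\mathrm{diam}(\Omega)}\right)|\Omega|^{-\frac{2s}{N}},$$ $$a(N,s)=\mathfrak{h}_{N,s}\,2^{-2s}(2^{2s}-1)\frac{\sqrt{\pi}\,\Gamma(\frac{N+2s}{2})}{\Gamma(\frac N2)\Gamma(\frac{1+2s}{2})}\left(\frac{N}{|\mathbb{S}^{N-1}|}\right)^{-\frac{2s}{N}},$$ $$b(N,s)=2^{2s-1}(4-2^{3-2s})\frac{\Gamma(\frac{N+2s}{2})}{\Gamma(\frac N2)\Gamma(1-s)}\left(\frac{N}{|\mathbb{S}^{N-1}|}\right)^{-\frac{2s-1}{N}}.$$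
   Context: $\delta(x)=\mathrm{dist}(x,\partial\Omega)$; $|\Omega|$ is the Lebesgue measure of $\Omega$, $\mathrm{diam}(\Omega)=\sup\{|x-y|:x,y\in\Omega\}$, and $|\mathbb{S}^{N-1}|$ is the surface measure of the unit sphere; $c_{N,s}=2^{2s}\pi^{-N/2}s\,\Gamma(\frac{N+2s}{2})/\Gamma(1-s)$. Let $H^s(\Omega)$ be the space of $u\in L^2(\Omega)$ with $(u(x)-u(y))|x-y|^{-(N+2s)/2}\in L^2(\Omega\times\Omega)$, with norm given by $\|u\|_{H^s(\Omega)}^2=\|u\|_{L^2(\Omega)}^2+\frac{c_{N,s}}{2}\iint_{\Omega\times\Omega}\frac{(u(x)-u(y))^2}{|x-y|^{N+2s}}\,dx\,dy$; $H^s_0(\Omega)$ is the completion of $C_c^\infty(\Omega)$ in $H^s(\Omega)$. The constant is $\mathfrak{h}_{N,s}=c_{N,s}\kappa_{N,2s}$ with $$\kappa_{N,2s}=\pi^{\frac{N-1}{2}}\frac{\Gamma(\frac{1+2s}{2})}{\Gamma(\frac{N+2s}{2})}\frac{1}{2s}\left[\frac{2^{1-2s}}{\sqrt{\pi}}\Gamma(1-s)\Gamma\Big(\frac{1+2s}{2}\Big)-1\right].$$ *)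

(* Defs.v *)
From HB Require Import structures.
From mathcomp Require Import all_boot all_order all_algebra.
From mathcomp Require Import all_classical all_reals all_analysis.

Set Implicit Arguments.
Unset Strict Implicit.
Unset Printing Implicit Defensive.

Import Order.TTheory GRing.Theory Num.Theory.
Import numFieldNormedType.Exports.

Local Open Scope classical_set_scope.
Local Open Scope ring_scope.

(* R^N is 'rV[R]_N.  Its library norm is the sup norm; it is used only through
   the topology and boundedness, which agree with the Euclidean ones. *)

(* The sigma-algebra generated by the coordinates, which for R^N is the Borel
   sigma-algebra (same construction as the library's one on n.-tuple T). *)
Section measurable_rV.
Context {R : realType} (n : nat).

Let coor (i : 'I_n) (v : 'rV[R]_n) : measurableTypeR R := v ord0 i.

Let rV_set0 : g_sigma_preimage coor set0.
Proof. exact: sigma_algebra0. Qed.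

Let rV_setC A : g_sigma_preimage coor A -> g_sigma_preimage coor (~` A).
Proof. exact: sigma_algebraC. Qed.

Let rV_bigcup (F : (set 'rV[R]_n)^nat) :
  (forall i, g_sigma_preimage coor (F i)) ->
  g_sigma_preimage coor (\bigcup_i (F i)).
Proof. exact: sigma_algebra_bigcup. Qed.

HB.instance Definition _ := @isMeasurable.Build default_measure_display
  'rV[R]_n (g_sigma_preimage coor) rV_set0 rV_setC rV_bigcup.

Lemma measurable_coor (i : 'I_n) :
  measurable_fun [set: 'rV[R]_n] (fun v : 'rV[R]_n => v ord0 i).
Proof.
move=> _ Y mY; rewrite setTI; apply: sub_sigma_algebra => /=.
rewrite -bigcup_seq/=; exists i => /=; first by rewrite mem_index_enum.
by exists Y => //; rewrite setTI.
Qed.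

Lemma measurable_fun_coorP d (T : measurableType d) (f : T -> 'rV[R]_n) :
  (forall i, measurable_fun [set: T] (fun x => f x ord0 i)) ->
  measurable_fun [set: T] f.
Proof.
move=> mf _ A; rewrite setTI => mA.
suff : g_sigma_preimage coor `<=` [set B | measurable (f @^-1` B)] by exact.
apply: smallest_sub.
  split=> /=.
  - by rewrite preimage_set0.
  - by move=> B mB; rewrite setTD preimage_setC; exact: measurableC.
  - by move=> F mF; rewrite preimage_bigcup; exact: bigcup_measurable.
rewrite -bigcup_seq => B [i _ [C mC <-]] /=.
have := mf i measurableT C mC; rewrite !setTI; exact.
Qed.

End measurable_rV.

Section lebesgue_rV.
Context {R : realType}.

Definition rV_cons n (p : measurableTypeR R * 'rV[R]_n) : 'rV[R]_n.+1 :=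
  \row_i (if unlift ord0 i is Some j then p.2 ord0 j else p.1).

Definition rV_uncons n (v : 'rV[R]_n.+1) : measurableTypeR R * 'rV[R]_n :=
  (v ord0 ord0, \row_j v ord0 (lift ord0 j)).

Lemma rV_consK n : cancel (@rV_cons n) (@rV_uncons n).
Proof.
move=> [x v]; rewrite /rV_uncons mxE unlift_none/=; congr pair.
by apply/rowP => j; rewrite !mxE liftK.
Qed.

Lemma measurable_rV_cons n : measurable_fun setT (@rV_cons n).
Proof.
apply: measurable_fun_coorP => i.
have [j ->|->] := unliftP ord0 i.
  rewrite (_ : (fun _ => _) = (fun v : 'rV[R]_n => v ord0 j) \o snd).
    by apply: measurableT_comp => //; exact: measurable_coor.
  by apply/funext => p /=; rewrite mxE liftK.
rewrite (_ : (fun _ => _) = fst); first exact: measurable_fst.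
by apply/funext => p /=; rewrite mxE unlift_none.
Qed.

Lemma measurable_rV_uncons n : measurable_fun setT (@rV_uncons n).
Proof.
apply/measurable_fun_pairP; split => /=; first exact: measurable_coor.
apply: measurable_fun_coorP => j.
rewrite (_ : (fun _ => _) = fun v : 'rV[R]_n.+1 => v ord0 (lift ord0 j)).
  exact: measurable_coor.
by apply/funext => v /=; rewrite mxE.
Qed.

Section step.
Context n (mu : {sigma_finite_measure set 'rV[R]_n -> \bar R}).
Local Open Scope ereal_scope.

Definition lebesgue_rV_step : set 'rV[R]_n.+1 -> \bar R :=
  pushforward (lebesgue_measure \x mu) (@rV_cons n).

HB.instance Definition _ := Measure.copy lebesgue_rV_step
  (measure_function_pushforward__canonical__measure_function_Measure
    (lebesgue_measure \x mu) (@measurable_rV_cons n)).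

Let lebesgue_rV_step_sigma_finite : sigma_finite setT lebesgue_rV_step.
Proof.
have /sigma_finiteP[F [FT Fnd mF]] := sigma_finiteT (@lebesgue_measure R).
have /sigma_finiteP[G [GT Gnd mG]] := sigma_finiteT mu.
exists (fun k => @rV_uncons n @^-1` (F k `*` G k)).
  rewrite -preimage_bigcup (_ : \bigcup_k _ = setT)//.
  apply/seteqP; split=> // -[x y] _.
  have [k _ Fkx] : (\bigcup_k F k) x by rewrite -FT.
  have [l _ Gly] : (\bigcup_k G k) y by rewrite -GT.
  exists (maxn k l) => //; split=> /=.
  - by move: x Fkx; exact/subsetPset/Fnd/leq_maxl.
  - by move: y Gly; exact/subsetPset/Gnd/leq_maxr.
move=> k; have [mFk Fkoo] := mF k; have [mGk Gkoo] := mG k; split.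
  rewrite -[X in measurable X]setTI; apply: measurable_rV_uncons => //.
  exact: measurableX.
rewrite /lebesgue_rV_step /pushforward -comp_preimage.
rewrite (_ : _ \o _ = id); last by apply/funext => p; exact: rV_consK.
by rewrite product_measure1E// lte_mul_pinfty// ge0_fin_numE.
Qed.

HB.instance Definition _ := Measure_isSigmaFinite.Build _ _ _
  lebesgue_rV_step lebesgue_rV_step_sigma_finite.

End step.

Fixpoint lebesgue_rV n : {sigma_finite_measure set 'rV[R]_n -> \bar R} :=
  match n return {sigma_finite_measure set 'rV[R]_n -> \bar R} with
  | 0%N => [the {sigma_finite_measure set 'rV[R]_0 -> \bar R} of \d_(0 : 'rV[R]_0)]
  | n'.+1 => [the {sigma_finite_measure set 'rV[R]_n'.+1 -> \bar R} of
      lebesgue_rV_step (lebesgue_rV n')]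
  end.

Lemma lebesgue_rV_box n (A : 'I_n -> set (measurableTypeR R)) :
  (forall i, measurable (A i)) ->
  lebesgue_rV n [set v | forall i, A i (v ord0 i)]
  = (\prod_(i < n) lebesgue_measure (A i))%E.
Proof.
elim: n A => [|n ih] A mA.
  by rewrite big_ord0 /= diracE mem_set//= => -[].
rewrite big_ord_recl -ih; last by move=> i; exact: mA.
have mB : measurable [set v : 'rV[R]_n | forall i, A (lift ord0 i) (v ord0 i)].
  rewrite (_ : mkset _ = \bigcap_(i in [set: 'I_n])
      ((fun v : 'rV[R]_n => v ord0 i) @^-1` A (lift ord0 i))).
    apply: fin_bigcap_measurable => // i _.
    by rewrite -[X in measurable X]setTI; apply: measurable_coor => //; exact: mA.
  by apply/seteqP; split=> v /= h i; [move=> _|]; exact: h.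
rewrite -product_measure1E//.
congr (product_measure1 _ _ _); apply/seteqP; split=> [p /= h|[x v] /= [Ax h] i].
  split; first by have := h ord0; rewrite mxE unlift_none.
  by move=> i; have := h (lift ord0 i); rewrite mxE liftK.
by rewrite mxE; case: unliftP => [j ->|->].
Qed.

End lebesgue_rV.

Section euclidean.
Context {R : realType} {N : nat}.
Implicit Types (x : 'rV[R]_N) (E Omega : set 'rV[R]_N).

Definition enorm x : R := Num.sqrt (\sum_(i < N) x ord0 i ^+ 2).

Definition diam Omega : R :=
  sup [set enorm (x - y) | x in Omega & y in Omega].

Definition boundary Omega : set 'rV[R]_N := closure Omega `\` interior Omega.

Definition dist x E : R := inf [set enorm (x - y) | y in E].

Definition bdist Omega x : R := dist x (boundary Omega).

Definition vol Omega : R := fine (lebesgue_rV N Omega).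

Definition unit_sphere : set 'rV[R]_N := [set x | enorm x = 1].

(* Surface measure on the unit sphere, as in the polar-coordinates formula:
   sigma(E) = N |{r x : 0 < r <= 1, x in E}|. *)
Definition surface_measure E : \bar R :=
  (N%:R%:E * lebesgue_rV N [set r *: x | r in (`]0%R, 1%R] : set R) & x in E])%E.

End euclidean.

Definition sphere_area (R : realType) (N : nat) : R :=
  fine (surface_measure (@unit_sphere R N)).

Section smooth.
Context {R : realType} {N : nat}.
Implicit Types (f : 'rV[R]_N -> R) (Omega : set 'rV[R]_N).

Definition partial (i : 'I_N) f : 'rV[R]_N -> R :=
  fun x => 'D_(delta_mx ord0 i) f x.

Definition partials (a : seq 'I_N) f : 'rV[R]_N -> R := foldr partial f a.

Definition smooth f : Prop := forall a : seq 'I_N,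
  continuous (partials a f) /\
  forall (i : 'I_N) x, derivable (partials a f) x (delta_mx ord0 i).

Definition support f : set 'rV[R]_N := closure [set x | f x != 0].

(* Functions on Omega are represented by functions on R^N; a test function is
   the extension by zero. *)
Definition Cc_infty Omega : set ('rV[R]_N -> R) :=
  [set f | [/\ smooth f, compact (support f) & support f `<=` Omega]].

End smooth.

(* Euler's integral; meaningful for z > 0, the only case used. *)
Definition Gamma {R : realType} (z : R) : R :=
  \int[lebesgue_measure]_(t in `]0, +oo[) (t `^ (z - 1) * expR (- t)).

Section constants.
Context {R : realType} (N : nat) (s : R).
Local Notation N' := (N%:R : R).

Definition c_const : R :=
  2 `^ (2 * s) * pi `^ (- (N' / 2)) * s * Gamma ((N' + 2 * s) / 2)
  / Gamma (1 - s).

(* kappa_{N,2s} *)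
Definition kappa_const : R :=
  pi `^ ((N' - 1) / 2) * (Gamma ((1 + 2 * s) / 2) / Gamma ((N' + 2 * s) / 2))
  * (2 * s)^-1
  * (2 `^ (1 - 2 * s) / Num.sqrt pi * Gamma (1 - s) * Gamma ((1 + 2 * s) / 2)
     - 1).

Definition h_const : R := c_const * kappa_const.

Definition a_const : R :=
  h_const * 2 `^ (- (2 * s)) * (2 `^ (2 * s) - 1)
  * (Num.sqrt pi * Gamma ((N' + 2 * s) / 2)
     / (Gamma (N' / 2) * Gamma ((1 + 2 * s) / 2)))
  * (N' / sphere_area R N) `^ (- (2 * s / N')).

Definition b_const : R :=
  2 `^ (2 * s - 1) * (4 - 2 `^ (3 - 2 * s))
  * (Gamma ((N' + 2 * s) / 2) / (Gamma (N' / 2) * Gamma (1 - s)))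
  * (N' / sphere_area R N) `^ (- ((2 * s - 1) / N')).

Definition C_const (Omega : set 'rV[R]_N) : R :=
  (a_const + b_const * (vol Omega `^ (N'^-1) / diam Omega))
  * vol Omega `^ (- (2 * s / N')).

End constants.

Section fractional_sobolev.
Context {R : realType} {N : nat} (s : R) (Omega : set 'rV[R]_N).
Implicit Types u : 'rV[R]_N -> R.
Local Open Scope ereal_scope.

Definition L2_normsq u : \bar R :=
  \int[lebesgue_rV N]_(x in Omega) (u x ^+ 2)%:E.

Definition energy u : \bar R :=
  (c_const N s / 2)%:E *
  \int[lebesgue_rV N \x lebesgue_rV N]_(z in Omega `*` Omega)
    ((u z.1 - u z.2) ^+ 2 / enorm (z.1 - z.2) `^ (N%:R + 2 * s))%:E.

Definition Hs_normsq u : \bar R := L2_normsq u + energy u.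

(* Elements of L^2 are represented by Borel functions; only the values on
   Omega matter. *)
Definition Hs : set ('rV[R]_N -> R) :=
  [set u | [/\ measurable_fun Omega u, L2_normsq u < +oo & energy u < +oo]].

(* The completion of C_c^infty(Omega) in H^s(Omega), i.e. its closure. *)
Definition Hs0 : set ('rV[R]_N -> R) :=
  [set u | Hs u /\ forall e : R, (0 < e)%R ->
    exists2 phi, Cc_infty Omega phi & Hs_normsq (u \- phi)%R < (e ^+ 2)%:E].

End fractional_sobolev.

(* Main.v *)
(* For x, y in Omega let 1 / m and 1 / m' be the distances from x to the boundary
   in the directions +w and -w of y - x. With M = |y - x| m and M' = |y - x| m',
   the factor rho = ((1 - M) (1 + M'))^(s - 1/2) becomes 1 / rho when x and y are
   exchanged, so that (u - v)^2 + u^2 rho + v^2 / rho >= u^2 + v^2. This is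
   integrated against the kernel over the pairs with (2 + M' - M) / (M + M') < Q,
   a symmetric condition. In polar coordinates around x both sides are explicit in
   m and m', and the limit in Q gives
     energy >= int u^2(x) int_(sphere) (2 gap ((m + m') / 2)^(2s) - (m^(2s) + m'^(2s)) / (2s))
   for bounded u with compact support in Omega. The integrand dominates
     kappa (max^(2s) + (2^(2s) - 1) min^(2s)) + c m^(2s-1) / diam:
   by a supporting hyperplane at a nearly closest boundary point the first term
   gives delta^(-2s), and Jensen's inequality with
   int_(sphere) m^(-N) = N |Omega| gives the two terms of the constant. *)

(* On the chord of Omega through x and y, the factors 1 - M and 1 + M' are the quotients of the
   distances from y and from x to the two ends. So rho = h(y) / h(x), where h is the product of both
   distances to the power s - 1/2: the pair inequality is a ground-state substitution along each
   chord. Without the cut-off, both kernel integrals diverge on the diagonal and only their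
   difference makes sense. For a fixed x and a fixed chord, q = (2 + M' - M) / (M + M') is affine in
   1 / |y - x| and runs over ]1, +oo[, and (1 - M) (1 + M') is q^2 - 1 up to a square factor.
   Cutting at q < Q therefore reduces every chord to the same one-dimensional integral, and gap is
   its finite part, the integral of q^(2s-1) - (q^2 - 1)_+^(s-1/2) over q > 0. Bounded functions
   with compact support in Omega make the subtracted terms finite. A general u is approached on the
   sets where the spherical average of the weight is at most k: there L^2 convergence of test
   functions suffices, and monotone convergence in k concludes. *)
Require Import Defs.
From HB Require Import structures.
From mathcomp Require Import all_boot all_order all_algebra.
From mathcomp Require Import all_classical all_reals all_analysis.
From mathcomp Require Import measurable_realfun ring lra.
Set Implicit Arguments.
Unset Strict Implicit.
Unset Printing Implicit Defensive.

Import Order.TTheory GRing.Theory Num.Theory.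
Import numFieldNormedType.Exports.
Local Open Scope classical_set_scope.
Local Open Scope ring_scope.

(** * Lebesgue measure on R^N *)

Section ge0_integral.
Context d (T : measurableType d) (R : realType) (mu : {measure set T -> \bar R}).
Local Open Scope ereal_scope.

(** The integral of a nonnegative function is a supremum over the simple functions below it, hence
    monotone on all nonnegative functions. It serves for integrands that contain [bdist]. *)
Lemma ge0_le_integral_nonmeasurable (D : set T) (f g : T -> \bar R) :
  (forall x, D x -> 0 <= f x) -> (forall x, D x -> f x <= g x) ->
  \int[mu]_(x in D) f x <= \int[mu]_(x in D) g x.
Proof.
move=> f0 fg; have g0 x : D x -> 0 <= g x.
  by move=> Dx; exact: le_trans (f0 _ Dx) (fg _ Dx).
rewrite !ge0_integralE//; apply: le_ereal_sup => _ [h hf <-]; exists h => //.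
move=> x; apply: le_trans (hf x) _; rewrite !patchE; case: ifPn => // /set_mem.
exact: fg.
Qed.

End ge0_integral.

Section topology_rV.
Context {R : realType} {n : nat}.

(** The cubes [B p] with rational centre and inverse-integer half-side are countably many, and an
    open set is the union of those that it contains. *)
Lemma open_measurable_rV (A : set 'rV[R]_n) : open A -> measurable A.
Proof.
move=> oA.
pose B (p : 'rV[rat]_n * nat) : set 'rV[R]_n :=
  [set v | forall i, `|ratr (p.1 ord0 i) - v ord0 i| < p.2.+1%:R^-1].
have mB p : measurable (B p).
  rewrite (_ : B p = \bigcap_(i in [set: 'I_n])
      ((fun v : 'rV[R]_n => v ord0 i) @^-1`
        [set y | `|ratr (p.1 ord0 i) - y| < p.2.+1%:R^-1])).
    apply: fin_bigcap_measurable => // i _.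
    rewrite -[X in measurable X]setTI; apply: measurable_coor => //.
    exact: (open_measurable (ball_open (ratr (p.1 ord0 i) : R) p.2.+1%:R^-1)).
  by apply/seteqP; split=> v /= h i; [move=> _|]; exact: h.
have -> : A = \bigcup_(p in [set p | B p `<=` A]) B p.
  apply/seteqP; split => [x Ax|x [p /= pA]]; last exact: pA.
  have /nbhs_ballP[e /= e0 eA] : nbhs x A by exact: open_nbhs_nbhs.
  have [k ke] : exists k : nat, k.+1%:R^-1 < e / 2.
    have e20 : 0 < e / 2 by rewrite divr_gt0.
    exists (Num.truncn (e / 2)^-1); rewrite invf_plt ?posrE//.
    by have := truncnS_gt (e / 2)^-1.
  have q_ i : {q : rat | `|ratr q - x ord0 i| < k.+1%:R^-1}.
    apply: cid; have k0 : 0 < (k.+1%:R^-1 : R) by rewrite invr_gt0.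
    have [q] : exists q, ratr q \in `](x ord0 i - k.+1%:R^-1), (x ord0 i + k.+1%:R^-1)[.
      by apply: rat_in_itvoo; rewrite ltrBlDr -addrA ltrDl addr_gt0.
    by rewrite in_itv/= => ?; exists q; rewrite ltr_distl.
  (* The centre is within 1 / (k + 1) < e / 2 of [x] in each coordinate, so the cube contains [x]
     and stays inside its ball of radius [e]. *)
  exists (\row_i sval (q_ i), k) => /=.
    move=> v /= hv; apply: eA; split=> // i j; rewrite /ball/= (ord1 i).
    have := hv j; rewrite mxE => vj; have := svalP (q_ j) => xj.
    rewrite (le_lt_trans (ler_distD (ratr (sval (q_ j))) _ _))//.
    rewrite distrC in xj; move: vj xj ke; set t := k.+1%:R^-1; lra.
  by move=> i /=; rewrite mxE; exact: (svalP (q_ i)).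
rewrite bigcup_mkcond; apply: (@countable_bigcupT_measurable _ _ ('rV[rat]_n * nat)%type
  (fun p => if p \in [set p | B p `<=` A] then B p else set0)).
  exact: countableP.
by move=> p; case: ifP.
Qed.

Lemma continuous_measurable_rV (f : 'rV[R]_n -> R) :
  continuous f -> measurable_fun setT f.
Proof.
move=> /continuousP cf; apply: (measurability _ (RGenOpens.measurableE R)).
move=> _ [_ [a [b ->] <-]]; rewrite setTI; apply: open_measurable_rV.
exact/cf/interval_open.
Qed.

Lemma measurable_rV_add :
  measurable_fun setT (fun z : 'rV[R]_n * 'rV[R]_n => z.1 + z.2).
Proof.
apply: measurable_fun_coorP => i.
rewrite (_ : (fun _ => _) = (fun z : 'rV[R]_n * 'rV[R]_n =>
    z.1 ord0 i + z.2 ord0 i)); last by apply/funext => z; rewrite mxE.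
by apply: measurable_funD; apply: (measurableT_comp (measurable_coor i)).
Qed.

Lemma measurable_rV_scale :
  measurable_fun setT (fun z : measurableTypeR R * 'rV[R]_n => z.1 *: z.2).
Proof.
apply: measurable_fun_coorP => i.
rewrite (_ : (fun _ => _) = (fun z : measurableTypeR R * 'rV[R]_n =>
    z.1 * z.2 ord0 i)); last by apply/funext => z; rewrite mxE.
by apply: measurable_funM => //; apply: (measurableT_comp (measurable_coor i)).
Qed.

End topology_rV.

Section measurable_fun_rV.
Context {R : realType} {n : nat} d (T : measurableType d).

Lemma measurable_funD_rV (f g : T -> 'rV[R]_n) :
  measurable_fun setT f -> measurable_fun setT g ->
  measurable_fun setT (fun x => f x + g x).
Proof.
move=> mf mg; exact: (measurableT_comp measurable_rV_add (measurable_fun_pair mf mg)).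
Qed.

Lemma measurable_funZ_rV (f : T -> R) (g : T -> 'rV[R]_n) :
  measurable_fun setT f -> measurable_fun setT g ->
  measurable_fun setT (fun x => f x *: g x).
Proof.
move=> mf mg; exact: (measurableT_comp measurable_rV_scale (measurable_fun_pair mf mg)).
Qed.

Lemma measurable_funB_rV (f g : T -> 'rV[R]_n) :
  measurable_fun setT f -> measurable_fun setT g ->
  measurable_fun setT (fun x => f x - g x).
Proof.
move=> mf mg; apply: measurable_funD_rV => //.
under eq_fun do rewrite -scaleN1r.
exact: measurable_funZ_rV.
Qed.

Lemma measurable_enorm : measurable_fun setT (@enorm R n).
Proof.
rewrite (_ : enorm = @Num.sqrt R \o fun x : 'rV[R]_n => \sum_(i < n) x ord0 i ^+ 2)//.
apply: (measurableT_comp (continuous_measurable_fun (@sqrt_continuous R))).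
apply: measurable_sum => i.
by apply: measurable_funX; exact: measurable_coor.
Qed.

End measurable_fun_rV.

Section lebesgue_affine.
Context {R : realType}.
Local Open Scope ereal_scope.
Notation mu := (@lebesgue_measure R).

(** By uniqueness of the Lebesgue measure: |c| times the push-forward gives every half-open interval
    its length. *)
Lemma lebesgue_measure_affine (c w : R) (A : set (measurableTypeR R)) : (c != 0)%R ->
  measurable A -> mu A = `|c|%:E * mu ((fun x => c * x + w)%R @^-1` A).
Proof.
move=> c0 mA.
pose f (x : measurableTypeR R) : measurableTypeR R := (c * x + w)%R.
have mf : measurable_fun setT f.
  by apply: measurable_funD => //; exact: measurable_funM.
pose nu0 : {measure set (measurableTypeR R) -> \bar R} :=
  measure_function_pushforward__canonical__measure_function_Measure mu mf.
pose nu : {measure set (measurableTypeR R) -> \bar R} :=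
  mscale (NngNum (normr_ge0 c)) nu0.
rewrite (lebesgue_measure_unique (mu := nu))// => _ [[a b]] /= _ <-.
rewrite /nu /nu0 /mscale /= /pushforward /=.
have [cgt0|clt0] : (0 < c)%R \/ (c < 0)%R by case: (ltgtP c 0%R) c0; tauto.
- rewrite (_ : _ @^-1` _ = `](c^-1 * (a - w))%R, (c^-1 * (b - w))%R]%classic).
    rewrite !lebesgue_measure_itv/= !lte_fin ltr_pM2l ?invr_gt0// ltrD2r.
    case: ifPn => ab; last by rewrite mule0.
    rewrite -EFinB -EFinB -EFinM gtr0_norm//; congr EFin.
    by rewrite -mulrBr mulrA divff// mul1r; ring.
  apply/seteqP; split => x /=; rewrite !in_itv/= /f ltr_pdivrMl// ler_pdivlMl//; lra.
(* A negative slope exchanges the open and the closed end, without effect on the length. *)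
- rewrite (_ : _ @^-1` _ = `[(c^-1 * (b - w))%R, (c^-1 * (a - w))%R[%classic).
    rewrite !lebesgue_measure_itv/= !lte_fin ltr_nM2l ?invr_lt0// ltrD2r.
    case: ifPn => ab; last by rewrite mule0.
    rewrite -EFinB -EFinB -EFinM ltr0_norm//; congr EFin.
    by rewrite -mulrBr mulrA mulNr divff// mulN1r; ring.
  apply/seteqP; split => x /=; rewrite !in_itv/= /f ler_ndivrMl// ltr_ndivlMl//; lra.
Qed.

Lemma ge0_integral_affine (c w : R) (f : R -> \bar R) : (c != 0)%R ->
  measurable_fun setT f -> (forall x, 0 <= f x) ->
  \int[mu]_x f x = `|c|%:E * \int[mu]_x f (c * x + w)%R.
Proof.
move=> c0 mf f0.
pose g (x : measurableTypeR R) : measurableTypeR R := (c * x + w)%R.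
have mg : measurable_fun setT g.
  by apply: measurable_funD => //; exact: measurable_funM.
pose nu0 : {measure set (measurableTypeR R) -> \bar R} :=
  measure_function_pushforward__canonical__measure_function_Measure mu mg.
pose nu : {measure set (measurableTypeR R) -> \bar R} :=
  mscale (NngNum (normr_ge0 c)) nu0.
rewrite (eq_measure_integral nu) => [|A mA _]; last first.
  exact: (lebesgue_measure_affine w c0 mA).
rewrite ge0_integral_mscale//; congr (_ * _).
by rewrite /nu0 ge0_integral_pushforward.
Qed.

End lebesgue_affine.

Section lebesgue_rV_affine.
Context {R : realType}.
Local Open Scope ereal_scope.
Notation mu := (@lebesgue_measure R).

Lemma ge0_integral_rV_cons n (f : 'rV[R]_n.+1 -> \bar R) :
  measurable_fun setT f -> (forall x, 0 <= f x) ->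
  \int[lebesgue_rV n.+1]_v f v =
  \int[mu]_x \int[lebesgue_rV n]_v f (rV_cons (x, v)).
Proof.
move=> mf f0.
transitivity (\int[mu \x lebesgue_rV n]_x (f \o @rV_cons R n) x).
  exact: (@ge0_integral_pushforward _ _ _ _ _ _ (@measurable_rV_cons R n)
    (mu \x lebesgue_rV n) setT f measurableT mf (fun y _ => f0 y)).
rewrite fubini_tonelli1//.
exact: (measurableT_comp mf (@measurable_rV_cons R n)).
by move=> p; exact: f0.
Qed.

Lemma ge0_integral_rV_affine n (c : R) (w : 'rV[R]_n) (f : 'rV[R]_n -> \bar R) :
  (c != 0)%R -> measurable_fun setT f -> (forall x, 0 <= f x) ->
  \int[lebesgue_rV n]_v f v =
  (`|c| ^+ n)%:E * \int[lebesgue_rV n]_v f (c *: v + w)%R.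
Proof.
move=> c0; elim: n w f => [|n ih] w f mf f0.
  rewrite expr0 mul1e; apply: eq_integral => v _; congr f.
  by apply/rowP => -[].
have mA m (u : 'rV[R]_m) : measurable_fun setT (fun v : 'rV[R]_m => c *: v + u)%R.
  by apply: measurable_funD_rV => //; exact: measurable_funZ_rV.
have mfc := measurableT_comp mf (@measurable_rV_cons R n).
have mfA : measurable_fun setT (fun v : 'rV[R]_n.+1 => f (c *: v + w)%R).
  exact: (measurableT_comp mf (mA _ w)).
have mfAc := measurableT_comp mfA (@measurable_rV_cons R n).
rewrite ge0_integral_rV_cons// ge0_integral_rV_cons//.
rewrite (@ge0_integral_affine _ c (w ord0 ord0) _ c0); last 2 first.
  exact: (measurable_fun_fubini_tonelli_F _ mfc (fun p => f0 _)).
  by move=> x; exact: integral_ge0.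
rewrite exprS EFinM -muleA; congr (_ * _).
rewrite -ge0_integralZl_EFin//; last first.
  exact: (measurable_fun_fubini_tonelli_F _ mfAc (fun p => f0 _)).
  by move=> x _; exact: integral_ge0.
apply: eq_integral => x _.
rewrite (ih (\row_j w ord0 (lift ord0 j)))//; last first.
  exact: (measurableT_comp mfc (pair1_measurable (c * x + w ord0 ord0)%R)).
congr (_ * _); apply: eq_integral => v _; congr f.
apply/rowP => i; rewrite !mxE; case: unliftP => [j ->|->] /=; by rewrite ?mxE.
Qed.

End lebesgue_rV_affine.

(** * One-dimensional integrals and the Gamma function *)

Section powR_calculus.
Context {R : realType}.
Implicit Types (a b c d e x : R).
Notation mu := (@lebesgue_measure R).

Lemma gt0_powRD x a b : 0 < x -> x `^ (a + b) = x `^ a * x `^ b.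
Proof. by move=> x0; rewrite powRD// (gt_eqF x0) implybT. Qed.

Lemma continuous_at_powR a x : 0 < x -> {for x, continuous (@powR R ^~ a)}.
Proof.
move=> x0; apply/differentiable_continuous/derivable1_diffP.
by apply: derivable_powR; rewrite in_itv/= x0.
Qed.

Lemma derivable_oo_LRcontinuous_powR a c d : 0 < c -> c < d ->
  derivable_oo_LRcontinuous (@powR R ^~ a) c d.
Proof.
move=> c0 cd; split.
- move=> x; rewrite in_itv/= => /andP[cx _]; apply: derivable_powR.
  by rewrite in_itv/= andbT (lt_trans c0).
- by apply: cvg_at_right_filter; exact: continuous_at_powR.
- by apply: cvg_at_left_filter; apply: continuous_at_powR; exact: lt_trans cd.
Qed.

Lemma derivable_oo_LRcontinuousZ (k : R) (f : R -> R) c d :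
  derivable_oo_LRcontinuous f c d ->
  derivable_oo_LRcontinuous (fun x => k * f x) c d.
Proof.
move=> [df fc fd]; split.
- by move=> x /df dfx; apply: derivableM.
- by apply: cvgM => //; exact: cvg_cst.
- by apply: cvgM => //; exact: cvg_cst.
Qed.

Lemma derive1_powR_normalized e x : e != 0 -> 0 < x ->
  (fun x => e^-1 * x `^ e)^`()%classic x = x `^ (e - 1).
Proof.
move=> e0 x0; rewrite derive1E deriveM//; last first.
  by apply: derivable_powR; rewrite in_itv/= x0.
rewrite -derive1E (@powR_derive1 _ e)// ?in_itv/= ?x0//.
by rewrite derive_cst scaler0 addr0 /GRing.scale/= mulrA mulVf// mul1r.
Qed.

Lemma integral_powR_itv c d e : 0 < c -> c <= d -> e != 0 ->
  (\int[mu]_(x in `[c, d]) (x `^ (e - 1))%:E = ((d `^ e - c `^ e) / e)%:E)%E.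
Proof.
move=> c0; rewrite le_eqVlt => /predU1P[<-|cd] e0.
  by rewrite set_itv1 integral_set1 subrr mul0r.
rewrite (@continuous_FTC2 _ _ (fun x => e^-1 * x `^ e))//.
- by rewrite -EFinB -mulrBr mulrC.
- apply: derivable_oo_LRcontinuous_within.
  exact: derivable_oo_LRcontinuous_powR.
- by apply: derivable_oo_LRcontinuousZ; exact: derivable_oo_LRcontinuous_powR.
- move=> x; rewrite in_itv/= => /andP[cx _].
  by rewrite derive1_powR_normalized// (lt_trans c0).
Qed.

Lemma powRN_cvgy a : 0 < a -> x `^ (- a) @[x --> +oo] --> (0 : R).
Proof.
move=> a0.
have : (x^-1) `^ a @[x --> +oo] --> (0 : R).
  apply: (@cvg_comp _ _ _ (fun x : R => x^-1) (@powR R ^~ a) _ 0^'+); last exact: powR_cvg0.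
  move=> P [r /= r0 rP]; near=> x.
  have x0 : 0 < x by near: x; exact: nbhs_pinfty_gt.
  apply: rP; rewrite /= ?invr_gt0// sub0r normrN gtr0_norm ?invr_gt0//.
  rewrite invf_plt ?posrE//; near: x; apply: nbhs_pinfty_gt.
  by rewrite num_real.
apply: cvg_trans; apply: near_eq_cvg; near=> x.
have x0 : 0 <= x by near: x; apply: nbhs_pinfty_ge; rewrite num_real.
by rewrite -powR_inv1// -powRrM mulN1r.
Unshelve. all: by end_near. Qed.

Lemma integral_powR_itvy c e : 0 < c -> 0 < e ->
  (\int[mu]_(x in `[c, +oo[) (x `^ (- e - 1))%:E = (c `^ (- e) / e)%:E)%E.
Proof.
move=> c0 e0; have eN0 : - e != 0 by rewrite oppr_eq0 gt_eqF.
rewrite (@ge0_continuous_FTC2y _ _ (fun x => (- e)^-1 * x `^ (- e)) _ 0)//.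
- by rewrite sub0e -EFinN -mulNr invrN opprK mulrC.
- by move=> x _; exact: powR_ge0.
- apply: derivable_oy_Rcontinuous_within_itvcy; split.
    move=> x; rewrite in_itv/= andbT => cx; apply: derivable_powR.
    by rewrite in_itv/= andbT (lt_trans c0).
  by apply: cvg_at_right_filter; exact: continuous_at_powR.
- rewrite -(mulr0 (- e)^-1); apply: cvgM; first exact: cvg_cst.
  exact: powRN_cvgy.
- move=> x cx; apply: derivableM => //; apply: derivable_powR.
  by rewrite in_itv/= andbT (lt_trans c0).
- apply: cvgM; first exact: cvg_cst.
  by apply: cvg_at_right_filter; exact: continuous_at_powR.
- move=> x; rewrite in_itv/= andbT => cx.
  by rewrite derive1_powR_normalized// (lt_trans c0).
Qed.

End powR_calculus.

Section exhaustion.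
Context {R : realType}.
Implicit Types (a b c d e x : R).
Notation mu := (@lebesgue_measure R).

Lemma continuous_measurable_itvoy (f : R -> R) a :
  {in `]a, +oo[, continuous f} -> measurable_fun `]a, +oo[ f.
Proof.
move=> cf; apply: open_continuous_measurable_fun; first exact: interval_open.
exact/in_continuous_mksetP.
Qed.

(** The exponent is a parameter because the exhaustions for k = 0 and k = 1 correspond to each other
    under squaring. *)
Lemma bigcup_itv_oy k :
  \bigcup_n `[(n.+1%:R ^- k.+1), (n.+1%:R ^+ k.+1)]%classic = `]0, +oo[%classic :> set R.
Proof.
apply/seteqP; split=> [x [n _]|x]/=; rewrite !in_itv/= ?andbT.
  by move=> /andP[nx _]; rewrite (lt_le_trans _ nx)// invr_gt0 exprn_gt0.
move=> x0; exists (Num.truncn (Num.max x x^-1)) => //=; rewrite in_itv/=.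
have := truncnS_gt (Num.max x x^-1); set n := (Num.truncn _).+1.
rewrite gt_max => /andP[h1 h2].
have nk : n%:R <= n%:R ^+ k.+1 :> R by rewrite ler_eXnr// ler1n.
rewrite (le_trans (ltW h1) nk) andbT invf_ple ?posrE ?exprn_gt0 ?ltr0n//.
exact: le_trans (ltW h2) nk.
Qed.

Lemma ge0_integral_oy_cvg k (f : R -> \bar R) :
  measurable_fun (`]0%R, +oo[%classic : set R) f -> (forall x, 0 < x -> (0 <= f x)%E) ->
  (\int[mu]_(x in `[(n.+1%:R ^- k.+1)%R, (n.+1%:R ^+ k.+1)%R]) f x @[n --> \oo] -->
  \int[mu]_(x in `]0%R, +oo[) f x)%E.
Proof.
move=> mf f0; rewrite -(bigcup_itv_oy k).
apply: ge0_nondecreasing_set_cvg_integral.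
- apply/nondecreasing_seqP => n; rewrite subsetEset; apply: subset_itv.
    by rewrite bnd_simp lef_pV2 ?posrE ?exprn_gt0// lerXn2r ?nnegrE ?ler_nat.
  by rewrite bnd_simp lerXn2r ?nnegrE ?ler_nat.
- by [].
- move=> n; apply: measurable_funS mf => //.
  move=> x; rewrite /= !in_itv/= andbT => /andP[nx _].
  by rewrite (lt_le_trans _ nx)// invr_gt0 exprn_gt0.
- move=> n x; rewrite /= in_itv/= => /andP[nx _]; apply: f0.
  by rewrite (lt_le_trans _ nx)// invr_gt0 exprn_gt0.
Qed.

(** For e < 1 the integrand is singular at 0, so the fundamental theorem is applied on the intervals
    from d / (n + 1) to d, which exhaust the domain. *)
Lemma integral_powR_oc d e : 0 < d -> 0 < e ->
  (\int[mu]_(x in `]0%R, d]) (x `^ (e - 1))%:E = (d `^ e / e)%:E)%E.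
Proof.
move=> d0 e0.
have F n : 0 < d / n.+1%:R <= d.
  by rewrite divr_gt0//= ler_pdivrMr// ler_peMr ?ler1n// ltW.
have FE : \bigcup_n `[d / n.+1%:R, d]%classic = `]0, d]%classic.
  apply/seteqP; split=> [x [n _]|x]/=; rewrite !in_itv/=.
    move=> /andP[nx ->]; rewrite (lt_le_trans _ nx)//.
    by have /andP[] := F n.
  move=> /andP[x0 xd]; exists (Num.truncn (d / x)) => //=; rewrite in_itv/= xd.
  by rewrite andbT ler_pdivrMr// mulrC -ler_pdivrMr// ltW// truncnS_gt.
have mp A : measurable_fun A (fun x : R => (x `^ (e - 1))%:E).
  by apply/measurable_EFinP; apply: measurable_funTS; exact: measurable_powR.
have : (\int[mu]_(x in `[(d / n.+1%:R)%R, d]) (x `^ (e - 1))%:E @[n --> \oo] -->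
  \int[mu]_(x in `]0%R, d]) (x `^ (e - 1))%:E)%E.
  rewrite -FE; apply: ge0_nondecreasing_set_cvg_integral => //.
    apply/nondecreasing_seqP => n; rewrite subsetEset; apply: subset_itv => //.
    by rewrite bnd_simp ler_pM2l// lef_pV2 ?posrE// ler_nat.
    by move=> n; exact: mp.
  by move=> n x _; rewrite lee_fin powR_ge0.
move/cvg_lim => <-//; apply/cvg_lim => //.
rewrite (_ : (fun n => _) =
    (fun n => ((d `^ e - d `^ e * n.+1%:R `^ (- e)) / e)%:E)); last first.
  apply/funext => n; have /andP[n0 nd] := F n.
  rewrite integral_powR_itv ?gt_eqF//; congr (((_ - _) / _)%:E).
  by rewrite powRM ?(ltW d0)// ?invr_ge0// -powR_inv1// -powRrM mulN1r.
apply: cvg_EFin; first by near=> n.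
apply: cvgMl; rewrite -[X in _ --> X]subr0; apply: cvgB; first exact: cvg_cst.
rewrite -(mulr0 (d `^ e)); apply: cvgM; first exact: cvg_cst.
apply: (cvg_comp (fun n => n.+1%:R : R) (@powR R ^~ (- e))); last first.
  exact: powRN_cvgy.
by rewrite (cvg_shiftS (fun n => n%:R : R)); exact: cvgr_idn.
Unshelve. all: by end_near. Qed.

(** Substitution by the square on compact intervals, followed by a limit on both sides. *)
Lemma ge0_integral_sqr_oy (f : R -> R) :
  {in `]0, +oo[, continuous f} -> (forall x, 0 < x -> 0 <= f x) ->
  (\int[mu]_(x in `]0%R, +oo[) (f x)%:E =
   \int[mu]_(x in `]0%R, +oo[) (f (x ^+ 2) * (2 * x))%:E)%E.
Proof.
move=> cf f0.
have cf2 : {in `]0, +oo[, continuous (fun x => f (x ^+ 2) * (2 * x))}.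
  move=> x; rewrite in_itv/= andbT => x0; apply: cvgM; last first.
    by apply: cvgM; [exact: cvg_cst|exact: cvg_id].
  apply: (@continuous_comp _ _ _ (fun x : R => x ^+ 2) f); first exact: exprn_continuous.
  by apply: cf; rewrite in_itv/= andbT exprn_gt0.
have f20 x : 0 < x -> 0 <= f (x ^+ 2) * (2 * x).
  by move=> x0; rewrite mulr_ge0 ?f0 ?exprn_gt0// mulr_ge0// ltW.
have mf := continuous_measurable_itvoy cf.
have mf2 := continuous_measurable_itvoy cf2.
have f2lim := @ge0_integral_oy_cvg 0 (EFin \o (fun x => f (x ^+ 2) * (2 * x)))
  ((measurable_EFinP _ _).2 mf2) f20.
have flim := @ge0_integral_oy_cvg 1 (EFin \o f) ((measurable_EFinP _ _).2 mf) f0.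
rewrite -(cvg_lim _ f2lim)// -(cvg_lim _ flim)//; congr (limn _).
apply/funext => n /=; rewrite !expr1.
set a : R := n.+1%:R^-1; set b : R := n.+1%:R.
have a0 : 0 < a by rewrite invr_gt0.
have ab : a <= b by rewrite (@le_trans _ _ 1)// ?invf_le1 ?ler1n.
have dE : (fun x : R => x ^+ 2)^`()%classic = (fun x => 2 * x).
  by apply/funext => x; rewrite exp_derive1 expr1.
have dC (x : R) : {for x, continuous (fun x : R => 2 * x)}.
  by apply: cvgM; [exact: cvg_cst|exact: cvg_id].
pose F (x : R) := x ^+ 2.
have -> : b ^- 2 = F a by rewrite /F exprVn.
rewrite -[b ^+ 2]/(F b).
have := @integration_by_substitution_increasing _ F f a b ab.
rewrite [F^`()%classic]dE => ->.
- by apply: eq_integral => x _.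
- move=> x y; rewrite !in_itv/= => /andP[ax _] /andP[ay _].
  by rewrite ltr_pXn2r// nnegrE (le_trans (ltW a0)).
- by move=> x _; exact: dC.
- apply: (cvgP (2 * a)); apply: cvg_at_right_filter; exact: dC.
- apply: (cvgP (2 * b)); apply: cvg_at_left_filter; exact: dC.
- split.
  + by move=> x _; exact: exprn_derivable.
  + by apply: cvg_at_right_filter; exact: exprn_continuous.
  + by apply: cvg_at_left_filter; exact: exprn_continuous.
- apply: continuous_in_subspaceT => x; rewrite inE/= in_itv/= => /andP[ax _].
  by apply: cf; rewrite in_itv/= andbT (lt_le_trans _ ax)// exprn_gt0.
Qed.

End exhaustion.

Section gamma.
Context {R : realType}.
Implicit Types (a b c k v z x t : R).
Notation mu := (@lebesgue_measure R).

Lemma ge0_integral_oy_scale c (f : R -> \bar R) : 0 < c ->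
  measurable_fun setT f -> (forall x, (0 <= f x)%E) ->
  (\int[mu]_(x in `]0%R, +oo[) f x =
   c%:E * \int[mu]_(x in `]0%R, +oo[) f (c * x)%R)%E.
Proof.
move=> c0 mf f0; rewrite integral_mkcond [in RHS]integral_mkcond.
rewrite (@ge0_integral_affine _ c 0)// ?gt_eqF//.
- rewrite gtr0_norm//; congr (_ * _)%E; apply: eq_integral => x _.
  by rewrite !patchE addr0 !mem_setE !in_itv/= !andbT pmulr_rgt0.
- apply/(measurable_restrictT f) => //; exact: measurable_funTS.
- by move=> x; apply: erestrict_ge0.
Qed.

Definition gamma_integrand z t : R := t `^ (z - 1) * expR (- t).

Lemma gamma_integrand_ge0 z t : 0 <= gamma_integrand z t.
Proof. by rewrite mulr_ge0 ?powR_ge0 ?expR_ge0. Qed.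

Lemma measurable_gamma_integrand z : measurable_fun setT (gamma_integrand z).
Proof.
apply: measurable_funM; first exact: measurable_powR.
exact: measurableT_comp.
Qed.

(** The bound t / a <= expR (t / a), raised to the power a. *)
Lemma powR_le_expR a t : 0 < a -> 0 < t -> t `^ a <= a `^ a * expR t.
Proof.
move=> a0 t0; rewrite -[t in leLHS](divfK (lt0r_neq0 a0)) mulrC.
rewrite powRM ?(ltW a0) ?(ltW (divr_gt0 t0 a0))//.
rewrite ler_pM2l ?powR_gt0// (_ : expR t = expR (t / a) `^ a).
  apply: ge0_ler_powR; rewrite ?nnegrE ?expR_ge0 ?(ltW a0) ?(ltW (divr_gt0 t0 a0))//.
  by rewrite (le_trans _ (expR_ge1Dx _))// lerDr.
by rewrite /powR gt_eqF ?expR_gt0// expRK mulrC divfK// gt_eqF.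
Qed.

Lemma gamma_integral_lty z : 0 < z ->
  (\int[mu]_(t in `]0%R, +oo[) (gamma_integrand z t)%:E < +oo)%E.
Proof.
move=> z0.
have mg A : measurable A -> measurable_fun A (fun t => (gamma_integrand z t)%:E).
  move=> mA; apply/measurable_EFinP; apply: measurable_funTS.
  exact: measurable_gamma_integrand.
have -> : (`]0, +oo[%classic : set R) = `]0, 1]%classic `|` `]1, +oo[%classic.
  by rewrite -itv_bndbnd_setU// bnd_simp.
rewrite ge0_integral_setU//=; last 3 first.
- by apply: mg; exact: measurableU.
- by move=> x _; rewrite lee_fin gamma_integrand_ge0.
- apply/disj_setPS => x []/=; rewrite !in_itv/= andbT => /andP[_ x1].
  by rewrite ltNge x1.
apply: lte_add_pinfty.
  apply: (@le_lt_trans _ _ (1 `^ z / z)%:E); last exact: ltry.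
  rewrite -integral_powR_oc//; apply: ge0_le_integral => //.
  - by move=> x _; rewrite lee_fin gamma_integrand_ge0.
  - exact: mg.
  - by apply/measurable_EFinP; apply: measurable_funTS; exact: measurable_powR.
  - move=> x; rewrite /= in_itv/= => /andP[x0 _]; rewrite lee_fin.
    rewrite ler_piMr ?powR_ge0// -[leRHS]expR0 ler_expR oppr_le0 ltW//.
(* The exponent z + 1 in [powR_le_expR] makes the integrand at most K t^(-2) on the half-line from
   1. *)
set K := (z + 1) `^ (z + 1).
apply: (@le_lt_trans _ _ (K%:E * (1 `^ (- 1) / 1)%:E)%E); last first.
  by rewrite -EFinM; exact: ltry.
rewrite -integral_powR_itvy// -ge0_integralZl_EFin//; last 3 first.
- by move=> x _; rewrite lee_fin powR_ge0.
- by apply/measurable_EFinP; apply: measurable_funTS; exact: measurable_powR.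
- exact: powR_ge0.
apply: (@le_trans _ _ (\int[mu]_(x in `[1%R, +oo[) (gamma_integrand z x)%:E)%E).
  apply: ge0_subset_integral => //; first exact: mg.
  - by move=> x _; rewrite lee_fin gamma_integrand_ge0.
  - by apply: subset_itvr; rewrite bnd_simp.
apply: ge0_le_integral => //.
- by move=> x _; rewrite lee_fin gamma_integrand_ge0.
- exact: mg.
- apply/measurable_EFinP; apply: measurable_funM => //.
  by apply: measurable_funTS; exact: measurable_powR.
- move=> x; rewrite /= in_itv/= andbT => x1; rewrite -EFinM lee_fin.
  have x0 : 0 < x by rewrite (lt_le_trans _ x1).
  rewrite /gamma_integrand (_ : z - 1 = (z + 1) + (- 1 - 1)); last by ring.
  rewrite (@gt0_powRD _ x (z + 1) (- 1 - 1))// mulrAC ler_wpM2r ?powR_ge0//.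
  by rewrite expRN ler_pdivrMr ?expR_gt0// powR_le_expR// ltr_wpDr.
Qed.

Lemma gamma_integralE z : 0 < z ->
  (\int[mu]_(t in `]0%R, +oo[) (gamma_integrand z t)%:E = (Gamma z)%:E)%E.
Proof.
move=> z0; rewrite /Gamma /Rintegral fineK// ge0_fin_numE ?gamma_integral_lty//.
by apply: integral_ge0 => x _; rewrite lee_fin gamma_integrand_ge0.
Qed.

Lemma Gamma_gt0 z : 0 < z -> 0 < Gamma z.
Proof.
move=> z0; rewrite -lte_fin -gamma_integralE//.
have mg A : measurable A -> measurable_fun A (fun t => (gamma_integrand z t)%:E).
  move=> mA; apply/measurable_EFinP; apply: measurable_funTS.
  exact: measurable_gamma_integrand.
apply: (@lt_le_trans _ _ ((expR (- 1))%:E * (1 `^ z / z)%:E)%E).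
  by rewrite -EFinM lte_fin mulr_gt0 ?expR_gt0// divr_gt0 ?powR_gt0.
rewrite -integral_powR_oc// -ge0_integralZl_EFin//; last 2 first.
- by move=> x _; rewrite lee_fin powR_ge0.
- by apply/measurable_EFinP; apply: measurable_funTS; exact: measurable_powR.
apply: (@le_trans _ _ (\int[mu]_(x in `]0%R, 1%R]) (gamma_integrand z x)%:E)%E).
  apply: ge0_le_integral => //.
  - by move=> x _; rewrite mule_ge0// lee_fin ?powR_ge0 ?expR_ge0.
  - apply/measurable_EFinP; apply: measurable_funM => //.
    by apply: measurable_funTS; exact: measurable_powR.
  - exact: mg.
  - move=> x; rewrite /= in_itv/= => /andP[x0 x1]; rewrite -EFinM lee_fin mulrC.
    by rewrite ler_wpM2l ?powR_ge0// ler_expR lerN2.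
apply: ge0_subset_integral => //; first exact: mg.
- by move=> x _; rewrite lee_fin gamma_integrand_ge0.
- by apply: subset_itvl; rewrite bnd_simp.
Qed.

Lemma integral_powR_gauss k : 0 < k ->
  (\int[mu]_(r in `]0%R, +oo[) (r `^ (k - 1) * expR (- r ^+ 2))%:E =
   (Gamma (k / 2) / 2)%:E)%E.
Proof.
move=> k0; rewrite mulrC EFinM -gamma_integralE ?divr_gt0//.
rewrite ge0_integral_sqr_oy; last 2 first.
- move=> x; rewrite in_itv/= andbT => x0; apply: cvgM.
    exact: continuous_at_powR.
  apply: (@continuous_comp _ _ _ -%R expR); first exact: opp_continuous.
  exact: continuous_expR.
- by move=> x _; exact: gamma_integrand_ge0.
rewrite -ge0_integralZl_EFin//; last 2 first.
- move=> x; rewrite /= in_itv/= andbT => x0; rewrite lee_fin mulr_ge0//.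
    exact: gamma_integrand_ge0.
  by rewrite mulr_ge0// ltW.
- apply/measurable_EFinP; apply: measurable_funM; last exact: measurable_funM.
  apply: measurable_funTS; apply: (measurableT_comp (measurable_gamma_integrand _)).
  exact: measurable_funX.
apply: eq_integral => x; rewrite inE/= in_itv/= andbT => x0.
rewrite -EFinM; congr EFin; rewrite /gamma_integrand.
rewrite (_ : 2^-1 * _ = ((x ^+ 2) `^ (k / 2 - 1) * x) * expR (- x ^+ 2)); last by field.
congr (_ * _); rewrite -powR_mulrn ?(ltW x0)// -powRrM.
rewrite -[X in _ * X](powRr1 (ltW x0)) -gt0_powRD//.
by congr (_ `^ _); field.
Qed.

Lemma Gamma_half : Gamma (1 / 2) = Num.sqrt pi :> R.
Proof.
have two0 : (2^-1 : R) != 0 by rewrite invr_eq0.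
apply: (mulIf two0); apply: EFin_inj.
rewrite -integral_powR_gauss// -(@integral0y_gauss R).
rewrite -integral_itv_obnd_cbnd; last first.
  by apply/measurable_EFinP; apply: measurable_funTS; exact: measurable_gauss_fun.
by apply: eq_integral => x _; rewrite subrr powRr0 mul1r.
Qed.

(** Read from right to left, this writes a negative power of [v] as a superposition of exponentials;
    [integral_powgap] uses it with z = 1/2. *)
Lemma integral_gamma_scale z v : 0 < z -> 0 < v ->
  (\int[mu]_(t in `]0%R, +oo[) (t `^ (z - 1) * expR (- (v * t)))%:E =
   (Gamma z * v `^ (- z))%:E)%E.
Proof.
move=> z0 v0; rewrite mulrC EFinM -gamma_integralE//.
rewrite (@ge0_integral_oy_scale v (fun t => (gamma_integrand z t)%:E))//; last 2 first.
- by apply/measurable_EFinP; exact: measurable_gamma_integrand.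
- by move=> x; rewrite lee_fin gamma_integrand_ge0.
rewrite muleA -EFinM -ge0_integralZl_EFin//; last 3 first.
- by move=> x _; rewrite lee_fin gamma_integrand_ge0.
- apply/measurable_EFinP; apply: measurable_funTS.
  by apply: (measurableT_comp (measurable_gamma_integrand _)); exact: measurable_funM.
- by rewrite mulr_ge0 ?powR_ge0// (ltW v0).
apply: eq_integral => x; rewrite inE/= in_itv/= andbT => x0.
rewrite -EFinM; congr EFin; rewrite /gamma_integrand mulrA; congr (_ * _).
rewrite powRM ?(ltW v0) ?(ltW x0)// mulrA -[X in _ * X * _ * _](powRr1 (ltW v0)).
rewrite -!gt0_powRD//.
by rewrite (_ : - z + 1 + (z - 1) = 0) ?powRr0 ?mul1r//; ring.
Qed.

End gamma.

(** * Tonelli's theorem on measurable rectangles *)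

Section tonelli_set.
Context d1 d2 (T1 : measurableType d1) (T2 : measurableType d2) (R : realType).
Variables (m1 : {sigma_finite_measure set T1 -> \bar R})
          (m2 : {sigma_finite_measure set T2 -> \bar R}).
Variables (A : set T1) (B : set T2) (f : T1 * T2 -> \bar R).
Hypotheses (mA : measurable A) (mB : measurable B).
Hypotheses (mf : measurable_fun (A `*` B) f) (f0 : forall z, (A `*` B) z -> (0 <= f z)%E).
Local Open Scope ereal_scope.

Let g := f \_ (A `*` B).

Let mg : measurable_fun setT g.
Proof. by apply/(measurable_restrictT f) => //; exact: measurableX. Qed.

Let g0 z : 0 <= g z.
Proof. by apply: erestrict_ge0. Qed.

Let gE1 x : \int[m2]_y g (x, y) = ((fun x => \int[m2]_(y in B) f (x, y)) \_ A) x.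
Proof.
rewrite patchE; case: ifPn => xA.
  rewrite [RHS]integral_mkcond; apply: eq_integral => y _.
  by rewrite /g !patchE in_setX xA.
by apply: integral0_eq => y _; rewrite /g patchE in_setX (negbTE xA).
Qed.

Let gE2 y : \int[m1]_x g (x, y) = ((fun y => \int[m1]_(x in A) f (x, y)) \_ B) y.
Proof.
rewrite patchE; case: ifPn => yB.
  rewrite [RHS]integral_mkcond; apply: eq_integral => x _.
  by rewrite /g !patchE in_setX yB andbT.
by apply: integral0_eq => x _; rewrite /g patchE in_setX (negbTE yB) andbF.
Qed.

Lemma tonelli_setX1 :
  \int[m1 \x m2]_(z in A `*` B) f z = \int[m1]_(x in A) \int[m2]_(y in B) f (x, y).
Proof.
rewrite integral_mkcond [RHS]integral_mkcond fubini_tonelli1//.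
by apply: eq_integral => x _; exact: gE1.
Qed.

Lemma tonelli_setX2 :
  \int[m1 \x m2]_(z in A `*` B) f z = \int[m2]_(y in B) \int[m1]_(x in A) f (x, y).
Proof.
rewrite integral_mkcond [RHS]integral_mkcond fubini_tonelli2//.
by apply: eq_integral => y _; exact: gE2.
Qed.

Lemma tonelli_set : \int[m1]_(x in A) \int[m2]_(y in B) f (x, y) =
  \int[m2]_(y in B) \int[m1]_(x in A) f (x, y).
Proof. by rewrite -tonelli_setX1 tonelli_setX2. Qed.

Lemma measurable_fun_tonelli_set1 :
  measurable_fun A (fun x => \int[m2]_(y in B) f (x, y)).
Proof.
apply/(measurable_restrictT _) => //; rewrite (_ : _ \_ _ = fubini_F m2 g).
  exact: measurable_fun_fubini_tonelli_F.
by apply/funext => x; rewrite -gE1.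
Qed.

Lemma measurable_fun_tonelli_set2 :
  measurable_fun B (fun y => \int[m1]_(x in A) f (x, y)).
Proof.
apply/(measurable_restrictT _) => //; rewrite (_ : _ \_ _ = fubini_G m1 g).
  exact: measurable_fun_fubini_tonelli_G.
by apply/funext => y; rewrite -gE2.
Qed.

End tonelli_set.

(** * Power inequalities and the one-dimensional constant *)

Section truncated_power.
Context {R : realType}.
Implicit Types (p s x v q : R).
Notation mu := (@lebesgue_measure R).

(** The truncated power x_+^p. For p > 0 it is continuous on the whole line, the form in which
    substitution and integration over varying intervals apply. *)
Definition pospow p x : R := Num.max x 0 `^ p.

Lemma pospow_ge0 p x : 0 <= pospow p x.
Proof. exact: powR_ge0. Qed.

Lemma pospowE p x : 0 <= x -> pospow p x = x `^ p.
Proof. by move=> x0; rewrite /pospow max_l. Qed.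

Lemma pospow_le0 p x : p != 0 -> x <= 0 -> pospow p x = 0.
Proof. by move=> p0 x0; rewrite /pospow max_r// powR0. Qed.

Lemma le_pospow p : 0 <= p -> {homo pospow p : x y / x <= y}.
Proof.
move=> p0 x y xy; apply: ge0_ler_powR => //.
- by rewrite nnegrE le_max lexx orbT.
- by rewrite nnegrE le_max lexx orbT.
- by rewrite ge_max; apply/andP; split; rewrite le_max ?xy ?lexx ?orbT.
Qed.

Lemma measurable_pospow p : measurable_fun setT (pospow p).
Proof.
apply: (measurableT_comp (measurable_powR p)).
exact: measurable_maxr.
Qed.

Lemma continuous_pospow p : 0 < p -> continuous (pospow p).
Proof.
move=> p0 x; apply/cvgrPdist_lt => e e0.
have [x0|x0] := ltP 0 x.
  have := @continuous_at_powR _ p _ x0; move/cvgrPdist_lt/(_ _ e0) => H.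
  near=> y; rewrite !pospowE ?(ltW x0)//; first by near: y.
  by apply: ltW; near: y; exact: lt_nbhsr.
have d0 : 0 < e `^ p^-1 by rewrite powR_gt0.
near=> y.
have yd : Num.max y 0 < e `^ p^-1.
  rewrite gt_max d0 andbT; near: y; apply: lt_nbhsl.
  exact: le_lt_trans d0.
rewrite (pospow_le0 (lt0r_neq0 p0) x0) sub0r normrN ger0_norm ?pospow_ge0//.
have -> : e = (e `^ p^-1) `^ p by rewrite -powRrM mulVf ?gt_eqF// powRr1 ?ltW.
by apply: gt0_ltr_powR => //; rewrite nnegrE ?(ltW d0)// le_max lexx orbT.
Unshelve. all: by end_near. Qed.

End truncated_power.

Section integral_if.
Context d (T : measurableType d) (R : realType) (mu : {measure set T -> \bar R}).

Lemma integral_if (D : set T) (b : pred T) (f : T -> \bar R) :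
  (\int[mu]_(x in D) (if b x then f x else 0) =
   \int[mu]_(x in D `&` [set x | b x]) f x)%E.
Proof.
rewrite integral_mkcondr; apply: eq_integral => x _.
by rewrite patchE mem_setE.
Qed.

End integral_if.

Section power_gap.
Context {R : realType}.
Implicit Types (p s x v q t : R).
Notation mu := (@lebesgue_measure R).

(** At v = q^2 and p = s - 1/2 this is the integrand of the regularized integral [gap_const]. *)
Definition powgap p v : R := pospow p v - pospow p (v - 1).

Lemma powgap_ge0 p v : 0 <= p -> 0 <= powgap p v.
Proof. by move=> p0; rewrite subr_ge0 le_pospow// gerBl. Qed.

Lemma measurable_powgap p : measurable_fun setT (powgap p).
Proof.
apply: measurable_funB; first exact: measurable_pospow.
by apply: (measurableT_comp (measurable_pospow p)); exact: measurable_funB.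
Qed.

Lemma measurable_expRM t : measurable_fun setT (fun v : R => expR (- (t * v))).
Proof.
apply: (measurableT_comp (@measurable_expR R)).
by apply: (measurableT_comp (@oppr_measurable _ setT)); exact: measurable_funM.
Qed.

Lemma integral_pospow_expR p t : 0 < p -> 0 < t ->
  (\int[mu]_(v in `]0%R, +oo[) (pospow p v * expR (- (t * v)))%:E =
   (Gamma (p + 1) * t `^ (- (p + 1)))%:E)%E.
Proof.
move=> p0 t0; have p1 : 0 < p + 1 by rewrite addr_gt0.
rewrite -(integral_gamma_scale p1 t0).
apply: eq_integral => v; rewrite inE/= in_itv/= andbT => v0.
by rewrite addrK pospowE// ltW.
Qed.

(** A shift by one multiplies a Laplace transform by [expR (- t)]; the integrand vanishes for v <=
    1, so the domain may be extended to the whole line before translating. *)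
Lemma integral_pospow_shift_expR p t : 0 < p -> 0 < t ->
  (\int[mu]_(v in `]0%R, +oo[) (pospow p (v - 1) * expR (- (t * v)))%:E =
   (Gamma (p + 1) * t `^ (- (p + 1)) * expR (- t))%:E)%E.
Proof.
move=> p0 t0.
have p00 := lt0r_neq0 p0.
transitivity (\int[mu]_v (pospow p (v - 1) * expR (- (t * v)))%:E)%E.
  rewrite integral_mkcond; apply: eq_integral => v _.
  rewrite patchE; case: ifPn => //; rewrite notin_setE/= in_itv/= andbT.
  move=> /negP; rewrite -leNgt => v0.
  by rewrite pospow_le0 ?mul0r// subr_le0 (le_trans v0).
rewrite (@ge0_integral_affine _ 1 1)//; last 2 first.
  apply/measurable_EFinP; apply: measurable_funM; last exact: measurable_expRM.
  by apply: (measurableT_comp (measurable_pospow p)); exact: measurable_funB.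
  by move=> v; rewrite lee_fin mulr_ge0 ?pospow_ge0 ?expR_ge0.
rewrite normr1 mul1e mulrC EFinM -integral_pospow_expR//.
rewrite -ge0_integralZl_EFin//; last 2 first.
- by move=> x _; rewrite lee_fin mulr_ge0 ?pospow_ge0 ?expR_ge0.
- apply/measurable_EFinP; apply: measurable_funTS.
  by apply: measurable_funM; [exact: measurable_pospow|exact: measurable_expRM].
rewrite [RHS]integral_mkcond; apply: eq_integral => v _.
rewrite mul1r addrK patchE; case: ifPn => [_|].
  by rewrite -EFinM mulrCA -expRD; congr (_ * expR _)%:E; ring.
rewrite notin_setE/= in_itv/= andbT => /negP; rewrite -leNgt => v0.
by rewrite pospow_le0 ?mul0r.
Qed.

Lemma integral_powgap_expR p t : 0 < p -> 0 < t ->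
  (\int[mu]_(v in `]0%R, +oo[) (powgap p v * expR (- (t * v)))%:E =
   (Gamma (p + 1) * t `^ (- (p + 1)) * (1 - expR (- t)))%:E)%E.
Proof.
move=> p0 t0.
have mE : measurable_fun (`]0, +oo[%classic : set R) (fun v : R => expR (- (t * v))).
  by apply: measurable_funTS; exact: measurable_expRM.
have : (Gamma (p + 1) * t `^ (- (p + 1)))%:E =
    (\int[mu]_(v in `]0%R, +oo[) (powgap p v * expR (- (t * v)))%:E +
     (Gamma (p + 1) * t `^ (- (p + 1)) * expR (- t))%:E)%E.
  rewrite -integral_pospow_expR// -integral_pospow_shift_expR//.
  rewrite -ge0_integralD//=.
  - apply: eq_integral => v _; rewrite -EFinD -mulrDl; congr (_ * _)%:E.
    by rewrite /powgap subrK.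
  - by move=> x _; rewrite lee_fin mulr_ge0 ?powgap_ge0 ?expR_ge0// ltW.
  - apply/measurable_EFinP; apply: measurable_funM => //.
    by apply: measurable_funTS; exact: measurable_powgap.
  - by move=> x _; rewrite lee_fin mulr_ge0 ?pospow_ge0 ?expR_ge0.
  - apply/measurable_EFinP; apply: measurable_funM => //; apply: measurable_funTS.
    by apply: (measurableT_comp (measurable_pospow p)); exact: measurable_funB.
move=> /(congr1 (fun z => z - (Gamma (p + 1) * t `^ (- (p + 1)) * expR (- t))%:E)%E).
by rewrite addeK// => <-; rewrite -EFinB mulrBr mulr1.
Qed.

Lemma integral_expRN t : 0 < t ->
  (\int[mu]_(v in `]0%R, t]) (expR (- v))%:E = (1 - expR (- t))%:E)%E.
Proof.
move=> t0; rewrite integral_itv_obnd_cbnd; last first.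
  by apply/measurable_EFinP; apply: measurable_funTS; exact: measurableT_comp.
have dF (x : R) : is_derive x 1 (fun x : R => - expR (- x)) (expR (- x)).
  have d1 : is_derive x 1 (expR \o -%R) (expR (- x) *: (- 1)).
    by apply: is_derive1_comp.
  by apply: (is_derive_eq (is_deriveN d1)); rewrite /GRing.scale/= mulrN1 opprK.
have cF : continuous (fun x : R => - expR (- x)).
  move=> x; apply/differentiable_continuous/derivable1_diffP.
  by have [] := dF x.
rewrite (@continuous_FTC2 _ _ (fun x => - expR (- x)))//.
- by rewrite oppr0 expR0 -EFinB opprK addrC.
- apply: continuous_subspaceT => x.
  apply: (@continuous_comp _ _ _ -%R expR); first exact: opp_continuous.
  exact: continuous_expR.
- split.
  + by move=> x _; have [] := dF x.
  + by apply: cvg_at_right_filter; exact: cF.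
  + by apply: cvg_at_left_filter; exact: cF.
- by move=> x _; rewrite derive1E; have [_ ->] := dF x.
Qed.

(** An integration by parts done with Tonelli: 1 - expR (- t) is the integral of expR (- v) over 0 <
    v <= t, and the inner integral in t from v to infinity is v^(-s) / s. *)
Lemma integral_powR_onem_expR s : 0 < s -> s < 1 ->
  (\int[mu]_(t in `]0%R, +oo[) (t `^ (- s - 1) * (1 - expR (- t)))%:E =
   (Gamma (1 - s) / s)%:E)%E.
Proof.
move=> s0 s1.
pose f (z : measurableTypeR R * measurableTypeR R) : \bar R :=
  if z.2 <= z.1 then (z.1 `^ (- s - 1) * expR (- z.2))%:E else 0%E.
have mf : measurable_fun ((`]0%R, +oo[%classic : set (measurableTypeR R)) `*` (`]0%R, +oo[%classic : set (measurableTypeR R))) f.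
  apply: measurable_funTS; apply: measurable_fun_ifT => //=.
    exact: measurable_fun_ler.
  apply/measurable_EFinP; apply: measurable_funM.
    by apply: (measurableT_comp (measurable_powR _)).
  apply: (measurableT_comp (@measurable_expR R)).
  exact: (measurableT_comp (@oppr_measurable _ setT)).
have f0 z : (0 <= f z)%E.
  by rewrite /f; case: ifP => // _; rewrite lee_fin mulr_ge0 ?powR_ge0 ?expR_ge0.
transitivity (\int[mu]_(t in `]0%R, +oo[) \int[mu]_(v in `]0%R, +oo[) f (t, v))%E.
  apply: eq_integral => t; rewrite inE/= in_itv/= andbT => t0.
  rewrite /f/= integral_if (_ : _ `&` _ = `]0, t]%classic); last first.
    by apply/seteqP; split=> v/=; rewrite !in_itv/= andbT; [by move=> [-> ->]|by move=> /andP[]].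
  under eq_integral do rewrite EFinM.
  rewrite ge0_integralZl_EFin//; last 2 first.
  - by apply/measurable_EFinP; apply: measurable_funTS; exact: measurableT_comp.
  - exact: powR_ge0.
  by rewrite integral_expRN// EFinM.
rewrite (tonelli_set mu mu _ _ mf (fun z _ => f0 z))//.
rewrite mulrC EFinM -gamma_integralE ?subr_gt0//.
rewrite -ge0_integralZl_EFin//; last 3 first.
- by move=> v _; rewrite lee_fin gamma_integrand_ge0.
- apply/measurable_EFinP; apply: measurable_funTS.
  exact: measurable_gamma_integrand.
- by rewrite invr_ge0 ltW.
apply: eq_integral => v; rewrite inE/= in_itv/= andbT => v0.
rewrite /f/= integral_if (_ : _ `&` _ = `[v, +oo[%classic); last first.
  apply/seteqP; split=> t/=; rewrite !in_itv/= !andbT; first by case.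
  by move=> vt; rewrite vt (lt_le_trans v0).
under eq_integral do rewrite mulrC EFinM.
rewrite ge0_integralZl_EFin ?expR_ge0//; last 2 first.
- by move=> t _; rewrite lee_fin powR_ge0.
- by apply/measurable_EFinP; apply: measurable_funTS; exact: measurable_powR.
rewrite integral_powR_itvy// -!EFinM; congr EFin; rewrite /gamma_integrand.
by rewrite (_ : 1 - s - 1 = - s); ring.
Qed.

End power_gap.

Section power_inequalities.
Context {R : realType}.
Implicit Types (a b c k x y z t : R).

Lemma is_derive_pospow a x : 0 < x ->
  is_derive x 1 (pospow a) (a * pospow (a - 1) x).
Proof.
move=> x0; have eqp : \forall z \near x, powR z a = pospow a z.
  near=> z; rewrite pospowE// ltW//; near: z; exact: lt_nbhsr.
have [d e] := @is_derive1_powR R a x x0.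
split.
  exact: near_eq_derivable eqp d.
by rewrite -(near_eq_derive _ eqp)// e pospowE// ltW.
Unshelve. all: by end_near. Qed.

(** A family closed under differentiation, so that a single derivative lemma covers the function of
    [powR_sum_le] and its first two derivatives. *)
Let G k l a y : R := k * pospow a (1 + y) + l * pospow a (1 - y).

Let is_derive_G k l a y : -1 < y < 1 ->
  is_derive y 1 (G k l a) (G (k * a) (- (l * a)) (a - 1) y).
Proof.
move=> /andP[y1 y2].
have d1 : is_derive y 1 (fun y : R => 1 + y) 1.
  have : is_derive y 1 (cst 1 + id : R -> R) (0 + 1) by exact: is_deriveD.
  by rewrite add0r.
have d2 : is_derive y 1 (fun y : R => 1 - y) (-1).
  have : is_derive y 1 (cst 1 - id : R -> R) (0 - 1) by exact: is_deriveB.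
  by rewrite add0r.
have p1 : is_derive (1 + y) 1 (pospow a) (a * pospow (a - 1) (1 + y)).
  by apply: is_derive_pospow; rewrite -ltrBlDl sub0r.
have p2 : is_derive (1 - y) 1 (pospow a) (a * pospow (a - 1) (1 - y)).
  by apply: is_derive_pospow; rewrite subr_gt0.
have c1 : is_derive y 1 (pospow a \o (fun y : R => 1 + y)) ((a * pospow (a - 1) (1 + y)) * 1) by exact: is_derive1_comp.
have c2 : is_derive y 1 (pospow a \o (fun y : R => 1 - y)) ((a * pospow (a - 1) (1 - y)) * -1) by exact: is_derive1_comp.
have : is_derive y 1 (k *: (pospow a \o (fun y : R => 1 + y)) + l *: (pospow a \o (fun y : R => 1 - y)))
  (k *: ((a * pospow (a - 1) (1 + y)) * 1) + l *: ((a * pospow (a - 1) (1 - y)) * -1)).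
  exact: is_deriveD.
rewrite /G /GRing.scale/= => h; apply: is_derive_eq h _.
by ring.
Qed.

Let derivable_G k l a y : -1 < y < 1 -> derivable (G k l a) y 1.
Proof. by move=> /is_derive_G h; have [] := h k l a. Qed.

Let within_continuous_G k l a x y : -1 < x -> y < 1 ->
  {within `[x, y], continuous (G k l a)}.
Proof.
move=> x1 y1; apply: derivable_within_continuous => z.
rewrite in_itv/= => /andP[xz zy]; apply: derivable_G.
by rewrite (lt_le_trans x1)// (le_lt_trans zy).
Qed.

Let continuous_G k l a : 0 < a -> continuous (G k l a).
Proof.
move=> a0 x; apply: cvgD; apply: cvgM; try exact: cvg_cst.
  apply: (@continuous_comp _ _ _ (fun y : R => 1 + y) (pospow a)).
    by apply: cvgD; [exact: cvg_cst|exact: cvg_id].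
  exact: continuous_pospow.
apply: (@continuous_comp _ _ _ (fun y : R => 1 - y) (pospow a)).
  by apply: cvgB; [exact: cvg_cst|exact: cvg_id].
exact: continuous_pospow.
Qed.

(** With b = a - 2 this is, up to a constant, the second derivative in [powR_sum_le]. Its own
    derivative is k b ((1 + w)^(b-1) - (1 - w)^(b-1)), a product of two nonpositive factors for w >=
    0. *)
Let G2_nondecreasing k b y z : 0 <= k -> -1 < b < 0 -> 0 <= y -> y < z -> z < 1 ->
  G k k b y <= G k k b z.
Proof.
move=> k0 /andP[b1 b0] y0 yz z1.
have dG w : w \in `]y, z[ -> is_derive w 1 (G k k b) (G (k * b) (- (k * b)) (b - 1) w).
  rewrite in_itv/= => /andP[yw wz]; apply: is_derive_G.
  by rewrite (lt_trans _ yw) ?(lt_trans wz)// (lt_le_trans _ y0)// ltrN10.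
have cG : {within `[y, z], continuous (G k k b)}.
  by apply: within_continuous_G => //; rewrite (lt_le_trans _ y0)// ltrN10.
have [w] := MVT yz dG cG.
rewrite in_itv/= => /andP[yw wz] e; rewrite -subr_ge0 e mulr_ge0//; last first.
  by rewrite subr_ge0 ltW.
have w0 : 0 <= w by rewrite (le_trans y0)// ltW.
have w1 : 0 < 1 - w by rewrite subr_gt0 (lt_trans wz).
have w2 : 0 < 1 + w by rewrite ltr_wpDr.
rewrite /G mulNr -mulrBr mulr_le0//; first by rewrite mulr_ge0_le0// ltW.
rewrite subr_le0 !pospowE ?(ltW w1) ?(ltW w2)//.
rewrite (_ : b - 1 = - (1 - b)); last by ring.
rewrite !powRN lef_pV2 ?posrE ?powR_gt0//.
apply: ge0_ler_powR; rewrite ?nnegrE ?(ltW w1) ?(ltW w2)//; first lra.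
by rewrite ltW// (lt_le_trans _ (_ : 1 <= _))//; lra.
Qed.

(* Monotone l'Hopital: with c := ((1 + x)^a + (1 - x)^a - 2) / x^2, two
   applications of Rolle's theorem give a zero below x of the second derivative
   of (1 + y)^a + (1 - y)^a - 2 - c y^2, which is nondecreasing. *)
Lemma powR_sum_le a x : 1 < a < 2 -> 0 <= x <= 1 ->
  (1 + x) `^ a + (1 - x) `^ a <= 2 + (2 `^ a - 2) * x ^+ 2.
Proof.
move=> /andP[a1 a2] /andP[x0 x1].
have [->|xn0] := eqVneq x 0.
  by rewrite subr0 addr0 powR1 expr0n/= mulr0 addr0; lra.
have [->|xn1] := eqVneq x 1.
  rewrite subrr powR0 ?gt_eqF ?(lt_trans _ a1)// expr1n mulr1 addr0.
  by rewrite (_ : 1 + 1 = 2 :> R)//; lra.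
have {}x0 : 0 < x by rewrite lt_neqAle eq_sym xn0.
have {}x1 : x < 1 by rewrite lt_neqAle xn1.
have a0 : 0 < a by rewrite (lt_trans _ a1).
have b0 : 0 < a - 1 by rewrite subr_gt0.
set c := ((1 + x) `^ a + (1 - x) `^ a - 2) / x ^+ 2.
suff h : c <= 2 `^ a - 2.
  have x20 : x ^+ 2 != 0 by rewrite expf_neq0.
  by rewrite -lerBlDl -(divfK x20 (_ - 2)) ler_wpM2r// sqr_ge0.
pose F y := G 1 1 a y - 2 - c * (y * y).
pose F' y := G a (- a) (a - 1) y - c * (2 * y).
pose F'' y := G (a * (a - 1)) (a * (a - 1)) (a - 2) y - c * 2.
have dF y : -1 < y < 1 -> is_derive y 1 F (F' y).
  move=> y1; have h := @is_derive_G 1 1 a y y1.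
  have hs : is_derive y 1 (c *: (id * id) : R -> R) (c *: (y *: 1 + y *: 1)).
    exact: is_deriveZ.
  have hd : is_derive y 1 (G 1 1 a - cst 2 - c *: (id * id) : R -> R)
      (G (1 * a) (- (1 * a)) (a - 1) y - 0 - c *: (y *: 1 + y *: 1)).
    exact: is_deriveB.
  by apply: (is_derive_eq hd); rewrite /F' /GRing.scale/= !mul1r; ring.
have dF' y : -1 < y < 1 -> is_derive y 1 F' (F'' y).
  move=> y1; have h := @is_derive_G a (- a) (a - 1) y y1.
  have hs : is_derive y 1 (c *: (2 *: id) : R -> R) (c *: (2 *: 1)).
    exact: is_deriveZ.
  have hd : is_derive y 1 (G a (- a) (a - 1) - c *: (2 *: id) : R -> R)
      (G (a * (a - 1)) (- (- a * (a - 1))) (a - 1 - 1) y - c *: (2 *: 1)).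
    exact: is_deriveB.
  apply: (is_derive_eq hd); rewrite /F'' /GRing.scale/= mulNr opprK mulr1.
  by rewrite (_ : a - 1 - 1 = a - 2)//; ring.
have cF : continuous F.
  move=> y; apply: cvgB; first by apply: cvgB; [exact: continuous_G|exact: cvg_cst].
  by apply: cvgM; [exact: cvg_cst|apply: cvgM; exact: cvg_id].
have cF' : continuous F'.
  move=> y; apply: cvgB; first exact: continuous_G.
  by apply: cvgM; [exact: cvg_cst|apply: cvgM; [exact: cvg_cst|exact: cvg_id]].
have F0 : F 0 = 0.
  by rewrite /F /G subr0 addr0 !mul1r pospowE// powR1 !mulr0 subr0; ring.
have F1 : F 1 = 2 `^ a - 2 - c.
  rewrite /F /G !mul1r subrr mulr1 pospowE// pospow_le0 ?gt_eqF//; ring.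
have Fx : F x = 0.
  rewrite /F /G !mul1r !pospowE ?subr_ge0 ?(ltW x1) ?addr_ge0 ?(ltW x0)//.
  by rewrite /c divfK ?subrr// expf_neq0.
have F'0 : F' 0 = 0.
  by rewrite /F' /G subr0 addr0 !mulr0 subr0 mulNr subrr.
have in11 y z w : 0 <= y -> z <= 1 -> w \in `]y, z[ -> -1 < w < 1.
  by rewrite in_itv/= => ? ? /andP[? ?]; apply/andP; split; lra.
have [u /[dup] u01 /[!in_itv]/= /andP[u0 ux] eu] :=
  @MVT _ F F' 0 x x0 (fun y h => dF y (in11 _ _ _ (lexx 0) (ltW x1) h))
    (continuous_subspaceT cF).
have F'u : F' u = 0.
  move: eu; rewrite Fx F0 subr0 => /esym/eqP; rewrite mulf_eq0 subr0.
  by rewrite (negbTE xn0) orbF => /eqP.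
have [v /[dup] v01 /[!in_itv]/= /andP[v0 vu] ev] :=
  @MVT _ F' F'' 0 u u0 (fun y h => dF' y (in11 _ _ _ (lexx 0) (ltW (lt_trans ux x1)) h))
    (continuous_subspaceT cF').
have F''v : F'' v = 0.
  move: ev; rewrite F'u F'0 subr0 => /esym/eqP; rewrite mulf_eq0 subr0.
  by rewrite (gt_eqF u0) orbF => /eqP.
(* To the right of x: F 1 - F x = F' t (1 - x), F' t = F'' w (t - u) and F'' w >= F'' v = 0 because
   w > v. Hence F 1 >= 0, which is the claim on c. *)
have [t /[dup] t01 /[!in_itv]/= /andP[xt t1] et] :=
  @MVT _ F F' x 1 x1 (fun y h => dF y (in11 _ _ _ (ltW x0) (lexx 1) h))
    (continuous_subspaceT cF).
have ut : u < t by rewrite (lt_trans ux).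
have [w /[dup] w01 /[!in_itv]/= /andP[uw wt] ew] :=
  @MVT _ F' F'' u t ut (fun y h => dF' y (in11 _ _ _ (ltW u0) (ltW t1) h))
    (continuous_subspaceT cF').
have F''w : 0 <= F'' w.
  rewrite -F''v lerD2r; apply: G2_nondecreasing.
  - by rewrite mulr_ge0 ?ltW.
  - by apply/andP; split; lra.
  - exact: ltW.
  - exact: lt_trans uw.
  - exact: lt_trans t1.
have F't : 0 <= F' t.
  have : F' t = F'' w * (t - u) by rewrite -ew F'u subr0.
  by move=> ->; rewrite mulr_ge0// subr_ge0 ltW.
have : 0 <= F 1 - F x by rewrite et mulr_ge0// subr_ge0 ltW.
by rewrite F1 Fx subr0 subr_ge0.
Qed.

Let convex2 a x y w : 1 <= a -> 0 <= x -> 0 <= y -> 0 <= w <= 1 ->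
  (w * x + (1 - w) * y) `^ a <= w * x `^ a + (1 - w) * y `^ a.
Proof.
move=> a1 x0 y0 /andP[w0 w1].
have := @convex_powR R a a1 (Itv01 w0 w1) x y.
by rewrite !inE/= !in_itv/= !andbT => /(_ x0 y0).
Qed.

Lemma powR_midpoint a x y : 1 <= a -> 0 <= y <= x ->
  2 * x `^ a <= (x - y) `^ a + (x + y) `^ a.
Proof.
move=> a1 /andP[y0 yx].
have xy0 : 0 <= x - y by rewrite subr_ge0.
have xy1 : 0 <= x + y by rewrite addr_ge0// (le_trans y0).
have h2 : 0 <= (2^-1 : R) <= 1 by rewrite invr_ge0 ler0n invf_le1 ?ler1n.
have := convex2 a1 xy0 xy1 h2.
rewrite (_ : 2^-1 * (x - y) + (1 - 2^-1) * (x + y) = x); last by field.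
by set u := x `^ a; lra.
Qed.

(** Both y and 2x are convex combinations of x and x + y, with complementary weights x / y and 1 - x
    / y. Adding the two convexity inequalities gives y^a + (2x)^a <= x^a + (x + y)^a. *)
Lemma powRD_ge a x y : 1 <= a -> 0 <= x <= y ->
  y `^ a + (2 `^ a - 1) * x `^ a <= (x + y) `^ a.
Proof.
move=> a1 /andP[x0 xy].
have [y0|y0] := eqVneq y 0.
  have -> : x = 0 by apply/eqP; rewrite eq_le x0 andbT -y0.
  by rewrite y0 addr0 powR0 ?mulr0 ?addr0//; apply/eqP => a0; move: a1; rewrite a0; lra.
have {}y0 : 0 < y by rewrite lt_neqAle eq_sym y0 (le_trans x0).
have w01 : 0 <= x / y <= 1.
  by rewrite divr_ge0 ?(ltW y0)//= ler_pdivrMr// mul1r.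
have w01' : 0 <= 1 - x / y <= 1 by case/andP: w01 => ? ?; apply/andP; split; lra.
have h1 := @convex2 a x (x + y) (x / y) a1 x0 (addr_ge0 x0 (ltW y0)) w01.
have h2 := @convex2 a x (x + y) (1 - x / y) a1 x0 (addr_ge0 x0 (ltW y0)) w01'.
rewrite (_ : _ * x + _ * (x + y) = y) in h1; last by field; rewrite gt_eqF.
rewrite (_ : _ * x + _ * (x + y) = 2 * x) in h2; last by field; rewrite gt_eqF.
rewrite powRM// in h2; lra.
Qed.

(* With t = (1 - z) / 2 this is [powR_sum_le]; it is scale invariant in x, y. *)
Lemma powRD_remainder a x y : 1 < a < 2 -> 0 < x -> 0 < y ->
  (4 - 2 `^ (3 - a)) * (x * y / (x + y)) * (x + y) `^ (a - 1) <=
  (x + y) `^ a - x `^ a - y `^ a.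
Proof.
move=> /[dup] a12 /andP[a1 a2].
wlog xy : x y / x <= y.
  move=> wl x0 y0; have [xy|yx] := leP x y; first exact: wl.
  have := wl y x (ltW yx) y0 x0; rewrite [y * x]mulrC [y + x]addrC => h.
  by apply: le_trans h _; rewrite addrAC.
move=> x0 y0; set z := (y - x) / (x + y).
have xy0 : 0 < x + y by rewrite addr_gt0.
have z01 : 0 <= z <= 1.
  rewrite /z divr_ge0 ?subr_ge0 ?(ltW xy0)//= ler_pdivrMr// mul1r; lra.
have := powR_sum_le a12 z01.
have -> : 1 + z = 2 / (x + y) * y by rewrite /z; field; rewrite gt_eqF.
have -> : 1 - z = 2 / (x + y) * x by rewrite /z; field; rewrite gt_eqF.
have d0 : 0 < 2 / (x + y) by rewrite divr_gt0.
rewrite !powRM ?(ltW d0) ?(ltW x0) ?(ltW y0) ?invr_ge0 ?(ltW xy0)//.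
have -> : (x + y)^-1 `^ a = ((x + y) `^ a)^-1.
  by rewrite -powR_inv1 ?(ltW xy0)// -powRrM mulN1r powRN.
have e0 : 0 < (x + y) `^ a by rewrite powR_gt0.
have t0 : 0 < 2 `^ a :> R by rewrite powR_gt0.
rewrite -mulrDr -(ler_pM2l e0) mulrA [X in X * _](_ : _ = 2 `^ a); last first.
  by field; rewrite gt_eqF.
move=> h; rewrite [2 `^ (3 - a)]gt0_powRD// powRN.
rewrite (_ : 2 `^ 3 = 8); last by rewrite (powR_mulrn 3)// -natrX.
have -> : (x + y) `^ (a - 1) = (x + y) `^ a / (x + y).
  by rewrite gt0_powRD// powR_inv1 ?(ltW xy0).
rewrite -(ler_pM2l t0).
have -> : 2 `^ a * ((4 - 8 / 2 `^ a) * (x * y / (x + y)) * ((x + y) `^ a / (x + y)))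
  = (2 `^ a - 2) * (4 * x * y / (x + y) ^+ 2) * (x + y) `^ a.
  by field; rewrite !gt_eqF.
move: h; have -> : z ^+ 2 = 1 - 4 * x * y / (x + y) ^+ 2.
  by rewrite /z; field; rewrite gt_eqF.
set A := 4 * x * y / _; set S := (x + y) `^ a; set T := 2 `^ a.
by set X := x `^ a; set Y := y `^ a; lra.
Qed.

End power_inequalities.

(** * The one-dimensional constant as a regularized integral *)

Section hardy_constant.
Context {R : realType} (s : R).
Hypotheses (s_gt : 1 / 2 < s) (s_lt : s < 1).
Implicit Types (q v t Q : R).
Notation mu := (@lebesgue_measure R).

Let p := s - 1 / 2.

(** Closed form of the integral of q^(2s-1) - (q^2 - 1)_+^(s-1/2) over q > 0. *)
Definition gap_const : R :=
  Gamma (s + 1 / 2) * Gamma (1 - s) / (2 * Num.sqrt pi * s).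

Let p0 : 0 < p. Proof. by rewrite /p subr_gt0. Qed.
Let s0 : 0 < s. Proof. by apply: lt_trans s_gt; lra. Qed.
Let sqrtpi0 : 0 < Num.sqrt (@pi R). Proof. by rewrite sqrtr_gt0 pi_gt0. Qed.

Let continuous_powgap : continuous (@powgap R p).
Proof.
move=> x; apply: cvgB; first exact: continuous_pospow.
apply: (@continuous_comp _ _ _ (fun y : R => y - 1) (pospow p)).
  by apply: cvgB; [exact: cvg_id|exact: cvg_cst].
exact: continuous_pospow.
Qed.

(** With v = q^2 the Jacobian is v^(-1/2) / 2. Writing v^(-1/2) as a Gamma integral of exponentials
    and exchanging the integrals leaves the Laplace transform of [powgap], and then
    [integral_powR_onem_expR]. *)
Lemma integral_powgap :
  (\int[mu]_(q in `]0%R, +oo[) (powgap p (q ^+ 2))%:E = gap_const%:E)%E.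
Proof.
pose h v : R := powgap p v * (2^-1 * v `^ (- (1 / 2))).
have ch : {in `]0, +oo[, continuous h}.
  move=> x; rewrite in_itv/= andbT => x0; apply: cvgM.
    exact: continuous_powgap.
  by apply: cvgM; [exact: cvg_cst|exact: continuous_at_powR].
have h0 x : 0 < x -> 0 <= h x.
  move=> _; rewrite mulr_ge0 ?powgap_ge0 ?(ltW p0)//.
  by rewrite mulr_ge0 ?powR_ge0// invr_ge0.
transitivity (\int[mu]_(v in `]0%R, +oo[) (h v)%:E)%E.
  rewrite [RHS]ge0_integral_sqr_oy//.
  apply: eq_integral => q; rewrite inE/= in_itv/= andbT => q0.
  congr EFin; rewrite /h -mulrA -[LHS]mulr1; congr (_ * _).
  rewrite -powR_mulrn ?(ltW q0)// -powRrM.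
  rewrite (_ : 2%:R * - (1 / 2) = - 1); last by field.
  by rewrite powR_inv1 ?(ltW q0)//; field; rewrite gt_eqF.
(* The factor 1/2 is that of the Jacobian and the square root of pi is Gamma (1/2). *)
pose c : R := 2^-1 * (Num.sqrt pi)^-1.
have c0 : 0 <= c by rewrite mulr_ge0 ?invr_ge0// ltW.
pose f (z : measurableTypeR R * measurableTypeR R) : \bar R :=
  (c * (powgap p z.1 * (z.2 `^ (1 / 2 - 1) * expR (- (z.1 * z.2)))))%:E.
have mf : measurable_fun ((`]0%R, +oo[%classic : set (measurableTypeR R)) `*`
    (`]0%R, +oo[%classic : set (measurableTypeR R))) f.
  apply: measurable_funTS; apply/measurable_EFinP.
  apply: measurable_funM => //; apply: measurable_funM.
    exact: (measurableT_comp (measurable_powgap p)).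
  apply: measurable_funM; first exact: (measurableT_comp (measurable_powR _)).
  apply: (measurableT_comp (@measurable_expR R)).
  apply: (measurableT_comp (@oppr_measurable _ setT)).
  exact: measurable_funM.
have f0 z : (0 <= f z)%E.
  rewrite lee_fin mulr_ge0// mulr_ge0 ?powgap_ge0 ?(ltW p0)//.
  by rewrite mulr_ge0 ?powR_ge0 ?expR_ge0.
transitivity (\int[mu]_(v in `]0%R, +oo[) \int[mu]_(t in `]0%R, +oo[) f (v, t))%E.
  apply: eq_integral => v; rewrite inE/= in_itv/= andbT => v0.
  rewrite /f/=; under eq_integral do rewrite mulrA EFinM.
  rewrite ge0_integralZl_EFin//.
  - rewrite integral_gamma_scale ?divr_gt0//.
    rewrite Gamma_half -EFinM; congr EFin; rewrite /h /c; field.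
    by rewrite gt_eqF.
  - by move=> t _; rewrite lee_fin mulr_ge0 ?powR_ge0 ?expR_ge0.
  - apply/measurable_EFinP; apply: measurable_funTS.
    by apply: measurable_funM; [exact: measurable_powR|exact: measurable_expRM].
  - by rewrite mulr_ge0 ?powgap_ge0 ?(ltW p0).
rewrite (tonelli_set mu mu _ _ mf (fun z _ => f0 z))//.
transitivity (\int[mu]_(t in `]0%R, +oo[)
  ((c * Gamma (p + 1))%:E * (t `^ (- s - 1) * (1 - expR (- t)))%:E))%E.
  apply: eq_integral => t; rewrite inE/= in_itv/= andbT => t0.
  rewrite /f/=.
  transitivity (\int[mu]_(v in `]0%R, +oo[)
    ((c * t `^ (1 / 2 - 1))%:E * (powgap p v * expR (- (t * v)))%:E))%E.
    apply: eq_integral => v _; rewrite -EFinM; congr EFin.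
    by rewrite [v * t]mulrC; ring.
  rewrite ge0_integralZl_EFin//.
  - rewrite integral_powgap_expR// -!EFinM; congr EFin.
    rewrite (_ : - s - 1 = (1 / 2 - 1) + - (p + 1)); last by rewrite /p; field.
    by rewrite [t `^ (_ - (p + 1))]gt0_powRD//; ring.
  - by move=> v _; rewrite lee_fin mulr_ge0 ?powgap_ge0 ?expR_ge0 ?(ltW p0).
  - apply/measurable_EFinP; apply: measurable_funTS.
    by apply: measurable_funM; [exact: measurable_powgap|exact: measurable_expRM].
  - by rewrite mulr_ge0 ?powR_ge0.
rewrite ge0_integralZl_EFin//.
- rewrite integral_powR_onem_expR// -EFinM; congr EFin; rewrite /gap_const /c.
  rewrite (_ : p + 1 = s + 1 / 2); last by rewrite /p; field.
  by field; rewrite !gt_eqF.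
- move=> t; rewrite /= in_itv/= andbT => t0.
  rewrite lee_fin mulr_ge0 ?powR_ge0// subr_ge0 -[leRHS]expR0 ler_expR oppr_le0.
  exact: ltW.
- apply/measurable_EFinP; apply: measurable_funTS.
  apply: measurable_funM; first exact: measurable_powR.
  by apply: measurable_funB => //; exact: measurableT_comp.
- by rewrite mulr_ge0// ltW// Gamma_gt0// addr_gt0.
Qed.

(** In effect an integral from 1 to Q. Starting at 0 makes it the complement, in Q^(2s) / (2s), of
    the integral of [powgap] over the same interval. *)
Definition shifted_power_integral Q : R :=
  fine (\int[mu]_(q in `]0%R, Q]) (pospow p (q ^+ 2 - 1))%:E)%E.

Let mpos (A : set (measurableTypeR R)) :
  measurable_fun A (fun q : R => (pospow p (q ^+ 2 - 1))%:E).
Proof.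
apply/measurable_EFinP; apply: measurable_funTS.
apply: (measurableT_comp (measurable_pospow p)); apply: measurable_funB => //.
Qed.

Let mgap (A : set (measurableTypeR R)) :
  measurable_fun A (fun q : R => (powgap p (q ^+ 2))%:E).
Proof.
apply/measurable_EFinP; apply: measurable_funTS.
apply: (measurableT_comp (measurable_powgap p)); exact: measurable_funX.
Qed.

Let integral_powgapD Q : 0 < Q ->
  (\int[mu]_(q in `]0%R, Q]) (powgap p (q ^+ 2))%:E +
  \int[mu]_(q in `]0%R, Q]) (pospow p (q ^+ 2 - 1))%:E =
  (Q `^ (2 * s) / (2 * s))%:E)%E.
Proof.
move=> Q0; rewrite -integral_powR_oc ?mulr_gt0// -ge0_integralD//; last 2 first.
- by move=> q _; rewrite lee_fin powgap_ge0 ?(ltW p0).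
- by move=> q _; rewrite lee_fin pospow_ge0.
apply: eq_integral => q; rewrite inE/= in_itv/= => /andP[q0 _].
rewrite -EFinD /powgap subrK pospowE ?sqr_ge0//; congr EFin.
rewrite -powR_mulrn ?(ltW q0)// -powRrM; congr (_ `^ _); rewrite /p; by field.
Qed.

Lemma shifted_power_integralE Q : 0 < Q ->
  (\int[mu]_(q in `]0%R, Q]) (pospow p (q ^+ 2 - 1))%:E =
   (shifted_power_integral Q)%:E)%E.
Proof.
move=> Q0; rewrite /shifted_power_integral fineK// ge0_fin_numE.
  apply: (@le_lt_trans _ _ (Q `^ (2 * s) / (2 * s))%:E); last exact: ltry.
  rewrite -integral_powgapD// leeDr// integral_ge0// => q _.
  by rewrite lee_fin powgap_ge0 ?(ltW p0).
by apply: integral_ge0 => q _; rewrite lee_fin pospow_ge0.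
Qed.

Let integral_powgap_oc Q : 0 < Q ->
  (\int[mu]_(q in `]0%R, Q]) (powgap p (q ^+ 2))%:E =
  (Q `^ (2 * s) / (2 * s) - shifted_power_integral Q)%:E)%E.
Proof.
move=> Q0; have := integral_powgapD Q0; rewrite shifted_power_integralE//.
move=> /(congr1 (fun z => z - (shifted_power_integral Q)%:E)%E).
by rewrite addeK// => ->; rewrite EFinB.
Qed.

Lemma le_gap_const Q : 0 < Q ->
  Q `^ (2 * s) / (2 * s) - shifted_power_integral Q <= gap_const.
Proof.
move=> Q0; rewrite -lee_fin -integral_powgap_oc// -integral_powgap.
apply: ge0_subset_integral => //.
- by move=> q _; rewrite lee_fin powgap_ge0 ?(ltW p0).
- by apply: subset_itvl; rewrite bnd_simp.
Qed.

Lemma gap_const_approx e : 0 < e ->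
  exists2 Q, 1 < Q &
    gap_const - e < Q `^ (2 * s) / (2 * s) - shifted_power_integral Q.
Proof.
move=> e0.
have lim : (\int[mu]_(q in `[(n.+1%:R ^- 1)%R, (n.+1%:R ^+ 1)%R]) (powgap p (q ^+ 2))%:E
    @[n --> \oo] --> gap_const%:E)%E.
  rewrite -integral_powgap; apply: (@ge0_integral_oy_cvg R 0%N); first exact: mgap.
  by move=> x _; rewrite lee_fin powgap_ge0 ?(ltW p0).
have : (\forall n \near \oo, (gap_const - e)%:E <
    \int[mu]_(q in `[(n.+1%:R ^- 1)%R, (n.+1%:R ^+ 1)%R]) (powgap p (q ^+ 2))%:E)%E.
  have lt1 : ((gap_const - e)%:E < gap_const%:E)%E by rewrite lte_fin ltrBlDr ltrDl.
  exact: (lim _ (open_ereal_gt' lt1)).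
(* The index n + 1, rather than n, yields the upper end Q = n + 2, which exceeds 1. *)
move=> [n _ /(_ n.+1)/= /(_ (leqnSn n)) hn].
exists n.+2%:R; first by rewrite ltr1n.
have n2 : 0 < n.+2%:R :> R by rewrite ltr0n.
rewrite -lte_fin -(integral_powgap_oc n2).
apply: lt_le_trans hn _; apply: ge0_subset_integral => //.
- by move=> q _; rewrite lee_fin powgap_ge0 ?(ltW p0).
- move=> x; rewrite /= !in_itv/= expr1 => /andP[h ->]; rewrite andbT.
  by rewrite (lt_le_trans _ h)// invr_gt0.
Qed.

(** For q >= 1, (q^2 - 1)^p = (q - 1)^p (q + 1)^p is at most the mean of (q - 1)^(2p) and (q +
    1)^(2p), whose primitive [F] is explicit. *)
Lemma shifted_power_integral_le Q : 1 < Q ->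
  shifted_power_integral Q <=
  ((Q - 1) `^ (2 * s) + (Q + 1) `^ (2 * s) - 2 `^ (2 * s)) / (4 * s).
Proof.
move=> Q1; have Q0 : 0 < Q by rewrite (lt_trans _ Q1).
have pp0 : 0 < 2 * p by rewrite mulr_gt0.
have ss0 : 0 < 2 * s by rewrite mulr_gt0.
rewrite -lee_fin -shifted_power_integralE//.
pose f q : R := 2^-1 * (pospow (2 * p) (q - 1) + pospow (2 * p) (q + 1)).
pose F q : R := (4 * s)^-1 * (pospow (2 * s) (q - 1) + pospow (2 * s) (q + 1)).
have cshift a c : 0 < a -> continuous (fun q : R => pospow a (q + c)).
  move=> a0 x; apply: (@continuous_comp _ _ _ (fun y : R => y + c) (pospow a)).
    by apply: cvgD; [exact: cvg_id|exact: cvg_cst].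
  exact: continuous_pospow.
have cf : continuous f.
  by move=> x; apply: cvgM; [exact: cvg_cst|apply: cvgD; exact: cshift].
have cF : continuous F.
  by move=> x; apply: cvgM; [exact: cvg_cst|apply: cvgD; exact: cshift].
have dF q : 1 < q -> is_derive q 1 F (f q).
  move=> q1.
  have dshift c : 0 < q + c -> is_derive q 1 (pospow (2 * s) \o (fun y : R => y + c))
      (2 * s * pospow (2 * s - 1) (q + c) * 1).
    move=> qc; have h1 := is_derive_pospow (2 * s) qc.
    have h2 : is_derive q 1 (id + cst c : R -> R) (1 + 0) by exact: is_deriveD.
    by rewrite addr0 in h2; exact: is_derive1_comp.
  have h1 := dshift (- 1); have h2 := dshift 1.
  have h3 : is_derive q 1 ((4 * s)^-1 *: ((pospow (2 * s) \o (fun y : R => y - 1)) +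
      (pospow (2 * s) \o (fun y : R => y + 1))))
    ((4 * s)^-1 *: (2 * s * pospow (2 * s - 1) (q - 1) * 1 +
       2 * s * pospow (2 * s - 1) (q + 1) * 1)).
    apply: is_deriveZ; apply: is_deriveD; [apply: h1|apply: h2].
      by rewrite subr_gt0.
    by rewrite addr_gt0// (lt_trans _ q1).
  apply: (is_derive_eq h3); rewrite /f /GRing.scale/=.
  rewrite (_ : 2 * p = 2 * s - 1); last by rewrite /p; field.
  by field; rewrite gt_eqF.
have FQ : (\int[mu]_(q in `[1%R, Q]) (f q)%:E = (F Q)%:E - (F 1)%:E)%E.
  apply: continuous_FTC2 => //.
  - exact: continuous_subspaceT.
  - split.
    + move=> x; rewrite in_itv/= => /andP[x1 _].
      by have [] := dF _ x1.
    + by apply: cvg_at_right_filter; exact: cF.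
    + by apply: cvg_at_left_filter; exact: cF.
  - move=> x; rewrite in_itv/= => /andP[x1 _].
    by rewrite derive1E; have [_ ->] := dF _ x1.
have -> : ((Q - 1) `^ (2 * s) + (Q + 1) `^ (2 * s) - 2 `^ (2 * s)) / (4 * s) =
    F Q - F 1.
  rewrite /F subrr [pospow _ 0]pospow_le0 ?gt_eqF// !pospowE; last 3 first.
  - by [].
  - by rewrite addr_ge0 ?(ltW Q0).
  - by rewrite subr_ge0 ltW.
  by rewrite (_ : 1 + 1 = 2)//; ring.
rewrite EFinB -FQ.
have -> : (\int[mu]_(q in `]0%R, Q]) (pospow p (q ^+ 2 - 1))%:E =
    \int[mu]_(q in `[1%R, Q]) (pospow p (q ^+ 2 - 1))%:E)%E.
  rewrite integral_mkcond [RHS]integral_mkcond; apply: eq_integral => q _.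
  rewrite !patchE !mem_setE !in_itv/=; have [q1|q1] := leP 1 q.
    by rewrite (lt_le_trans _ q1).
  case: ifP => //= /andP[q0 _]; rewrite pospow_le0 ?gt_eqF//.
  by rewrite subr_le0 expr_le1 ?ltW.
apply: ge0_le_integral => //.
- by move=> q _; rewrite lee_fin pospow_ge0.
- apply/measurable_EFinP; apply: measurable_funTS.
  exact: continuous_measurable_fun.
- move=> q; rewrite /= in_itv/= => /andP[q1 _]; rewrite lee_fin /f.
  have a0 : 0 <= q - 1 by rewrite subr_ge0.
  have b0 : 0 <= q + 1 by rewrite addr_ge0// (le_trans _ q1).
  rewrite (_ : q ^+ 2 - 1 = (q - 1) * (q + 1)); last by ring.
  rewrite !pospowE ?mulr_ge0// powRM// ![2 * p]mulrC !powRrM.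
  rewrite !(powR_mulrn 2) ?powR_ge0//.
  have := sqr_ge0 ((q - 1) `^ p - (q + 1) `^ p).
  by set A := (q - 1) `^ p; set B := (q + 1) `^ p; nra.
Qed.

(** This amounts to [kappa1] being nonnegative. [powR_sum_le] at 1 / Q bounds (Q + 1)^(2s) + (Q -
    1)^(2s) by 2 Q^(2s) plus a multiple of Q^(2s-2); the terms Q^(2s) cancel and the rest vanishes
    as Q grows. *)
Lemma gap_const_ge : 2 `^ (2 * s - 1) / (2 * s) <= gap_const.
Proof.
have e0 : 0 < 2 - 2 * s by move: s_lt; lra.
have ss : 1 < 2 * s < 2 by apply/andP; split; move: s_lt s_gt; lra.
have two_s : 2 `^ (2 * s - 1) = 2 `^ (2 * s) / 2 :> R.
  by rewrite gt0_powRD// powR_inv1.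
pose K : R := (2 `^ (2 * s) - 2) / (4 * s).
have bound Q : 1 < Q ->
    2 `^ (2 * s - 1) / (2 * s) - gap_const <= K * Q `^ (- (2 - 2 * s)).
  move=> Q1; have Q0 : 0 < Q by rewrite (lt_trans _ Q1).
  have h1 := le_gap_const Q0; have h2 := shifted_power_integral_le Q1.
  have x01 : 0 <= Q^-1 <= 1 by rewrite invr_ge0 (ltW Q0) invf_le1 ?ltW.
  have := powR_sum_le ss x01; rewrite -(ler_pM2l (powR_gt0 (2 * s) Q0)).
  have -> : 1 + Q^-1 = (Q + 1) / Q by field; rewrite gt_eqF.
  have -> : 1 - Q^-1 = (Q - 1) / Q by field; rewrite gt_eqF.
  rewrite !powRM ?invr_ge0 ?(ltW Q0) ?subr_ge0 ?(ltW Q1) ?addr_ge0 ?(ltW Q0)//.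
  have -> : Q^-1 `^ (2 * s) = (Q `^ (2 * s))^-1.
    by rewrite -powR_inv1 ?(ltW Q0)// -powRrM mulN1r powRN.
  have q0 : 0 < Q `^ (2 * s) by rewrite powR_gt0.
  rewrite mulrDr mulrCA mulfV ?gt_eqF// mulr1 mulrCA mulfV ?gt_eqF// mulr1.
  rewrite (_ : - (2 - 2 * s) = 2 * s + - 2%:R); last by ring.
  rewrite [Q `^ (_ - 2%:R)]gt0_powRD// powRN (powR_mulrn 2) ?(ltW Q0)// two_s exprVn.
  set A := (Q + 1) `^ _; set B := (Q - 1) `^ _; set C := Q `^ _ => h3.
  have s40 : 0 < 4 * s by rewrite mulr_gt0.
  rewrite -(ler_pM2l s40) /K.
  have h4 := h1; rewrite -(ler_pM2l s40) in h4.
  have h5 := h2; rewrite -(ler_pM2l s40) in h5.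
  have -> : 4 * s * ((2 `^ (2 * s) - 2) / (4 * s) * (C * Q ^- 2)) =
    C * ((2 `^ (2 * s) - 2) * Q ^- 2) by field; rewrite !gt_eqF.
  have e5 : 4 * s * ((B + A - 2 `^ (2 * s)) / (4 * s)) = B + A - 2 `^ (2 * s).
    by field; rewrite gt_eqF.
  rewrite e5 in h5.
  have e4 : 4 * s * (C / (2 * s) - shifted_power_integral Q) =
    2 * C - 4 * s * shifted_power_integral Q by field; rewrite gt_eqF.
  rewrite e4 in h4.
  have -> : 4 * s * (2 `^ (2 * s) / 2 / (2 * s) - gap_const) =
    2 `^ (2 * s) - 4 * s * gap_const by field; rewrite gt_eqF.
  rewrite mulrDr in h3.
  by move: h3 h4 h5; set T := C * (_ * _); set U := 4 * s * gap_const;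
    set V := 4 * s * shifted_power_integral Q; lra.
(* A positive defect would lie below K Q^(-(2-2s)) for every Q > 1, a quantity that tends to 0. *)
rewrite -subr_le0 leNgt; apply/negP => D0.
set D := _ - gap_const in D0 bound.
have lim0 : K * Q `^ (- (2 - 2 * s)) @[Q --> +oo] --> (0 : R).
  by rewrite -(mulr0 K); apply: cvgM; [exact: cvg_cst|exact: powRN_cvgy].
have : \forall Q \near +oo, (K * Q `^ (- (2 - 2 * s)) < D) /\ 1 < Q.
  near=> Q; split; last by near: Q; exact: nbhs_pinfty_gt.
  near: Q; exact: (cvgr_lt _ lim0).
case/filter_ex => Q [h Q1]; have := bound _ Q1.
by rewrite leNgt h.
Unshelve. all: by end_near. Qed.

End hardy_constant.

(** * Polar coordinates and spherical moments *)

Section enorm_facts.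
Context {R : realType} {N : nat}.
Implicit Types (x y z : 'rV[R]_N) (c : R).

Lemma enorm_ge0 x : 0 <= enorm x.
Proof. exact: sqrtr_ge0. Qed.

Lemma enormZ c x : enorm (c *: x) = `|c| * enorm x.
Proof.
rewrite /enorm -sqrtr_sqr -sqrtrM ?sqr_ge0// mulr_sumr; congr Num.sqrt.
by apply: eq_bigr => i _; rewrite mxE exprMn.
Qed.

Lemma enormN x : enorm (- x) = enorm x.
Proof. by rewrite -scaleN1r enormZ normrN1 mul1r. Qed.

Lemma enorm_sqr x : enorm x ^+ 2 = \sum_i x ord0 i ^+ 2.
Proof. by rewrite sqr_sqrtr// sumr_ge0// => i _; rewrite sqr_ge0. Qed.

Lemma enorm_eq0 x : enorm x = 0 -> x = 0.
Proof.
move=> x0; have := enorm_sqr x; rewrite x0 expr0n/= => /esym/eqP.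
rewrite psumr_eq0 => [/allP h|i _]; last exact: sqr_ge0.
apply/rowP => i; rewrite mxE; apply/eqP; rewrite -sqrf_eq0.
by apply: h; rewrite mem_index_enum.
Qed.

Lemma enorm0 : enorm (0 : 'rV[R]_N) = 0.
Proof. by rewrite -(scale0r 0) enormZ normr0 mul0r. Qed.

Lemma enorm_gt0 x : (0 < enorm x) = (x != 0).
Proof.
rewrite lt_neqAle enorm_ge0 andbT eq_sym; congr negb.
by apply/eqP/eqP => [/enorm_eq0//|->]; exact: enorm0.
Qed.

(** At the origin the inverse of 0 is 0, so [dir 0] is 0; the origin is excluded wherever a unit
    vector is meant. *)
Definition dir z := (enorm z)^-1 *: z.

Lemma enorm_dir z : 0 < enorm z -> enorm (dir z) = 1.
Proof.
by move=> z0; rewrite enormZ gtr0_norm ?invr_gt0// mulVf// gt_eqF.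
Qed.

Lemma dirN z : dir (- z) = - dir z.
Proof. by rewrite /dir enormN scalerN. Qed.

(** Integrals over the unit sphere are encoded as N times integrals over this punctured ball of
    functions of [dir z]; this is the cone definition of the surface measure. *)
Definition pball : set 'rV[R]_N := [set z | 0 < enorm z <= 1].

Lemma mem_pball z : (z \in pball) = (0 < enorm z <= 1).
Proof. by apply/idP/idP; rewrite inE. Qed.

Lemma mem_punctured z : (z \in [set y : 'rV[R]_N | 0 < enorm y]) = (0 < enorm z).
Proof. by apply/idP/idP; rewrite inE. Qed.

Lemma measurable_dir : measurable_fun setT dir.
Proof.
apply: measurable_funZ_rV => //.
rewrite (_ : (fun x => _) = (@powR R ^~ (- 1)) \o @enorm R N); last first.
  by apply/funext => x /=; rewrite powR_inv1 ?enorm_ge0.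
exact: (measurableT_comp (measurable_powR _) (@measurable_enorm R N)).
Qed.

Lemma measurable_pball : measurable pball.
Proof.
have := @measurable_enorm R N measurableT `]0, 1]%classic (measurable_itv _).
by rewrite setTI.
Qed.

Lemma measurable_punctured : measurable [set y : 'rV[R]_N | 0 < enorm y].
Proof.
have := @measurable_enorm R N measurableT `]0, +oo[%classic (measurable_itv _).
rewrite setTI; congr measurable.
by apply/seteqP; split=> y/=; rewrite in_itv/= andbT.
Qed.

End enorm_facts.

Section polar.
Context {R : realType} (N : nat).
Hypothesis N0 : (0 < N)%N.
Notation mu := (@lebesgue_measure R).
Notation leb := (@lebesgue_rV R N).
Variable g : 'rV[R]_N -> R.
Hypotheses (mg : measurable_fun setT g) (g0 : forall y, 0 <= g y).
Local Notation N' := (N%:R : R).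

Let ray (r : R) (w : 'rV[R]_N) : R := r `^ (N' - 1) * g (r *: w).

Let ray_ge0 r w : 0 <= ray r w.
Proof. by rewrite mulr_ge0 ?powR_ge0. Qed.

Let N'0 : 0 < N'. Proof. by rewrite ltr0n. Qed.

Let f1 (z : 'rV[R]_N * measurableTypeR R) : R := enorm z.1 `^ N' * ray z.2 z.1.

Let measurable_ray d (T : measurableType d) (r : T -> R) (w : T -> 'rV[R]_N) :
  measurable_fun setT r -> measurable_fun setT w ->
  measurable_fun setT (fun t => ray (r t) (w t)).
Proof.
move=> mr mw; apply: measurable_funM.
  exact: (measurableT_comp (measurable_powR _) mr).
by apply: (measurableT_comp mg); exact: measurable_funZ_rV.
Qed.

Let mf1 : measurable_fun setT f1.
Proof.
apply: measurable_funM; last exact: measurable_ray.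
apply: (measurableT_comp (measurable_powR _)).
exact: (measurableT_comp (@measurable_enorm R N)).
Qed.

Let f2 (z : measurableTypeR R * 'rV[R]_N) : R :=
  if enorm z.2 <= z.1 then z.1 `^ (- N' - 1) * (enorm z.2 `^ N' * g z.2) else 0.

Let mf2 : measurable_fun setT f2.
Proof.
apply: measurable_fun_ifT => //=.
  apply: measurable_fun_ler => //.
  exact: (measurableT_comp (@measurable_enorm R N)).
apply: measurable_funM.
  exact: (measurableT_comp (measurable_powR _)).
apply: measurable_funM; last exact: (measurableT_comp mg).
apply: (measurableT_comp (measurable_powR _)).
exact: (measurableT_comp (@measurable_enorm R N)).
Qed.

Let f2_ge0 z : 0 <= f2 z.
Proof. by rewrite /f2; case: ifP => // _; rewrite !mulr_ge0 ?powR_ge0. Qed.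

Let E : set 'rV[R]_N := [set y | 0 < enorm y].

(** Only scaling is used. Replacing r by |z| r turns the right side into an integral of |z|^N
    r^(N-1) g (r z); for fixed r, put y = r z. The ball condition becomes r >= |y|, and N times the
    integral of r^(-N-1) from |y| on is |y|^(-N), which cancels the factor |y|^N. *)
Lemma polar_coordinates :
  (\int[leb]_(y in [set y | 0 < enorm y]%R) (g y)%:E =
   N'%:E * \int[leb]_(z in pball)
     \int[mu]_(r in `]0%R, +oo[) (r `^ (N' - 1) * g (r *: dir z))%:E)%E.
Proof.
have mD := @measurable_pball R N.
transitivity (N'%:E * \int[leb]_(z in pball)
     \int[mu]_(r in `]0%R, +oo[) (f1 (z, r))%:E)%E; last first.
  congr (_ * _)%E; apply: eq_integral => z; rewrite inE => /andP[z0 z1].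
  rewrite [RHS](@ge0_integral_oy_scale _ (enorm z) (fun r => (ray r (dir z))%:E))//; last 2 first.
  - apply/measurable_EFinP; exact: measurable_ray.
  - by move=> r; rewrite lee_fin ray_ge0.
  rewrite -ge0_integralZl_EFin ?enorm_ge0//; last 2 first.
  - by move=> r _; rewrite lee_fin ray_ge0.
  - apply/measurable_EFinP; apply: measurable_funTS; apply: measurable_ray => //.
  apply: eq_integral => r; rewrite inE/= in_itv/= andbT => r0.
  rewrite -EFinM; congr EFin; rewrite /f1 /ray/= /dir scalerA.
  rewrite [enorm z * r]mulrC mulfK ?gt_eqF// [r * _]mulrC powRM ?enorm_ge0 ?(ltW r0)//.
  rewrite !mulrA; congr (_ * _ * _).
  by rewrite mulr_powRB1 ?enorm_ge0.
rewrite (@tonelli_set _ _ _ _ _ leb mu _ _ (EFin \o f1))//; last 2 first.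
- by apply: measurable_funTS; exact/measurable_EFinP.
- by move=> z _; rewrite lee_fin mulr_ge0 ?powR_ge0.
transitivity (N'%:E * \int[mu]_(r in `]0%R, +oo[) \int[leb]_(y in E) (f2 (r, y))%:E)%E; last first.
  congr (_ * _)%E; apply: eq_integral => r; rewrite inE/= in_itv/= andbT => r0.
  have mP : measurable_fun setT ((fun z => (f1 (z, r))%:E) \_ pball).
    apply/(measurable_restrictT (fun z => (f1 (z, r))%:E)) => //.
    apply: measurable_funTS; apply/measurable_EFinP; apply: (measurableT_comp mf1).
    exact: pair2_measurable.
  have P0 z : (0 <= ((fun z => (f1 (z, r))%:E) \_ pball) z)%E.
    by apply: erestrict_ge0 => y _; rewrite lee_fin mulr_ge0 ?powR_ge0.
  have mA : measurable_fun setT (fun y : 'rV[R]_N => r^-1 *: y + 0).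
    by apply: measurable_funD_rV => //; exact: measurable_funZ_rV.
  rewrite [RHS]integral_mkcond (@ge0_integral_rV_affine _ _ r^-1 0)//; last first.
    by rewrite invr_neq0// gt_eqF.
  rewrite -ge0_integralZl_EFin//; last first.
    exact: (measurableT_comp mP mA).
  rewrite [LHS]integral_mkcond; apply: eq_integral => y _.
  rewrite !patchE addr0 mem_pball mem_punctured enormZ gtr0_norm ?invr_gt0//.
  rewrite pmulr_rgt0 ?invr_gt0// ler_pdivrMl// mulr1 /f2/=.
  case: ltP => y0 /=; last by rewrite mule0.
  case: leP => yr; last by rewrite mule0.
  rewrite -EFinM; congr EFin; rewrite /f1 /ray/= scalerA mulfV ?gt_eqF// scale1r.
  have rN : r^-1 `^ N' = r `^ (- N') by rewrite -powR_inv1 ?(ltW r0)// -powRrM mulN1r.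
  rewrite enormZ gtr0_norm ?invr_gt0// powRM ?invr_ge0 ?(ltW r0) ?enorm_ge0// rN.
  rewrite -powR_mulrn ?invr_ge0 ?(ltW r0)// rN.
  rewrite (_ : - N' - 1 = - N' + - N' + (N' - 1)); last by ring.
  by rewrite [in LHS]gt0_powRD// [r `^ (- N' + - N')]gt0_powRD//; ring.
rewrite (@tonelli_set _ _ _ _ _ mu leb _ _ (EFin \o f2))//; last 3 first.
- exact: measurable_punctured.
- by apply: measurable_funTS; exact/measurable_EFinP.
- by move=> z _; rewrite lee_fin.
rewrite -ge0_integralZl_EFin//; last 3 first.
- exact: measurable_punctured.
- by move=> y _; apply: integral_ge0 => r _; rewrite lee_fin.
- apply: (@measurable_fun_tonelli_set2 _ _ _ _ _ mu _ E (EFin \o f2)) => //.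
  + exact: measurable_punctured.
  + by apply: measurable_funTS; exact/measurable_EFinP.
  + by move=> z _; rewrite lee_fin.
apply: eq_integral => y; rewrite inE => y0; rewrite /f2 /=.
transitivity (N'%:E * \int[mu]_(r in `]0%R, +oo[) (if (enorm y <= r)%R then (r `^ (- N' - 1) * (enorm y `^ N' * g y))%:E else 0))%E; last first.
  by congr (_ * _)%E; apply: eq_integral => r _; case: ifP.
rewrite integral_if (_ : _ `&` _ = `[enorm y, +oo[%classic); last first.
  apply/seteqP; split=> r/=; rewrite !in_itv/= !andbT; first by case.
  by move=> yr; rewrite yr (lt_le_trans y0).
under eq_integral do rewrite mulrC EFinM.
rewrite ge0_integralZl_EFin//; last 3 first.
- by move=> r _; rewrite lee_fin powR_ge0.
- by apply/measurable_EFinP; apply: measurable_funTS; exact: measurable_powR.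
- by rewrite mulr_ge0 ?powR_ge0.
rewrite integral_powR_itvy// -!EFinM; congr EFin; rewrite powRN.
by field; rewrite !gt_eqF ?powR_gt0.
Qed.

End polar.

Section dot_product.
Context {R : realType} {N : nat}.
Implicit Types (x y z v e : 'rV[R]_N) (c : R).

Definition dotp x y : R := \sum_i x ord0 i * y ord0 i.

Lemma dotpC x y : dotp x y = dotp y x.
Proof. by apply: eq_bigr => i _; rewrite mulrC. Qed.

Lemma dotpDl x y z : dotp (x + y) z = dotp x z + dotp y z.
Proof. by rewrite -big_split; apply: eq_bigr => i _; rewrite mxE mulrDl. Qed.

Lemma dotpZl c x z : dotp (c *: x) z = c * dotp x z.
Proof. by rewrite mulr_sumr; apply: eq_bigr => i _; rewrite mxE mulrA. Qed.

Lemma dotpNl x z : dotp (- x) z = - dotp x z.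
Proof. by rewrite -scaleN1r dotpZl mulN1r. Qed.

Lemma dotpBl x y z : dotp (x - y) z = dotp x z - dotp y z.
Proof. by rewrite dotpDl dotpNl. Qed.

Lemma dotpDr x y z : dotp z (x + y) = dotp z x + dotp z y.
Proof. by rewrite !(dotpC z) dotpDl. Qed.

Lemma dotpZr c x z : dotp z (c *: x) = c * dotp z x.
Proof. by rewrite !(dotpC z) dotpZl. Qed.

Lemma dotpBr x y z : dotp z (x - y) = dotp z x - dotp z y.
Proof. by rewrite !(dotpC z) dotpBl. Qed.

Lemma dotpp x : dotp x x = enorm x ^+ 2.
Proof. by rewrite enorm_sqr; apply: eq_bigr => i _; rewrite expr2. Qed.

Lemma measurable_dotp v : measurable_fun setT (fun x => dotp x v).
Proof.
apply: measurable_sum => i; apply: measurable_funM => //.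
exact: measurable_coor.
Qed.

Lemma cauchy_schwarz x y : dotp x y <= enorm x * enorm y.
Proof.
have [->|y0] := eqVneq y 0.
  by rewrite enorm0 mulr0 -(scale0r 0) dotpZr mul0r.
have [->|x0] := eqVneq x 0.
  by rewrite enorm0 mul0r -(scale0r 0) dotpZl mul0r.
have a0 : 0 < enorm x by rewrite enorm_gt0.
have b0 : 0 < enorm y by rewrite enorm_gt0.
(* This square equals 2 |x| |y| (|x| |y| - x.y). *)
have : 0 <= dotp (enorm y *: x - enorm x *: y) (enorm y *: x - enorm x *: y).
  by rewrite dotpp sqr_ge0.
rewrite !(dotpBl, dotpBr, dotpZl, dotpZr) !dotpp (dotpC y x) => h.
have h2 : 0 <= 2 * (enorm x * enorm y) * (enorm x * enorm y - dotp x y).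
  by apply: le_trans h _; rewrite le_eqVlt; apply/orP; left; apply/eqP; ring.
by rewrite -subr_ge0 -(pmulr_rge0 _ (_ : 0 < 2 * (enorm x * enorm y)))// !mulr_gt0.
Qed.

Lemma ler_enormD x y : enorm (x + y) <= enorm x + enorm y.
Proof.
rewrite -(@ler_pXn2r _ 2)// ?nnegrE ?addr_ge0 ?enorm_ge0//.
rewrite -dotpp !(dotpDl, dotpDr) !dotpp (dotpC y x).
have := cauchy_schwarz x y; nra.
Qed.

(** Reflection in the hyperplane orthogonal to [v]; for v = 0 it is the identity. *)
Definition reflection v x := x - (2 * dotp x v / dotp v v) *: v.

Lemma enorm_reflection v x : enorm (reflection v x) = enorm x.
Proof.
apply/eqP; rewrite -(@eqrXn2 _ 2) ?enorm_ge0// -!dotpp; apply/eqP.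
rewrite /reflection; have [->|v0] := eqVneq v 0; first by rewrite scaler0 subr0.
have vv : dotp v v != 0 by rewrite dotpp expf_neq0// gt_eqF// enorm_gt0.
by rewrite !(dotpBl, dotpBr, dotpZl, dotpZr) (dotpC v x); field.
Qed.

Lemma reflectionB v x y : reflection v (x - y) = reflection v x - reflection v y.
Proof.
by rewrite /reflection dotpBl; apply/rowP => i; rewrite !mxE; ring.
Qed.

Lemma reflectionK v : involutive (reflection v).
Proof.
move=> x; have [->|v0] := eqVneq v 0; first by rewrite /reflection !scaler0 !subr0.
have vv : dotp v v != 0 by rewrite dotpp expf_neq0// gt_eqF// enorm_gt0.
rewrite /reflection dotpBl dotpZl -addrA -opprD -scalerDl.
set k := (X in X *: v); have -> : k = 0 by rewrite /k; field.
by rewrite scale0r subr0.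
Qed.

(** The reflection along e - f exchanges the unit vectors [e] and [f]. The computation rests on (e -
    f).f = - |e - f|^2 / 2. *)
Lemma dotp_reflection e f x : enorm e = 1 -> enorm f = 1 ->
  dotp (reflection (e - f) x) f = dotp x e.
Proof.
move=> e1 f1; rewrite /reflection; set v := e - f.
have [v0|v0] := eqVneq v 0.
  by rewrite v0 scaler0 subr0; congr dotp; apply/eqP; rewrite eq_sym -subr_eq0 -/v v0.
have vv : dotp v v != 0 by rewrite dotpp expf_neq0// gt_eqF// enorm_gt0.
rewrite dotpBl dotpZl.
have vf : dotp v f = - (dotp v v / 2).
  rewrite /v !(dotpBl, dotpBr) !dotpp e1 f1 (dotpC f e); by field.
by rewrite vf /v dotpBr -/v; field.
Qed.

Lemma measurable_reflection v : measurable_fun setT (reflection v).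
Proof.
apply: measurable_funB_rV => //; apply: measurable_funZ_rV => //.
apply: measurable_funM => //; apply: measurable_funM => //.
exact: measurable_dotp.
Qed.

End dot_product.

(** * Gaussian integrals and invariance under isometries *)

Section gaussian.
Context {R : realType}.
Notation mu := (@lebesgue_measure R).
Local Notation sqrtpi := (Num.sqrt (@pi R)).

Lemma enorm_rV_cons n (x : R) (v : 'rV[R]_n) :
  enorm (rV_cons (x, v)) ^+ 2 = x ^+ 2 + enorm v ^+ 2.
Proof.
rewrite !enorm_sqr big_ord_recl mxE unlift_none; congr (_ + _).
by apply: eq_bigr => i _; rewrite mxE liftK.
Qed.

Lemma measurable_gauss_rV n :
  measurable_fun setT (fun v : 'rV[R]_n => expR (- enorm v ^+ 2)).
Proof.
apply: (measurableT_comp (@measurable_expR R)).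
apply: (measurableT_comp (@oppr_measurable _ setT)).
by apply: measurable_funX; exact: measurable_enorm.
Qed.

Lemma integral_gauss_rV n :
  (\int[lebesgue_rV n]_v (expR (- enorm v ^+ 2))%:E = (sqrtpi ^+ n)%:E)%E.
Proof.
elim: n => [|n ih].
  rewrite integral_dirac//= ?diracE ?mem_set// ?mul1e.
    by rewrite enorm0 expr0n/= oppr0 expR0 expr0.
  by have := @measurable_gauss_rV 0 => /measurable_EFinP; exact.
rewrite ge0_integral_rV_cons//; last first.
  by apply/measurable_EFinP; exact: measurable_gauss_rV.
transitivity (\int[mu]_x ((sqrtpi ^+ n)%:E * (gauss_fun x)%:E))%E.
  apply: eq_integral => x _; rewrite -ih muleC -ge0_integralZl_EFin ?expR_ge0//.
  - apply: eq_integral => v _.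
    by rewrite -EFinM enorm_rV_cons opprD expRD.
  - by apply/measurable_EFinP; exact: measurable_gauss_rV.
rewrite ge0_integralZl_EFin//.
- by rewrite integralT_gauss -EFinM exprSr.
- by move=> x _; rewrite lee_fin expR_ge0.
- by apply/measurable_EFinP; exact: measurable_gauss_fun.
Qed.

Let measurable_moment b : measurable_fun setT (fun x : R => `|x| `^ b * expR (- x ^+ 2)).
Proof.
apply: measurable_funM.
  exact: (measurableT_comp (measurable_powR b) (@normr_measurable R setT)).
exact: measurable_gauss_fun.
Qed.

Lemma integral_moment_gauss b : 0 <= b ->
  (\int[mu]_x (`|x| `^ b * expR (- x ^+ 2))%:E = (Gamma ((1 + b) / 2))%:E)%E.
Proof.
move=> b0; set f := fun x : R => (`|x| `^ b * expR (- x ^+ 2))%:E.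
have mf : measurable_fun setT f by exact/measurable_EFinP.
have f0 x : (0 <= f x)%E by rewrite lee_fin mulr_ge0 ?powR_ge0 ?expR_ge0.
have half : (\int[mu]_(x in `]0%R, +oo[) f x = (Gamma ((1 + b) / 2) / 2)%:E)%E.
  have b1 : 0 < 1 + b by rewrite ltr_wpDr.
  rewrite -(integral_powR_gauss b1).
  apply: eq_integral => x; rewrite inE/= in_itv/= andbT => x0.
  by rewrite /f gtr0_norm// addrAC subrr add0r.
have -> : [set: R] = `]-oo, 0[%classic `|` `[0, +oo[%classic.
  by rewrite -itv_bndbnd_setU// set_itvNyy.
rewrite ge0_integral_setU//=; last 2 first.
- exact: measurable_funTS.
- apply/disj_setPS => x []/=; rewrite !in_itv/= andbT => x0.
  by rewrite leNgt x0.
rewrite -[X in (_ + X)%E]integral_itv_obnd_cbnd; last exact: measurable_funTS.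
have -> : (\int[mu]_(x in `]-oo, 0%R[) f x = \int[mu]_(x in `]0%R, +oo[) f x)%E.
  rewrite integral_mkcond (@ge0_integral_affine _ (-1) 0); last 3 first.
  - by rewrite oppr_eq0 oner_neq0.
  - by apply/(measurable_restrictT f) => //; exact: measurable_funTS.
  - by move=> x; apply: erestrict_ge0.
  rewrite normrN1 mul1e [RHS]integral_mkcond; apply: eq_integral => x _.
  rewrite !patchE !mem_setE !in_itv/= andbT addr0 mulN1r oppr_lt0.
  by rewrite /f normrN sqrrN.
by rewrite half -EFinD -splitr.
Qed.

Lemma integral_coord_gauss_rV n b : 0 <= b ->
  (\int[lebesgue_rV n.+1]_v (`|v ord0 ord0| `^ b * expR (- enorm v ^+ 2))%:E =
   (Gamma ((1 + b) / 2) * sqrtpi ^+ n)%:E)%E.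
Proof.
move=> b0.
have mf : measurable_fun setT (fun v : 'rV[R]_n.+1 =>
    `|v ord0 ord0| `^ b * expR (- enorm v ^+ 2)).
  apply: measurable_funM; last exact: measurable_gauss_rV.
  apply: (measurableT_comp (measurable_powR b)).
  exact: (measurableT_comp (@normr_measurable R setT) (measurable_coor _)).
rewrite ge0_integral_rV_cons//; last exact/measurable_EFinP.
transitivity (\int[mu]_x ((sqrtpi ^+ n)%:E * (`|x| `^ b * expR (- x ^+ 2))%:E))%E.
  apply: eq_integral => x _.
  rewrite -integral_gauss_rV.
  rewrite muleC.
  rewrite -ge0_integralZl_EFin; last 4 first.
  - by [].
  - by move=> v _; rewrite lee_fin expR_ge0.
  - by apply/measurable_EFinP; exact: measurable_gauss_rV.
  - by rewrite mulr_ge0 ?powR_ge0 ?expR_ge0.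
  apply: eq_integral => v _.
  rewrite -EFinM enorm_rV_cons opprD expRD mulrA.
  by rewrite mxE unlift_none.
rewrite ge0_integralZl_EFin//.
- by rewrite integral_moment_gauss// -EFinM mulrC.
- by apply/measurable_EFinP; exact: measurable_moment.
Qed.

End gaussian.

Section isometry.
Context {R : realType} {N : nat}.
Notation leb := (@lebesgue_rV R N).
Variable T : 'rV[R]_N -> 'rV[R]_N.
Hypotheses (mT : measurable_fun setT T) (TK : involutive T)
  (TB : forall x y, T (x - y) = T x - T y) (TN : forall x, enorm (T x) = enorm x).

Let ge0_integral_translate (w : 'rV[R]_N) (f : 'rV[R]_N -> R) :
  measurable_fun setT f -> (forall x, 0 <= f x) ->
  (\int[leb]_v (f v)%:E = \int[leb]_v (f (v + w)%R)%:E)%E.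
Proof.
move=> mf f0; rewrite (@ge0_integral_rV_affine _ _ 1 w)//.
- by rewrite normr1 expr1n mul1e; apply: eq_integral => v _; rewrite scale1r.
- exact/measurable_EFinP.
Qed.

(* Comparing the integral of [f (T x) g y], [g] Gaussian, before and after
   translating first x by T y and then y by - T x, only the translation invariance of
   the Lebesgue measure is needed. *)
Lemma ge0_integral_isometry (f : 'rV[R]_N -> R) :
  measurable_fun setT f -> (forall x, 0 <= f x) ->
  (\int[leb]_v (f (T v))%:E = \int[leb]_v (f v)%:E)%E.
Proof.
move=> mf f0.
have T0 : T 0 = 0 by have := TB 0 0; rewrite !subrr.
have TNN x : T (- x) = - T x by rewrite -sub0r TB T0 sub0r.
have TD x y : T (x + y) = T x + T y by rewrite -[y in LHS]opprK TB TNN opprK.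
pose g (v : 'rV[R]_N) := expR (- enorm v ^+ 2).
have mg : measurable_fun setT g by exact: measurable_gauss_rV.
have g0 v : 0 <= g v by exact: expR_ge0.
have mfT : measurable_fun setT (f \o T) by exact: measurableT_comp.
have gI : (\int[leb]_v (g v)%:E = (Num.sqrt pi ^+ N)%:E)%E.
  exact: integral_gauss_rV.
pose c : R := Num.sqrt pi ^+ N.
have c0 : 0 < c by rewrite exprn_gt0// sqrtr_gt0 pi_gt0.
suff : (\int[leb]_v (f (T v))%:E * c%:E = \int[leb]_v (f v)%:E * c%:E)%E.
  move/(congr1 (fun z => z * (c^-1)%:E)%E).
  by rewrite -!muleA -EFinM mulfV ?gt_eqF// !mule1.
transitivity (\int[leb]_y \int[leb]_x (f (T x) * g y)%:E)%E.
  rewrite /c -gI muleC -ge0_integralZr//; last 3 first.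
  - exact/measurable_EFinP.
  - by move=> v _; rewrite lee_fin.
  - by apply: integral_ge0 => v _; rewrite lee_fin.
  apply: eq_integral => y _; rewrite muleC.
  under [RHS]eq_integral do rewrite mulrC EFinM.
  rewrite ge0_integralZl_EFin// 1?muleC//.
  - by move=> v _; rewrite lee_fin.
  - exact/measurable_EFinP.
transitivity (\int[leb]_y \int[leb]_x (f (T x + y) * g y)%:E)%E.
  apply: eq_integral => y _.
  rewrite (ge0_integral_translate (T y)); last 2 first.
  - by apply: measurable_funM.
  - by move=> x; rewrite mulr_ge0.
  by apply: eq_integral => x _; rewrite TD TK.
have mTD : measurable_fun setT (fun z : 'rV[R]_N * 'rV[R]_N => T z.1 + z.2).
  by apply: measurable_funD_rV => //; exact: measurableT_comp.
have mTB : measurable_fun setT (fun z : 'rV[R]_N * 'rV[R]_N => z.2 - T z.1).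
  by apply: measurable_funB_rV => //; exact: measurableT_comp.
rewrite -(fubini_tonelli (fun z => (f (T z.1 + z.2) * g z.2)%:E)); last 2 first.
- apply/measurable_EFinP; apply: measurable_funM.
    exact: (measurableT_comp mf mTD).
  exact: (measurableT_comp mg).
- by move=> z; rewrite lee_fin mulr_ge0.
transitivity (\int[leb]_x \int[leb]_y (f y * g (y - T x))%:E)%E.
  apply: eq_integral => x _ /=.
  rewrite (ge0_integral_translate (- T x)); last 2 first.
  - apply: measurable_funM => //; apply: (measurableT_comp mf).
    exact: measurable_funD_rV.
  - by move=> y; rewrite mulr_ge0.
  by apply: eq_integral => y _; rewrite addrC subrK.
rewrite (fubini_tonelli (fun z => (f z.2 * g (z.2 - T z.1))%:E)); last 2 first.
- apply/measurable_EFinP; apply: measurable_funM.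
    exact: (measurableT_comp mf).
  exact: (measurableT_comp mg mTB).
- by move=> z; rewrite lee_fin mulr_ge0.
rewrite muleC -ge0_integralZl_EFin//; last 3 first.
- by move=> v _; rewrite lee_fin.
- exact/measurable_EFinP.
- exact: ltW.
apply: eq_integral => y _ /=.
under eq_integral do rewrite EFinM.
rewrite ge0_integralZl_EFin//; last 2 first.
- by move=> v _; rewrite lee_fin.
- apply/measurable_EFinP; apply: (measurableT_comp mg).
  exact: measurable_funB_rV.
rewrite muleC; congr (_ * _)%E; rewrite /c -gI.
(* As T is an isometric involution, |y - T x| = |T y - x|, and the Gaussian mass is unchanged by the
   substitution of T y - x. *)
rewrite (@ge0_integral_rV_affine _ _ (-1) (T y)); last 3 first.
- by rewrite oppr_eq0 oner_neq0.
- exact/measurable_EFinP.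
- by move=> v; rewrite lee_fin.
rewrite normrN1 expr1n mul1e; apply: eq_integral => x _.
congr EFin; rewrite /g -(TN (y - T x)) TB TK scaleN1r.
by rewrite addrC.
Qed.

End isometry.

Section sphere.
Context {R : realType} (n : nat).
Local Notation N := n.+1.
Notation leb := (@lebesgue_rV R N).
Local Notation sqrtpi := (Num.sqrt (@pi R)).
Local Notation N' := (N%:R : R).

Let N'0 : 0 < N'. Proof. by rewrite ltr0n. Qed.

Lemma negligible_origin : leb [set 0] = 0%E.
Proof.
have := @lebesgue_rV_box R N (fun=> [set 0]) (fun i => measurable_set1 0).
rewrite big_ord_recl lebesgue_measure_set1 mul0e => <-.
congr (lebesgue_rV _ _); apply/seteqP; split=> [x -> i|x h]/=.
  by rewrite mxE.
by apply/rowP => i; rewrite mxE; exact: h.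
Qed.

Lemma ge0_integral_punctured (f : 'rV[R]_N -> R) :
  measurable_fun setT f -> (forall x, 0 <= f x) ->
  (\int[leb]_x (f x)%:E = \int[leb]_(x in [set y | 0 < enorm y]%R) (f x)%:E)%E.
Proof.
move=> mf f0; rewrite (@ge0_negligible_integral _ _ _ _ _ ([set 0] : set 'rV[R]_N))//; last 4 first.
- rewrite -[X in measurable X]setCK; apply: measurableC.
  rewrite (_ : ~` _ = [set y | 0 < enorm y]); first exact: measurable_punctured.
  by apply/seteqP; split=> x /=; rewrite enorm_gt0 => /eqP.
- exact/measurable_EFinP.
- by move=> x _; rewrite lee_fin.
- exact: negligible_origin.
congr (integral leb _ _); apply/seteqP; split=> x /=; rewrite enorm_gt0.
  by move=> [_ /eqP].
by move=> /eqP.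
Qed.

(** The integral of |w.e|^b over the unit sphere of dimension n, for any unit vector e; b = 0 gives
    its area. *)
Definition sphere_moment (b : R) : R :=
  2 * sqrtpi ^+ n * Gamma ((1 + b) / 2) / Gamma ((N' + b) / 2).

Lemma sphere_moment_gt0 b : 0 <= b -> 0 < sphere_moment b.
Proof.
move=> b0; rewrite divr_gt0 ?mulr_gt0 ?exprn_gt0 ?sqrtr_gt0 ?pi_gt0 ?Gamma_gt0//.
- by rewrite divr_gt0// ltr_wpDr.
- by rewrite divr_gt0// ltr_wpDr.
Qed.

Lemma measurable_dir_coor b :
  measurable_fun setT (fun z : 'rV[R]_N => `|dir z ord0 ord0| `^ b).
Proof.
apply: (measurableT_comp (measurable_powR b)).
apply: (measurableT_comp (@normr_measurable R setT)).
exact: (measurableT_comp (measurable_coor _) (@measurable_dir R N)).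
Qed.

(** The Gaussian moment of the first coordinate is computed twice: as a product of one-dimensional
    integrals, and in polar coordinates, where the radial factor is Gamma ((N + b) / 2) / 2. *)
Lemma integral_dir_coor b : 0 <= b ->
  (N'%:E * \int[leb]_(z in pball) (`|dir z ord0 ord0| `^ b)%:E =
   (sphere_moment b)%:E)%E.
Proof.
move=> b0; have g0 : 0 < Gamma ((N' + b) / 2).
  by rewrite Gamma_gt0// divr_gt0// ltr_wpDr.
have mg : measurable_fun setT (fun v : 'rV[R]_N =>
    `|v ord0 ord0| `^ b * expR (- enorm v ^+ 2)).
  apply: measurable_funM; last exact: measurable_gauss_rV.
  apply: (measurableT_comp (measurable_powR b)).
  exact: (measurableT_comp (@normr_measurable R setT) (measurable_coor _)).
have := @integral_coord_gauss_rV R n b b0.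
rewrite ge0_integral_punctured// polar_coordinates//.
have -> : (\int[leb]_(z in pball) \int[lebesgue_measure]_(r in `]0%R, +oo[)
    (r `^ (N' - 1) * (`|(r *: dir z) ord0 ord0| `^ b * expR (- enorm (r *: dir z) ^+ 2)))%:E =
  (Gamma ((N' + b) / 2) / 2)%:E * \int[leb]_(z in pball) (`|dir z ord0 ord0| `^ b)%:E)%E.
  rewrite -ge0_integralZl_EFin//; last 3 first.
  - exact: measurable_pball.
  - by apply/measurable_EFinP; apply: measurable_funTS; exact: measurable_dir_coor.
  - by rewrite divr_ge0// ltW.
  apply: eq_integral => z; rewrite inE => /andP[z0 z1].
  have Nb : 0 < N' + b by rewrite ltr_wpDr.
  rewrite -(integral_powR_gauss Nb) muleC -ge0_integralZl_EFin//; last first.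
    apply/measurable_EFinP; apply: measurable_funTS; apply: measurable_funM.
      exact: measurable_powR.
    exact: measurable_gauss_fun.
    by move=> r _; rewrite lee_fin mulr_ge0 ?powR_ge0 ?expR_ge0.
  apply: eq_integral => r; rewrite inE/= in_itv/= andbT => r0.
  rewrite -EFinM enormZ enorm_dir// mulr1 (gtr0_norm r0) [(r *: dir z) _ _]mxE normrM (gtr0_norm r0).
  rewrite powRM ?(ltW r0)// (_ : N' + b - 1 = (N' - 1) + b); last by ring.
  by rewrite [in RHS]gt0_powRD//; congr EFin; ring.
rewrite muleCA => /(congr1 (fun z => (2 / Gamma ((N' + b) / 2))%:E * z)%E).
have e1 : 2 / Gamma ((N' + b) / 2) * (Gamma ((N' + b) / 2) / 2) = 1.
  by field; rewrite gt_eqF.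
rewrite (muleA (2 / _)%:E (_ / 2)%:E) -(EFinM (2 / _) (_ / 2)) e1 mul1e => ->.
by rewrite -EFinM /sphere_moment; congr EFin; field; rewrite gt_eqF.
Qed.

(** The reflection that exchanges [e] with the first basis vector preserves both the ball and the
    Lebesgue measure. *)
Lemma integral_dir_dotp b (e : 'rV[R]_N) : 0 <= b -> enorm e = 1 ->
  (N'%:E * \int[leb]_(z in pball) (`|dotp (dir z) e| `^ b)%:E =
   (sphere_moment b)%:E)%E.
Proof.
move=> b0 e1; rewrite -(integral_dir_coor b0); apply: (congr1 (mule _)).
pose e0 : 'rV[R]_N := delta_mx ord0 ord0.
have dote0 x : dotp x e0 = x ord0 ord0.
  rewrite /dotp big_ord_recl big1 ?addr0 => [|i _]; rewrite mxE eqxx/= ?mulr1//.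
  by rewrite mulr0.
have e01 : enorm e0 = 1.
  by apply/eqP; rewrite -(@eqrXn2 _ 2) ?enorm_ge0// -dotpp dote0 mxE !eqxx expr1n.
pose T := reflection (e - e0).
pose f (z : 'rV[R]_N) : R := if 0 < enorm z <= 1 then `|dotp (dir z) e0| `^ b else 0.
have mf : measurable_fun setT f.
  apply: measurable_fun_ifT => //=.
    apply: measurable_and.
      by apply: measurable_fun_ltr => //; exact: measurable_enorm.
    by apply: measurable_fun_ler => //; exact: measurable_enorm.
  apply: (measurableT_comp (measurable_powR b)).
  apply: (measurableT_comp (@normr_measurable R setT)).
  exact: (measurableT_comp (measurable_dotp _) (@measurable_dir R N)).
have f0 z : 0 <= f z by rewrite /f; case: ifP => // _; exact: powR_ge0.
transitivity (\int[leb]_z (f (T z))%:E)%E.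
  rewrite integral_mkcond; apply: eq_integral => z _.
  rewrite patchE mem_pball /f enorm_reflection; case: ifP => // _.
  congr (`|_| `^ _)%:E; rewrite /dir enorm_reflection !dotpZl.
  by rewrite dotp_reflection.
rewrite (ge0_integral_isometry (T := T))//.
- rewrite [RHS]integral_mkcond; apply: eq_integral => z _.
  by rewrite patchE mem_pball /f; case: ifP => // _; rewrite dote0.
- exact: measurable_reflection.
- exact: reflectionK.
- exact: reflectionB.
- exact: enorm_reflection.
Qed.

Lemma surface_measure_unit_sphere :
  surface_measure (@unit_sphere R N) = (N'%:E * leb pball)%E.
Proof.
rewrite /surface_measure; congr (_ * leb _)%E; apply/seteqP; split=> z /=.
  move=> [r]; rewrite in_itv/= => /andP[r0 r1] [x x1 <-].
  by rewrite /pball/= enormZ x1 mulr1 gtr0_norm// r0.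
move=> /andP[z0 z1]; exists (enorm z); first by rewrite /= in_itv/= z0.
by exists (dir z); [exact: enorm_dir|rewrite /dir scalerA mulfV ?gt_eqF// scale1r].
Qed.

Lemma lebesgue_pball : (N'%:E * leb pball = (sphere_moment 0)%:E)%E.
Proof.
rewrite -integral_dir_coor//; congr (_ * _)%E.
under eq_integral do rewrite powRr0.
by rewrite integral_cst ?mul1e//; exact: measurable_pball.
Qed.

Lemma sphere_areaE : sphere_area R N = sphere_moment 0.
Proof. by rewrite /sphere_area surface_measure_unit_sphere lebesgue_pball. Qed.

End sphere.

(** * Gauges of bounded convex sets *)

Section gauge.
Context {R : realType} {N : nat} (Omega : set 'rV[R]_N).
Hypotheses (oO : open Omega) (cO : convex_set Omega).
Implicit Types (x y v : 'rV[R]_N) (l c : R).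

(* The Minkowski functional of Omega - x, set to 0 for x outside Omega so that
   it is jointly measurable in x and v. *)
Definition gauge x v : R :=
  inf [set l | 0 < l /\ (Omega x -> Omega (x + l^-1 *: v))].

Local Notation S x v := [set l | 0 < l /\ (Omega x -> Omega (x + l^-1 *: v))].

Lemma convex_set_comb x y w : Omega x -> Omega y -> 0 <= w <= 1 ->
  Omega (w *: x + (1 - w) *: y).
Proof.
move=> Ox Oy /andP[w0 w1].
have := cO (Itv01 w0 w1) (mem_set Ox) (mem_set Oy).
by rewrite inE.
Qed.

Let near_line x v : Omega x -> \forall t \near (0 : R), Omega (x + t *: v).
Proof.
move=> Ox; have : nbhs x Omega by exact: open_nbhs_nbhs.
have : (fun t : R => x + t *: v) t @[t --> (0:R)] --> x + (0:R) *: v.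
  by apply: cvgD; [exact: cvg_cst|apply: cvgZr_tmp; exact: cvg_id].
by rewrite scale0r addr0; apply.
Qed.

Let line_convex x v s t : Omega x -> Omega (x + t *: v) -> 0 <= s <= t ->
  Omega (x + s *: v).
Proof.
move=> Ox Ot /andP[s0 st]; have [t0|t0] := eqVneq t 0.
  by move: s0 st; rewrite t0 => s0 sle; have -> : s = 0; [lra|rewrite scale0r addr0].
have {}t0 : 0 < t by rewrite lt_neqAle eq_sym t0 (le_trans s0).
have w01 : 0 <= s / t <= 1 by rewrite divr_ge0 ?(ltW t0)//= ler_pdivrMr// mul1r.
have := convex_set_comb Ot Ox w01; congr Omega.
by apply/rowP => i; rewrite !mxE; field; rewrite gt_eqF.
Qed.

Let S_nonempty x v : S x v !=set0.
Proof.
have [Ox|nOx] := pselect (Omega x); last by exists 1; split.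
have /nbhs_ballP[e /= e0 eO] := near_line v Ox.
exists (2 / e); split; first by rewrite divr_gt0.
move=> _; apply: eO; rewrite /ball/= sub0r normrN invf_div gtr0_norm ?divr_gt0//.
by rewrite ltr_pdivrMr// ltr_pMr// ltr1n.
Qed.

Let S_lb x v : has_lbound (S x v).
Proof. by exists 0 => l [/ltW]. Qed.

Lemma gauge_ge0 x v : 0 <= gauge x v.
Proof. by apply: lb_le_inf => // l [/ltW]. Qed.

(** Convexity fills the segment up to any attained point; openness lets an attained point be pushed
    slightly further, which makes the inequality strict. Outside Omega the gauge is 0 and both sides
    hold. *)
Lemma gauge_lt x v l : 0 < l ->
  (gauge x v < l) <-> (Omega x -> Omega (x + l^-1 *: v)).
Proof.
move=> l0; split=> [gl Ox|h].
  have [l' [l'0 /(_ Ox) h] l'l] := inf_lt (S_nonempty x v) gl.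
  apply: (line_convex Ox h); rewrite invr_ge0 (ltW l0) lef_pV2 ?posrE//.
  exact: ltW.
have [Ox|nOx] := pselect (Omega x); last first.
  apply: (@le_lt_trans _ _ (l / 2)); last by rewrite ltr_pdivrMr// ltr_pMr// ltr1n.
  by apply: inf_lbound => //; split=> //; rewrite divr_gt0.
have /nbhs_ballP[e /= e0 eO] := near_line v (h Ox).
pose l' := (l^-1 + e / 2)^-1.
have l'i : 0 < l^-1 + e / 2 by rewrite addr_gt0 ?invr_gt0 ?divr_gt0.
apply: (@le_lt_trans _ _ l').
  apply: inf_lbound => //; split=> [|_]; first by rewrite invr_gt0.
  rewrite invrK scalerDl addrA; apply: eO.
  rewrite /ball/= sub0r normrN gtr0_norm ?divr_gt0//.
  by rewrite ltr_pdivrMr// ltr_pMr// ltr1n.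
rewrite /l' invf_plt ?posrE//.
by rewrite ltrDl divr_gt0.
Qed.

Lemma gauge_ltP x v t : Omega x -> 0 < t -> (gauge x v * t < 1) <-> Omega (x + t *: v).
Proof.
move=> Ox t0; have := @gauge_lt x v t^-1; rewrite invr_gt0 invrK => /(_ t0).
by rewrite -ltr_pdivlMr// div1r => -[h1 h2]; split => [/h1/(_ Ox)|h]; [|exact: h2].
Qed.

(** Identities between gauges reduce in this way to equivalences of membership in Omega, through
    [gauge_lt]. *)
Let eq_by_lt (a b : R) : 0 <= a -> 0 <= b -> (forall l, 0 < l -> a < l <-> b < l) -> a = b.
Proof.
move=> a0 b0 h; apply/eqP; rewrite eq_le; apply/andP; split; apply/ler_addgt0Pl => e e0.
  have be0 : 0 < e + b by rewrite ltr_pwDl.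
  have be : b < e + b by rewrite ltrDr.
  exact: (ltW ((h _ be0).2 be)).
have ae0 : 0 < e + a by rewrite ltr_pwDl.
have ae : a < e + a by rewrite ltrDr.
exact: (ltW ((h _ ae0).1 ae)).
Qed.

Lemma gaugeZ x v c : 0 < c -> gauge x (c *: v) = c * gauge x v.
Proof.
move=> c0; apply: eq_by_lt => [||l l0]; rewrite ?mulr_ge0 ?gauge_ge0 ?(ltW c0)//.
rewrite gauge_lt// scalerA -ltr_pdivlMl// gauge_lt ?mulr_gt0 ?invr_gt0//.
by rewrite invfM invrK mulrC.
Qed.

(** In units of [v], the boundary ahead is at distance 1 / M from x, hence at 1 / M - 1 from x + v,
    where M is the gauge at x. *)
Lemma gauge_forward x v : Omega x -> Omega (x + v) ->
  gauge (x + v) v = gauge x v / (1 - gauge x v).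
Proof.
move=> Ox Oy; have := gauge_ltP v Ox ltr01; rewrite mulr1 scale1r => -[_ /(_ Oy) g1].
have g10 : 0 < 1 - gauge x v by rewrite subr_gt0.
apply: eq_by_lt => [||l l0]; rewrite ?divr_ge0 ?gauge_ge0 ?(ltW g10)//.
rewrite gauge_lt// ltr_pdivrMr// -addrA -[X in X + _ *: _]scale1r -scalerDl.
have t0 : 0 < 1 + l^-1 by rewrite addr_gt0 ?invr_gt0.
have -> : (gauge x v < l * (1 - gauge x v)) = (gauge x v * (1 + l^-1) < 1).
  set g := gauge x v; have e : l * (g * (1 + l^-1)) = g * l + g.
    by field; rewrite gt_eqF.
  by rewrite -[RHS](ltr_pM2l l0) e mulr1; apply/idP/idP; lra.
by rewrite gauge_ltP//; split=> [/(_ Oy)|].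
Qed.

(** In the direction opposite to [v], the distance to the boundary grows by one unit. *)
Lemma gauge_backward x v : Omega x -> Omega (x + v) ->
  gauge (x + v) (- v) = gauge x (- v) / (1 + gauge x (- v)).
Proof.
move=> Ox Oy; have g0 := gauge_ge0 x (- v).
have g10 : 0 < 1 + gauge x (- v) by rewrite ltr_wpDr.
apply: eq_by_lt => [||l l0]; rewrite ?divr_ge0 ?gauge_ge0 ?(ltW g10)//.
rewrite gauge_lt// ltr_pdivrMr// -addrA scalerN.
(* For l >= 1 the point x + v - v / l lies on the segment from x to x + v, so both sides are
   true. *)
have [l1|l1] := leP 1 l.
  split=> [_|_ _]; first by nra.
  rewrite -[X in X - _ *: _]scale1r -scalerBl.
  have Oy1 : Omega (x + 1 *: v) by rewrite scale1r.
  apply: (line_convex Ox Oy1); rewrite subr_ge0 gerBl invr_ge0 (ltW l0) andbT.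
  by rewrite invf_le1.
have t0 : 0 < l^-1 - 1 by rewrite subr_gt0 invf_gt1.
have -> : v - l^-1 *: v = (l^-1 - 1) *: - v.
  by rewrite scalerN -scaleNr opprB scalerBl scale1r.
have -> : (gauge x (- v) < l * (1 + gauge x (- v))) = (gauge x (- v) * (l^-1 - 1) < 1).
  set g := gauge x (- v); have e : l * (g * (l^-1 - 1)) = g - g * l.
    by field; rewrite gt_eqF.
  by rewrite -[RHS](ltr_pM2l l0) e mulr1; apply/idP/idP; lra.
by rewrite gauge_ltP//; split=> [/(_ Oy)|].
Qed.

(** For l > 0 the sublevel set is the union of the pairs with x outside Omega and of those with x +
    v / l in Omega; the value 0 outside Omega gives it this simple form. *)
Lemma measurable_gauge :
  measurable_fun setT (fun z : 'rV[R]_N * 'rV[R]_N => gauge z.1 z.2).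
Proof.
apply: (measurability _ (RGenInftyO.measurableE R)) => _ [_ [l ->] <-].
rewrite setTI; have [l0|l0] := leP l 0.
  rewrite (_ : _ @^-1` _ = set0)//; apply/seteqP; split=> z //=.
  by rewrite in_itv/= => /lt_le_trans/(_ l0); rewrite ltNge gauge_ge0.
have mO : measurable Omega by exact: open_measurable_rV.
have m1 : measurable [set z : 'rV[R]_N * 'rV[R]_N | Omega z.1].
  by have := @measurable_fst _ _ 'rV[R]_N 'rV[R]_N measurableT _ mO; rewrite setTI.
have mf : measurable_fun setT (fun z : 'rV[R]_N * 'rV[R]_N => z.1 + l^-1 *: z.2).
  by apply: measurable_funD_rV => //; exact: measurable_funZ_rV.
have m2 := mf measurableT _ mO; rewrite setTI in m2.
rewrite (_ : _ @^-1` _ = ~` [set z | Omega z.1] `|`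
    (fun z : 'rV[R]_N * 'rV[R]_N => z.1 + l^-1 *: z.2) @^-1` Omega).
  by apply: measurableU => //; exact: measurableC.
apply/seteqP; split=> z /=; rewrite in_itv/=.
  move/(gauge_lt _ _ l0) => h; have [Oz|nOz] := pselect (Omega z.1); [right|by left].
  exact: h.
by move=> h; apply/(gauge_lt _ _ l0) => Oz; case: h.
Qed.

End gauge.

Section norms.
Context {R : realType} {N : nat}.
Implicit Types (x y : 'rV[R]_N).

Lemma coor_le_norm x i : `|x ord0 i| <= `|x|.
Proof.
have /mapP[j Hj ->] : `|x ord0 i| \in [seq `|x k.1 k.2| | k : 'I_1 * 'I_N].
  by apply/mapP; exists (ord0, i) => //=; rewrite mem_enum.
by rewrite [leRHS]/Num.norm /= mx_normrE; apply/bigmax_geP; right => /=; exists j.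
Qed.

Lemma coor_le_enorm x i : `|x ord0 i| <= enorm x.
Proof.
rewrite -(@ler_pXn2r _ 2)// ?nnegrE ?enorm_ge0// real_normK ?num_real//.
rewrite enorm_sqr (bigD1 i)//= lerDl sumr_ge0// => j _; exact: sqr_ge0.
Qed.

Lemma norm_le_enorm x : `|x| <= enorm x.
Proof.
rewrite [leLHS]/Num.norm /= mx_normrE; apply/bigmax_leP; split=> [|[i j] _ /=].
  exact: enorm_ge0.
by rewrite (ord1 i) coor_le_enorm.
Qed.

Lemma enorm_le_norm x : enorm x <= N%:R * `|x|.
Proof.
have h0 : 0 <= N%:R * `|x| by rewrite mulr_ge0.
rewrite -(@ler_pXn2r _ 2)// ?nnegrE ?enorm_ge0// enorm_sqr.
apply: (@le_trans _ _ (\sum_(i < N) `|x| ^+ 2)).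
  apply: ler_sum => i _; rewrite -(@real_normK _ (x ord0 i)) ?num_real//.
  by rewrite lerXn2r ?nnegrE// coor_le_norm.
rewrite sumr_const card_ord -[leLHS]mulr_natl exprMn ler_wpM2r ?sqr_ge0//.
rewrite -natrX ler_nat; case: (N) => // k.
by rewrite expnS expn1 leq_pmulr.
Qed.

Lemma continuous_enorm : continuous (@enorm R N).
Proof.
have le1 (a b : 'rV[R]_N) : enorm a - enorm b <= enorm (a - b).
  by rewrite lerBlDr -[a in leLHS](subrK b) ler_enormD.
move=> x A /nbhs_ballP[e /= e0 eA]; apply/nbhs_ballP.
have e'0 : 0 < e / N.+1%:R by rewrite divr_gt0.
exists (e / N.+1%:R) => //= y; rewrite -ball_normE /= => h; apply: eA.
have h2 : enorm (x - y) < e.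
  apply: (le_lt_trans (enorm_le_norm _)).
  apply: (@le_lt_trans _ _ (N.+1%:R * `|x - y|)).
    by rewrite ler_wpM2r// ler_nat.
  by rewrite mulrC -ltr_pdivlMr.
rewrite /ball /= ltr_norml; apply/andP; split; last exact: le_lt_trans (le1 _ _) h2.
rewrite ltrNl opprB; apply: le_lt_trans (le1 _ _) _.
by rewrite -enormN opprB.
Qed.

End norms.

Section bounded_convex.
Context {R : realType} {N : nat} (Omega : set 'rV[R]_N).
Hypotheses (oO : open Omega) (cO : convex_set Omega) (bO : bounded_set Omega).
Implicit Types (x y v w : 'rV[R]_N) (l c d e : R).

Let bound : exists2 M : R, 0 < M & forall x, Omega x -> enorm x <= M.
Proof.
have [M [_ /(_ (M + 1))]] := bO; rewrite ltrDl ltr01 => /(_ isT) h.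
exists (N%:R * `|M + 1| + 1); first by rewrite ltr_wpDl// mulr_ge0.
move=> x /h/= xM; apply: (le_trans (enorm_le_norm _)).
rewrite (@le_trans _ _ (N%:R * `|M + 1|)) ?lerDl//.
by rewrite ler_wpM2l// (le_trans xM)// ler_norm.
Qed.

Lemma enorm_le_diam x y : Omega x -> Omega y -> enorm (x - y) <= diam Omega.
Proof.
move=> Ox Oy; apply: sup_ubound; last by exists x => //; exists y.
have [M M0 h] := bound; exists (M + M) => _ [a Oa [b Ob <-]].
by rewrite (le_trans (ler_enormD _ _))// enormN lerD ?h.
Qed.

(** The sum of the two inverses is the length of the chord through x. It is first bounded with
    numbers slightly above the two gauges, whose inverses give points of Omega. *)
Lemma gauge_gt0_diam x w : Omega x -> enorm w = 1 ->
  0 < gauge Omega x w /\ (gauge Omega x w)^-1 + (gauge Omega x (- w))^-1 <= diam Omega.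
Proof.
move=> Ox w1.
have key l l' : gauge Omega x w < l -> gauge Omega x (- w) < l' ->
    l^-1 + l'^-1 <= diam Omega.
  move=> gl gl'; have l0 := le_lt_trans (gauge_ge0 oO _ _) gl.
  have l'0 := le_lt_trans (gauge_ge0 oO _ _) gl'.
  have h1 := (gauge_lt oO cO x w l0).1 gl Ox.
  have h2 := (gauge_lt oO cO x (- w) l'0).1 gl' Ox.
  have := enorm_le_diam h1 h2.
  have -> : x + l^-1 *: w - (x + l'^-1 *: - w) = (l^-1 + l'^-1) *: w.
    by apply/rowP => i; rewrite !mxE; ring.
  by rewrite enormZ w1 mulr1 ger0_norm// addr_ge0// invr_ge0 ltW.
(* A gauge equal to 0 would put a point of Omega at distance diam + 1 from x. *)
have pos v : enorm v = 1 -> (forall l l', gauge Omega x v < l -> gauge Omega x (- v) < l' ->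
    l^-1 + l'^-1 <= diam Omega) -> 0 < gauge Omega x v.
  move=> v1 hk; rewrite lt_neqAle (gauge_ge0 oO) andbT; apply/eqP => g0.
  pose l' := gauge Omega x (- v) + 1.
  have l'0 : 0 < l' by rewrite ltr_wpDl ?(gauge_ge0 oO).
  have D0 : 0 <= diam Omega.
    by rewrite (le_trans _ (enorm_le_diam Ox Ox))// enorm_ge0.
  have := hk (diam Omega + 1)^-1 l'.
  rewrite -g0 invr_gt0 ltr_wpDl// ltrDl ltr01 invrK => /(_ isT isT).
  by have := l'0; rewrite -invr_gt0; lra.
have g1 := pos _ w1 key.
have g2 : 0 < gauge Omega x (- w).
  apply: pos; first by rewrite enormN.
  by rewrite opprK => l l' h h'; rewrite addrC key.
split=> //; apply/ler_addgt0Pr => e e0.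
set a := gauge _ _ w in g1 key *; set b := gauge _ _ (- w) in g2 key *.
have D0 : 0 <= diam Omega.
  by rewrite (le_trans _ (enorm_le_diam Ox Ox))// enorm_ge0.
(* Enlarging both gauges by the factor 1 + t costs diam t <= e. *)
pose t := e / (diam Omega + 1).
have t0 : 0 < t by rewrite divr_gt0// ltr_wpDl.
have := key (a * (1 + t)) (b * (1 + t)).
rewrite !ltr_pMr// ltrDl t0 => /(_ isT isT).
rewrite !invfM -mulrDl -ler_pdivlMr ?invr_gt0 ?ltr_wpDl ?(ltW t0)// invrK => h.
apply: (le_trans h); rewrite mulrDr mulr1 lerD2l /t mulrA ler_pdivrMr ?ltr_wpDl//.
by rewrite mulrC ler_wpM2l ?(ltW e0)// lerDl.
Qed.

(** By compactness the balls of a common radius e around the points of K lie in Omega, so a unit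
    vector can be followed at least to length e / 2. *)
Lemma gauge_compact_bound (K : set 'rV[R]_N) : compact K -> K `<=` Omega ->
  exists2 C, 0 < C & forall x w, K x -> enorm w = 1 -> gauge Omega x w <= C.
Proof.
move=> cK KO.
have : \forall e \near (0:R)^'+, K `<=` (fun x => ball x e `<=` Omega).
  apply: (compact_near_coveringP K).1 => // x Kx.
  have /nbhs_ballP[d /= d0 dO] : nbhs x Omega by apply: open_nbhs_nbhs; split=> //; exact: KO.
  have d20 : 0 < d / 2 by rewrite divr_gt0.
  near=> z e.
  have e2 : e <= d / 2 by near: e; exact: nbhs_right_le.
  have zb : ball x (d / 2) z by near: z; exact: nbhsx_ballx.
  move=> /= y yz; apply: dO.
  rewrite (splitr d); apply: (@ball_triangle _ _ z).
    exact: zb.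
  exact: (le_ball e2 yz).
move=> KB; have : \forall e \near (0:R)^'+, 0 < e /\ K `<=` (fun x => ball x e `<=` Omega).
  near=> e; split; first by near: e; exact: nbhs_right_gt.
  by near: e; exact: KB.
case/filter_ex => e [e0 eO].
exists (2 / e); first by rewrite divr_gt0.
move=> x w Kx w1; apply: ltW; apply/gauge_lt => //; first by rewrite divr_gt0.
move=> _; apply: (eO _ Kx); rewrite -ball_normE /= opprD addrA subrr sub0r normrN.
rewrite normrZ invf_div gtr0_norm ?divr_gt0//.
apply: (@le_lt_trans _ _ (e / 2 * 1)); last by rewrite mulr1 ltr_pdivrMr// ltr_pMr// ltr1n.
by rewrite ler_wpM2l ?divr_ge0 ?(ltW e0)// -w1 norm_le_enorm.
Unshelve. all: by end_near. Qed.

End bounded_convex.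

(** * Separating hyperplanes near the boundary *)

Section supporting_hyperplane.
Context {R : realType} {N : nat} (Omega : set 'rV[R]_N).
Hypotheses (oO : open Omega) (cO : convex_set Omega) (bO : bounded_set Omega).
Implicit Types (x y v w c : 'rV[R]_N) (l d e t : R).

(** Replace c by a nearby c' in Omega and shift x by t / (1 - t) (c - c') to compensate: the
    combination with weights t and 1 - t is the same point, and the shifted x is still in the open
    set. *)
Lemma closure_segment x c t : Omega x -> closure Omega c -> 0 <= t < 1 ->
  Omega (x + t *: (c - x)).
Proof.
move=> Ox cc /andP[t0 t1]; have [->|tn0] := eqVneq t 0.
  by rewrite scale0r addr0.
have {tn0} t0 : 0 < t by rewrite lt_neqAle eq_sym tn0.
have t1' : 0 < 1 - t by rewrite subr_gt0.
have /nbhs_ballP[r /= r0 rO] : nbhs x Omega by exact: open_nbhs_nbhs.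
have r'0 : 0 < r * ((1 - t) / t) by rewrite mulr_gt0// divr_gt0.
have [c' [Oc' cc']] := cc _ (nbhsx_ballx c _ r'0).
have Ox' : Omega (x + (t / (1 - t)) *: (c - c')).
  apply: rO; rewrite -ball_normE /= opprD addrA subrr sub0r normrN normrZ.
  rewrite gtr0_norm ?divr_gt0// -[t / _]invf_div -ltr_pdivlMl ?invr_gt0 ?divr_gt0// invrK.
  by rewrite mulrC; move: cc'; rewrite -ball_normE.
have t01 : 0 <= t <= 1 by rewrite !ltW.
have := convex_set_comb cO Oc' Ox' t01; congr Omega.
by apply/rowP => i; rewrite !mxE; field; rewrite gt_eqF.
Qed.

Let compact_closure : compact (closure Omega).
Proof.
apply: bounded_closed_compact; last exact: closed_closure.
have [M [Mr /(_ (M + 1))]] := bO; rewrite ltrDl ltr01 => /(_ isT) h.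
exists (M + 2); split; first by rewrite num_real.
move=> K MK c cc; have [y [Oy yc]] := cc _ (nbhsx_ballx c _ ltr01).
have := h _ Oy; move: yc; rewrite -ball_normE /= => yc yM.
rewrite -[c](subrK y) (le_trans (ler_normD _ _))//.
by move: yc yM MK; lra.
Qed.

(** The hyperplane separates the closure from a point q at distance exactly d from x, lying beyond a
    boundary point closer than d. Every d above the distance is allowed, so no nearest boundary
    point has to exist. *)
Lemma gauge_boundary x d : Omega x -> boundary Omega !=set0 -> bdist Omega x < d ->
  exists2 e, enorm e = 1 & forall w, dotp w e <= d * gauge Omega x w.
Proof.
move=> Ox [p0 bp0] xd.
have := @inf_lt _ [set enorm (x - y) | y in boundary Omega] d.
case/(_ _ xd) => [|_ [p [cp ip] <-] pd]; first by exists (enorm (x - p0)); exists p0.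
have xp : 0 < enorm (p - x).
  rewrite lt_neqAle enorm_ge0 andbT eq_sym; apply/eqP => /enorm_eq0/eqP.
  rewrite subr_eq0 => /eqP px; apply: ip; rewrite px.
  by rewrite (interior_id _).1.
rewrite -enormN opprB in pd.
(* The point at distance d from x on the ray through the boundary point p. *)
pose q := x + (d / enorm (p - x)) *: (p - x).
have d0 : 0 < d by exact: lt_trans pd.
have r1 : 1 < d / enorm (p - x) by rewrite ltr_pdivlMr// mul1r.
have r0 : 0 < d / enorm (p - x) by exact: lt_trans r1.
have qd : enorm (q - x) = d.
  by rewrite /q addrAC subrr add0r enormZ gtr0_norm// divfK// gt_eqF.
(* Otherwise p, strictly between x and q, would lie in Omega by [closure_segment], hence in its
   interior. *)
have nq : ~ closure Omega q.
  move=> cq; apply: ip; rewrite (interior_id _).1//.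
  have t01 : 0 <= (d / enorm (p - x))^-1 < 1.
    by rewrite invr_ge0 (ltW r0) invf_lt1.
  have := closure_segment Ox cq t01; congr Omega.
  rewrite /q [_ + _ - x]addrAC subrr add0r scalerA mulVf ?gt_eqF// scale1r.
  by rewrite addrCA subrr addr0.
have cont : continuous (fun y => enorm (q - y)).
  move=> y; apply: continuous_comp; last exact: continuous_enorm.
  by apply: continuousB => //; exact: cst_continuous.
have [c cc cmin] := compact_EVT_min (ex_intro _ _ (subset_closure Ox))
  compact_closure (continuous_subspaceT cont).
have Hc : closure Omega c by rewrite inE in cc.
have qc : 0 < enorm (q - c).
  rewrite lt_neqAle enorm_ge0 andbT eq_sym; apply/eqP => /enorm_eq0/eqP.
  by rewrite subr_eq0 => /eqP qc; apply: nq; rewrite qc.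
have sep y : Omega y -> dotp (y - c) (q - c) <= 0.
  move=> Oy; apply/ler_addgt0Pr => e e0; rewrite add0r.
  (* A step from the nearest point c towards y cannot approach q. The first-order term then gives
     the sign, and t is small enough for the quadratic remainder to stay below e. *)
  pose t := Num.min 1 (e / (enorm (y - c) ^+ 2 + 1)).
  have D0 : 0 < enorm (y - c) ^+ 2 + 1 by rewrite ltr_wpDl ?sqr_ge0.
  have t0 : 0 < t by rewrite lt_min ltr01 divr_gt0.
  have t1 : t <= 1 by rewrite ge_min lexx.
  have te : t * (enorm (y - c) ^+ 2 + 1) <= e.
    by rewrite -ler_pdivlMr// ge_min lexx orbT.
  have t01 : 0 <= 1 - t < 1 by rewrite subr_ge0 t1/= gtrBl.
  have := closure_segment Oy Hc t01.
  have -> : y + (1 - t) *: (c - y) = c + t *: (y - c).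
    by apply/rowP => i; rewrite !mxE; ring.
  move=> /subset_closure /mem_set/cmin.
  rewrite -(@ler_pXn2r _ 2)// ?nnegrE ?enorm_ge0// opprD addrA.
  have -> : enorm (q - c - t *: (y - c)) ^+ 2 = enorm (q - c) ^+ 2
      - 2 * t * dotp (y - c) (q - c) + t ^+ 2 * enorm (y - c) ^+ 2.
    rewrite -!dotpp; move: (y - c) (q - c) => v w.
    by rewrite dotpBl !dotpBr !dotpZl !dotpZr [dotp w v]dotpC; ring.
  move: te; set b := dotp _ _; set z := enorm (y - c) ^+ 2 => te h.
  have z0 : 0 <= z by exact: sqr_ge0.
  have : 0 <= t * (t * z - 2 * b) by nra.
  rewrite pmulr_rge0// => h2; nra.
exists ((enorm (q - c))^-1 *: (q - c)).
  by rewrite enormZ gtr0_norm ?invr_gt0// mulVf// gt_eqF.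
move=> w; apply/ler_addgt0Pr => e e0.
pose l := gauge Omega x w + e / d.
have l0 : 0 < l by rewrite ltr_wpDl ?(gauge_ge0 oO)// divr_gt0.
have gl : gauge Omega x w < l by rewrite ltrDl divr_gt0.
have := sep _ ((gauge_lt oO cO x w l0).1 gl Ox).
have -> : d * gauge Omega x w + e = d * l.
  by rewrite /l mulrDr mulrCA divff ?gt_eqF// mulr1.
(* Pairing with q - c, the middle term gives |q - c|^2 and the last is at most d |q - c| by
   Cauchy-Schwarz, so that w.(q - c) <= l d |q - c|. *)
have -> : x + l^-1 *: w - c = l^-1 *: w + (q - c) - (q - x).
  by apply/rowP => i; rewrite !mxE; ring.
rewrite dotpBl [dotp (_ + (q - c)) _]dotpDl dotpZl [dotp (q - c) (q - c)]dotpp dotpZr => h.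
have := cauchy_schwarz (q - x) (q - c); rewrite qd => cs.
rewrite ler_pdivrMl//.
move: h cs; set a := dotp w _; set b := dotp _ _; set z := enorm _ in qc * => h cs.
have : l^-1 * a <= d * z by have := sqr_ge0 z; lra.
by rewrite ler_pdivrMl// => /le_trans; apply; rewrite le_eqVlt; apply/orP; left; apply/eqP; ring.
Qed.

End supporting_hyperplane.

Section volume.
Context {R : realType} {N : nat}.
Local Notation leb := (@lebesgue_rV R).

Let cube (x : 'rV[R]_N) (r : R) : 0 < r ->
  leb N [set y | forall i, `]x ord0 i - r, x ord0 i + r[%classic (y ord0 i)] =
  ((r *+ 2) ^+ N)%:E.
Proof.
move=> r0; rewrite (@lebesgue_rV_box _ _ (fun i => `]x ord0 i - r, x ord0 i + r[%classic : set (measurableTypeR R)));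
  last by move=> i; exact: measurable_itv.
under eq_bigr => i _.
  rewrite lebesgue_measure_itv /= lte_fin ltrD2l gtrN// -EFinB.
  rewrite opprD opprK addrACA subrr add0r -mulr2n.
  over.
by rewrite prodEFin prodr_const card_ord.
Qed.

Let measurable_cube (x : 'rV[R]_N) (r : R) :
  measurable [set y : 'rV[R]_N | forall i, `]x ord0 i - r, x ord0 i + r[%classic (y ord0 i)].
Proof.
have -> : [set y : 'rV[R]_N | forall i, `]x ord0 i - r, x ord0 i + r[%classic (y ord0 i)] =
    \bigcap_(i in [set: 'I_N])
      ((fun v : 'rV[R]_N => v ord0 i) @^-1` `]x ord0 i - r, x ord0 i + r[%classic).
  by apply/seteqP; split=> v /= hv i; [move=> _|]; have := hv i; exact.
apply: fin_bigcap_measurable => // i _.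
by rewrite -[X in measurable X]setTI; apply: measurable_coor => //; exact: measurable_itv.
Qed.

Lemma lebesgue_rV_bounded (A : set 'rV[R]_N) : measurable A -> bounded_set A ->
  (leb N A < +oo)%E.
Proof.
move=> mA [M [Mr /(_ (`|M| + 1))]].
have MM : M < `|M| + 1 by rewrite ltr_pwDr// ler_norm.
move=> /(_ MM) h.
have r0 : 0 < `|M| + 2 by rewrite ltr_wpDl.
apply: (@le_lt_trans _ _ (((`|M| + 2) *+ 2) ^+ N)%:E); last by rewrite ltry.
rewrite -(cube 0 r0); apply: le_measure; rewrite ?inE//.
  exact: measurable_cube.
move=> y /h/= hy i; rewrite /= in_itv/= mxE sub0r add0r -ltr_norml.
by apply: (le_lt_trans (coor_le_norm _ _)); move: hy; lra.
Qed.

Lemma lebesgue_rV_open_gt0 (A : set 'rV[R]_N) : open A -> A !=set0 -> (0 < leb N A)%E.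
Proof.
move=> oA [x Ax].
have /nbhs_ballP[r /= r0 rA] : nbhs x A by exact: open_nbhs_nbhs.
have r20 : 0 < r / 2 by rewrite divr_gt0.
apply: (@lt_le_trans _ _ (((r / 2) *+ 2) ^+ N)%:E).
  by rewrite lte_fin exprn_gt0// mulrn_wgt0.
rewrite -(cube x r20); apply: le_measure; rewrite ?inE//.
- exact: measurable_cube.
- exact: open_measurable_rV.
move=> y /= hy; apply: rA; rewrite /ball /= /mx_ball; split=> // i j; rewrite (ord1 i).
have := hy j; rewrite /= in_itv /= /ball /= ltr_norml.
by move: r0; lra.
Qed.

End volume.

(** * The energy inequality *)

Section inverse_substitution.
Context {R : realType}.
Notation mu := (@lebesgue_measure R).
Variables (k c : R).
Hypothesis k0 : 0 < k.

(** This is c + k / r, written with a normalized power so that [derive1_powR_normalized] gives its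
    derivative. *)
Let F (r : R) : R := c + (- k) * ((-1)^-1 * r `^ (-1)).

Let FE (r : R) : 0 < r -> F r = c + k / r.
Proof. by move=> r0; rewrite /F powR_inv1 ?(ltW r0)// invrN invr1; ring. Qed.

Let is_deriveF (r : R) : 0 < r -> is_derive r 1 F (- k * r `^ (-1 - 1)).
Proof.
move=> r0; pose g (x : R) : R := (-1)^-1 * x `^ (-1).
have dg : is_derive r 1 g (r `^ (-1 - 1)).
  have dp : derivable (@powR R ^~ (-1)) r 1.
    by apply: derivable_powR; rewrite in_itv/= r0.
  have dg : derivable g r 1 by exact: (derivableM (derivable_cst _ r _) dp).
  by apply: DeriveDef => //; rewrite -derive1E derive1_powR_normalized.
have := is_deriveD (is_derive_cst c r 1) (is_deriveZ (- k) dg).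
by rewrite add0r; exact.
Qed.

Let derivF (r : R) : 0 < r -> derivable F r 1.
Proof. by move=> /is_deriveF[]. Qed.

Let derive1F (r : R) : 0 < r -> F^`()%classic r = - k * r `^ (-1 - 1).
Proof. by move=> /is_deriveF[_ <-]; rewrite derive1E. Qed.

Let continuous_derive1F (r : R) : 0 < r -> {for r, continuous F^`()%classic}.
Proof.
move=> r0; rewrite /prop_for /continuous_at derive1F//.
have : - k * x `^ (-1 - 1) @[x --> r] --> - k * r `^ (-1 - 1).
  by apply: cvgM; [exact: cvg_cst|exact: continuous_at_powR].
apply: cvg_trans; apply: near_eq_cvg; near=> x; rewrite derive1F//.
by near: x; exact: lt_nbhsr.
Unshelve. all: by end_near. Qed.

Lemma integral_inverse_substitution G a b : 0 < a -> a < b -> continuous G ->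
  (\int[mu]_(q in `[(c + k / b)%R, (c + k / a)%R]) (G q)%:E =
   \int[mu]_(r in `[a, b]) (k * G (c + k / r) * r `^ (-1 - 1))%:E)%E.
Proof.
move=> a0 ab cG; have b0 := lt_trans a0 ab.
rewrite -(FE a0) -(FE b0) integration_by_substitution_decreasing ?(ltW ab)//.
- apply: eq_integral => r; rewrite inE/= in_itv/= => /andP[ar _].
  have r0 : 0 < r by exact: lt_le_trans ar.
  have h1 := derive1F r0; have h2 := FE r0.
  have -> : ((G \o F) * - F^`()%classic) r = G (F r) * - (F^`()%classic r) by [].
  by rewrite h1 h2; congr EFin; ring.
- move=> x y; rewrite !in_itv/= => /andP[ax _] /andP[ay _] xy.
  have x0 : 0 < x by exact: lt_le_trans ax.
  have y0 : 0 < y by exact: lt_le_trans ay.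
  by rewrite !FE// ltrD2l ltr_pM2l// ltf_pV2.
- by move=> x; rewrite in_itv/= => /andP[/(lt_trans a0) x0 _]; exact: continuous_derive1F.
- by apply/cvg_ex; exists (F^`()%classic a); apply: cvg_at_right_filter; exact: continuous_derive1F.
- by apply/cvg_ex; exists (F^`()%classic b); apply: cvg_at_left_filter; exact: continuous_derive1F.
- have cF r : 0 < r -> {for r, continuous F}.
    by move=> r0; apply/differentiable_continuous/derivable1_diffP; exact: derivF.
  split.
  + by move=> x; rewrite in_itv/= => /andP[/(lt_trans a0) x0 _]; exact: derivF.
  + by apply: cvg_at_right_filter; exact: cF.
  + by apply: cvg_at_left_filter; exact: cF.
- exact: continuous_subspaceT.
Qed.

End inverse_substitution.

Section line_integrals.
Context {R : realType}.
Notation mu := (@lebesgue_measure R).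
Variables (m m' Q : R).
Hypotheses (m0 : 0 < m) (m'0 : 0 < m') (Q1 : 1 < Q).

(** The cut-off q < Q at distance r, that is 2 + r m' - r m < Q r (m + m'), means r > 2 / D. *)
Let D : R := Q * (m + m') + (m - m').
Let D2m : 2 * m < D.
Proof.
have q0 : 0 < Q - 1 by rewrite subr_gt0.
have := mulr_gt0 (addr_gt0 m0 m'0) q0.
by rewrite /D; lra.
Qed.
Let D0 : 0 < D. Proof. by apply: lt_trans D2m; rewrite mulr_gt0. Qed.
Let a0 : 0 < 2 / D. Proof. by rewrite divr_gt0. Qed.
Let ab : 2 / D < m^-1.
Proof. by rewrite ltr_pdivrMr// mulrC ltr_pdivlMr. Qed.

Let cond r := (r * m < 1) && (2 + r * m' - r * m < Q * (r * m + r * m')).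

Let condE : (`]0%R, +oo[%classic : set R) `&` [set r | cond r] =
  `](2 / D)%R, (m^-1)%R[%classic.
Proof.
apply/seteqP; split=> r /=; rewrite !in_itv/= ?andbT.
  move=> [r0 /andP[rm h]]; rewrite ltr_pdivrMr//; apply/andP; split.
    by move: h; rewrite /D; lra.
  by rewrite -[m^-1]mul1r ltr_pdivlMr.
move=> /andP[h rm]; have r0 := lt_trans a0 h; split=> //.
move: h; rewrite ltr_pdivrMr// /cond -ltr_pdivlMr// div1r rm/= /D.
by move=> h; lra.
Qed.

Let mP (f : R -> R) : (forall r, 0 < r -> {for r, continuous f}) ->
  measurable_fun (`](2 / D)%R, (m^-1)%R[%classic : set R) (fun r => (f r)%:E) /\
  measurable_fun (`](2 / D)%R, (m^-1)%R]%classic : set R) (fun r => (f r)%:E).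
Proof.
move=> cf; suff h : measurable_fun (`](0:R)%R, +oo[%classic : set R) (fun r => (f r)%:E).
  split; apply: (measurable_funS _ _ h) => // r /=; rewrite !in_itv/= andbT.
    by move=> /andP[/(lt_trans a0)].
  by move=> /andP[/(lt_trans a0)].
apply/measurable_EFinP; apply: continuous_measurable_itvoy => r.
by rewrite in_itv/= andbT; exact: cf.
Qed.

Lemma line_integral_kernel a : 0 < a ->
  (\int[mu]_(r in `]0%R, +oo[)
     (if ((r * m < 1) && (2 + r * m' - r * m < Q * (r * m + r * m')))%R
      then (r `^ (- a - 1))%:E else 0) =
   ((((Q * (m + m') + (m - m')) / 2) `^ a - m `^ a) / a)%:E)%E.
Proof.
move=> a_gt0; rewrite integral_if (_ : _ `&` _ = `](2 / D)%R, (m^-1)%R[%classic);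
  last exact: condE.
have hV (x : R) : 0 <= x -> x^-1 `^ (- a) = x `^ a.
  by move=> x0; rewrite -powR_inv1// -powRrM mulrNN mul1r.
have [h1 h2] := mP (fun r r0 => @continuous_at_powR R (- a - 1) r r0).
rewrite integral_itv_bndo_bndc// integral_itv_obnd_cbnd//.
rewrite integral_powR_itv ?(ltW ab)// ?oppr_eq0 ?(gt_eqF a_gt0)//.
rewrite invrN mulrN -mulNr opprB; congr ((_ - _) / _)%:E.
  by rewrite -[2 / D]invf_div hV ?divr_ge0 ?(ltW D0).
by rewrite hV ?(ltW m0).
Qed.

(** The substitution q = c + k / r sends r = 1 / m to 1 and r = 2 / D to Q. All powers of r combine
    into the Jacobian r^(-2), and m, m' survive only in the factor ((m + m') / 2)^(2s). *)
Lemma line_integral_weight s : 1 / 2 < s -> s < 1 ->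
  (\int[mu]_(r in `]0%R, +oo[)
     (if ((r * m < 1) && (2 + r * m' - r * m < Q * (r * m + r * m')))%R
      then (((1 - r * m) * (1 + r * m')) `^ (s - 1 / 2) * r `^ (- (2 * s) - 1))%:E
      else 0) <=
   (((m + m') / 2) `^ (2 * s) * shifted_power_integral s Q)%:E)%E.
Proof.
move=> s_gt s_lt; rewrite integral_if (_ : _ `&` _ = `](2 / D)%R, (m^-1)%R[%classic);
  last exact: condE.
have mm0 : 0 < m + m' by rewrite addr_gt0.
have Q0 : 0 < Q by exact: lt_trans Q1.
rewrite EFinM -shifted_power_integralE//.
set G := fun q : R => pospow (s - 1 / 2) (q ^+ 2 - 1).
have p0 : 0 < s - 1 / 2 by rewrite subr_gt0.
have cG : continuous G.
  move=> q; apply: (@continuous_comp _ _ _ (fun q : R => q ^+ 2 - 1) (pospow (s - 1 / 2)));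
    last exact: continuous_pospow.
  by apply: continuousB; [exact: exprn_continuous|exact: cst_continuous].
have mG A : measurable_fun A (fun q => (G q)%:E).
  apply/measurable_EFinP; apply: measurable_funTS.
  exact: continuous_measurable_fun.
have G0 q : (0 <= (G q)%:E)%E by rewrite lee_fin pospow_ge0.
pose k := 2 / (m + m'); pose c := (m' - m) / (m + m').
have k0 : 0 < k by rewrite divr_gt0.
have ekr (b x : R) : 0 < x -> (k / x) `^ b = k `^ b * x `^ (-1 * b).
  by move=> x0; rewrite powRM ?invr_ge0 ?(ltW k0) ?(ltW x0)// -(powR_inv1 (ltW x0)) -powRrM.
have q1 : c + k / m^-1 = 1 by rewrite /c /k invrK; field; rewrite gt_eqF.
have qQ : c + k / (2 / D) = Q.
  by rewrite /c /k invf_div /D; field; rewrite gt_eqF.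
apply: (@le_trans _ _ ((((m + m') / 2) `^ (2 * s))%:E * \int[mu]_(q in `[1%R, Q]) (G q)%:E)%E); last first.
  rewrite lee_pmul2l ?lte_fin ?powR_gt0 ?divr_gt0//.
  apply: ge0_subset_integral => //.
  - exact: mG.
  - by apply: subset_itvr; rewrite bnd_simp.
have := integral_inverse_substitution c k0 a0 ab cG; rewrite q1 qQ => ->.
have mH (A : set (measurableTypeR R)) : A `<=` `]0%R, +oo[%classic -> measurable A ->
    measurable_fun A (fun r => (k * G (c + k / r) * r `^ (-1 - 1))%:E).
  move=> A0 mA; have h : measurable_fun (`](0:R)%R, +oo[%classic : set R)
      (fun r => (k * G (c + k / r) * r `^ (-1 - 1))%:E).
    apply/measurable_EFinP; apply: continuous_measurable_itvoy => r.
    rewrite in_itv/= andbT => r0.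
    have cin : (c + k / x : R) @[x --> (r : R)] --> (c + k / r : R).
      apply: cvgD; first exact: cvg_cst.
      apply: cvgM; first exact: cvg_cst.
      by apply: cvgV; [rewrite gt_eqF|exact: cvg_id].
    have : (k * G (c + k / x) * x `^ (-1 - 1) : R) @[x --> (r : R)] -->
        (k * G (c + k / r) * r `^ (-1 - 1) : R).
      apply: cvgM; last exact: continuous_at_powR.
      apply: cvgM; first exact: cvg_cst.
      exact: (cvg_comp _ _ cin (cG _)).
    exact.
  exact: (measurable_funS _ A0 h).
have sub1 : `[(2 / D)%R, (m^-1)%R]%classic `<=` `]0%R, +oo[%classic.
  by move=> r /=; rewrite !in_itv/= andbT => /andP[/(lt_le_trans a0)].
have H0 r : (0 <= (k * G (c + k / r) * r `^ (-1 - 1))%:E)%E.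
  rewrite lee_fin; apply: mulr_ge0; last exact: powR_ge0.
  by apply: mulr_ge0; [exact: ltW|exact: pospow_ge0].
rewrite -ge0_integralZl_EFin ?powR_ge0//; last exact: mH.
apply: (@le_trans _ _ (\int[mu]_(r in `](2 / D)%R, (m^-1)%R[) ((((m + m') / 2) `^ (2 * s))%:E *
  (k * G (c + k / r) * r `^ (-1 - 1))%:E))%E).
  rewrite le_eqVlt; apply/orP; left; apply/eqP.
  apply: eq_integral => r; rewrite inE/= in_itv/= => /andP[ar rm].
  have r0 := lt_trans a0 ar.
  have X0 : 0 <= (1 - r * m) * (1 + r * m').
    have h1 : r * m < 1 by rewrite -ltr_pdivlMr// div1r.
    have h2 : 0 <= r * m' by rewrite mulr_ge0// ltW.
    by apply: mulr_ge0; move: h1 h2; lra.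
  have kr0 : 0 < k / r by rewrite divr_gt0.
  (* Factor the left side: c - 1 = - k m and c + 1 = k m'. *)
  have e : (c + k / r) ^+ 2 - 1 = (k / r) ^+ 2 * ((1 - r * m) * (1 + r * m')).
    by rewrite /k /c; field; rewrite !gt_eqF.
  rewrite -EFinM; congr EFin.
  move: X0 e; set X := (1 - r * m) * (1 + r * m') => X0 e.
  have -> : G (c + k / r) = ((k / r) ^+ 2) `^ (s - 1 / 2) * X `^ (s - 1 / 2).
    rewrite /G e pospowE; first by rewrite powRM// sqr_ge0.
    by apply: mulr_ge0 => //; exact: sqr_ge0.
  have -> : (m + m') / 2 = k^-1 by rewrite /k invf_div.
  rewrite -powR_inv1 ?(ltW k0)// -powRrM mulN1r.
  rewrite -[(k / r) ^+ 2]powR_mulrn ?(ltW kr0)// -powRrM.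
  rewrite ekr//.
  have -> : r `^ (- (2 * s) - 1) = r `^ (-1 * (2%:R * (s - 1 / 2))) * r `^ (-1 - 1).
    by rewrite -gt0_powRD//; congr powR; lra.
  have ek : k `^ (- (2 * s)) * k * k `^ (2%:R * (s - 1 / 2)) = 1.
    rewrite -{2}(powRr1 (ltW k0)) -!gt0_powRD//.
    by rewrite (_ : _ + _ = 0) ?powRr0//; lra.
  by rewrite -[LHS]mul1r -[X in X * _ = _]ek; ring.
apply: ge0_subset_integral => //.
- apply: measurable_funeM; exact: mH.
- by move=> r _; rewrite mule_ge0// lee_fin powR_ge0.
- exact: subset_itv_oo_cc.
Qed.

End line_integrals.

(** * Spherical averages of the gauge *)

Section gauge_average.
Context {R : realType} (n : nat) (Omega : set 'rV[R]_n.+1).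
Hypotheses (oO : open Omega) (cO : convex_set Omega).
Local Notation N := n.+1.
Notation leb := (@lebesgue_rV R N).
Notation mu := (@lebesgue_measure R).
Local Notation m := (gauge Omega).
Implicit Types (F G : R * R -> R) (x y z v w : 'rV[R]_N).

(* By polar coordinates, the integral of [F (m x w, m x (- w))] over the unit
   vectors [w] with respect to the surface measure. *)
Definition gauge_average F x : \bar R :=
  ((N%:R : R)%:E * \int[leb]_(z in pball) (F (m x (dir z), m x (- dir z)))%:E)%E.

Lemma measurable_oppr_rV : measurable_fun setT (fun v : 'rV[R]_N => - v).
Proof.
rewrite (_ : (fun _ => _) = (fun v : 'rV[R]_N => 0 - v)); last first.
  by apply/funext => v; rewrite sub0r.
exact: measurable_funB_rV.
Qed.

Lemma measurable_gauge_pair d (T : measurableType d) (f g : T -> 'rV[R]_N) :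
  measurable_fun setT f -> measurable_fun setT g ->
  measurable_fun setT (fun t => (m (f t) (g t), m (f t) (- g t))).
Proof.
move=> mf mg.
have h (g' : T -> 'rV[R]_N) : measurable_fun setT g' ->
    measurable_fun setT (fun t => m (f t) (g' t)).
  move=> mg'; have mfg : measurable_fun setT (fun t => (f t, g' t)).
    exact/measurable_fun_pairP.
  exact: (measurableT_comp (measurable_gauge oO cO) mfg).
apply/measurable_fun_pairP; split; first exact: h.
by apply: (h (fun t => - g t)); exact: (measurableT_comp measurable_oppr_rV).
Qed.

Let mjoint F : measurable_fun setT F -> measurable_fun setT (fun t : 'rV[R]_N * 'rV[R]_N =>
  F (m t.1 (dir t.2), m t.1 (- dir t.2))).
Proof.
move=> mF; apply: (measurableT_comp mF); apply: measurable_gauge_pair => //.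
exact: (measurableT_comp (@measurable_dir R N)).
Qed.

Let mdir F x (A : set 'rV[R]_N) : measurable_fun setT F ->
  measurable_fun A (fun z => (F (m x (dir z), m x (- dir z)))%:E).
Proof.
move=> mF; apply/measurable_EFinP; apply: measurable_funTS.
apply: (measurableT_comp mF); apply: measurable_gauge_pair => //.
exact: (@measurable_dir R N).
Qed.

Let mball := @measurable_pball R N.

Lemma gauge_average_ge0 F x : (forall p, 0 <= F p) -> (0 <= gauge_average F x)%E.
Proof.
by move=> F0; rewrite mule_ge0// integral_ge0// => z _; rewrite lee_fin.
Qed.

Lemma measurable_gauge_average F : measurable_fun setT F -> (forall p, 0 <= F p) ->
  measurable_fun setT (gauge_average F).
Proof.
move=> mF F0; apply: measurable_funeM.
apply: (@measurable_fun_tonelli_set1 _ _ _ _ _ leb setT pball (fun t => (F (m t.1 (dir t.2), m t.1 (- dir t.2)))%:E)) => //.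
- by apply/measurable_EFinP; apply: measurable_funTS; exact: mjoint.
- by move=> t _; rewrite lee_fin.
Qed.

(** The ball is invariant under z -> - z, which exchanges the two gauges. *)
Lemma gauge_averageC F x : measurable_fun setT F -> (forall p, 0 <= F p) ->
  gauge_average (fun p => F (p.2, p.1)) x = gauge_average F x.
Proof.
move=> mF F0; apply: (congr1 (mule _)); rewrite integral_mkcond [RHS]integral_mkcond.
rewrite [RHS](@ge0_integral_rV_affine _ _ (- 1) 0).
- rewrite normrN normr1 expr1n mul1e; apply: eq_integral => z _.
  rewrite addr0 scaleN1r !patchE !mem_pball enormN dirN opprK.
  by case: ifP.
- by rewrite oppr_eq0 oner_eq0.
- by apply/(measurable_restrictT _ mball); apply: mdir.
- by move=> z; apply: erestrict_ge0 => t _; rewrite lee_fin.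
Qed.

Lemma gauge_averageD F G x : measurable_fun setT F -> (forall p, 0 <= F p) ->
  measurable_fun setT G -> (forall p, 0 <= G p) ->
  gauge_average (fun p => F p + G p) x = (gauge_average F x + gauge_average G x)%E.
Proof.
move=> mF F0 mG G0; rewrite /gauge_average -ge0_muleDr//; last 2 first.
- by apply: integral_ge0 => z _; rewrite lee_fin.
- by apply: integral_ge0 => z _; rewrite lee_fin.
rewrite -ge0_integralD//; last 4 first.
- by move=> z _; rewrite lee_fin.
- exact: mdir.
- by move=> z _; rewrite lee_fin.
- exact: mdir.
Qed.

Lemma gauge_averageZ k F x : 0 <= k -> measurable_fun setT F -> (forall p, 0 <= F p) ->
  gauge_average (fun p => k * F p) x = (k%:E * gauge_average F x)%E.
Proof.
move=> k0 mF F0; rewrite /gauge_average [RHS]muleCA; congr (_ * _)%E.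
rewrite -ge0_integralZl_EFin//; last exact: mdir.
by move=> z _; rewrite lee_fin.
Qed.

Lemma gauge_average_bounded F x C B : (forall w, enorm w = 1 -> m x w <= C) ->
  (forall a b, 0 <= a <= C -> 0 <= b <= C -> F (a, b) <= B) ->
  measurable_fun setT F -> (forall p, 0 <= F p) ->
  (gauge_average F x <= (sphere_moment n 0 * B)%:E)%E.
Proof.
move=> mC FB mF F0; rewrite EFinM -lebesgue_pball -muleA lee_wpmul2l//.
have -> : (leb pball * B%:E = \int[leb]_(z in pball) B%:E)%E.
  by rewrite integral_cst// muleC.
apply: ge0_le_integral => //.
- by move=> z _; rewrite lee_fin.
- exact: mdir.
- move=> z /= /andP[z0 z1]; rewrite lee_fin FB// gauge_ge0//= mC// ?enormN enorm_dir//.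
Qed.

Lemma le_gauge_average F G x : bounded_set Omega -> Omega x ->
  measurable_fun setT F -> (forall p, 0 <= F p) ->
  measurable_fun setT G -> (forall p, 0 <= G p) ->
  (forall a b, 0 < a -> 0 < b -> a^-1 + b^-1 <= diam Omega -> F (a, b) <= G (a, b)) ->
  (gauge_average F x <= gauge_average G x)%E.
Proof.
move=> bO Ox mF F0 mG G0 FG; rewrite lee_wpmul2l//; apply: ge0_le_integral => //.
- by move=> z _; rewrite lee_fin.
- exact: mdir.
- exact: mdir.
- move=> z /= /andP[z0 z1]; rewrite lee_fin.
  have d1 := enorm_dir z0.
  have [h1 h2] := gauge_gt0_diam oO cO bO Ox d1.
  have [h3 _] := gauge_gt0_diam oO cO bO Ox (etrans (enormN _) d1).
  exact: FG.
Qed.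

(** For x in Omega, y belongs to Omega exactly when the gauge of y - x is below 1. A function [F]
    that vanishes for a first argument >= 1 thus carries the indicator of Omega, and polar
    coordinates apply on the whole space. *)
Lemma polar_gauge (F : R * R -> R) b x :
  measurable_fun setT F -> (forall p, 0 <= F p) ->
  (forall a c, ~~ (a < 1) -> F (a, c) = 0) -> Omega x ->
  (\int[leb]_(y in Omega) (F (m x (y - x), m x (x - y)) / enorm (x - y) `^ b)%:E =
   N%:R%:E * \int[leb]_(z in pball) \int[mu]_(r in `]0%R, +oo[)
     (F (r * m x (dir z), r * m x (- dir z)) * r `^ (N%:R - 1 - b))%:E)%E.
Proof.
move=> mF F0 F1 Ox.
pose g v : R := F (m x v, m x (- v)) * enorm v `^ (- b).
have g0 v : 0 <= g v by rewrite mulr_ge0 ?powR_ge0.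
have mg : measurable_fun setT g.
  apply: measurable_funM.
    by apply: (measurableT_comp mF); exact: measurable_gauge_pair.
  apply: (measurableT_comp (measurable_powR _)).
  exact: (@measurable_enorm R N).
have mO : measurable Omega by exact: open_measurable_rV.
transitivity (\int[leb]_v (g v)%:E)%E.
  rewrite [LHS]integral_mkcond.
  rewrite [LHS](@ge0_integral_rV_affine _ _ 1 x)//.
  - rewrite normr1 expr1n mul1e; apply: eq_integral => v _.
    rewrite scale1r patchE [v + x]addrC; case: ifPn => [_|].
      rewrite [x + v - x]addrAC subrr add0r opprD addrA subrr sub0r.
      by rewrite enormN /g powRN.
    move=> /negP nO; rewrite /g F1 ?mul0r//.
    apply/negP => m1; apply: nO; rewrite inE.
    by have := gauge_ltP oO cO v Ox ltr01; rewrite mulr1 scale1r => -[h _]; exact: h.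
  - apply/(measurable_restrictT _ mO); apply/measurable_EFinP; apply: measurable_funTS.
    have mB : measurable_fun setT (fun y => y - x) by exact: measurable_funB_rV.
    rewrite (_ : (fun _ => _) = g \o (fun y => y - x)); first exact: measurableT_comp.
    by apply/funext => y /=; rewrite /g opprB powRN -enormN opprB.
  - move=> y; apply: erestrict_ge0 => t _.
    by rewrite lee_fin divr_ge0 ?powR_ge0.
rewrite (ge0_integral_punctured mg g0) polar_coordinates//; apply: (congr1 (mule _)).
apply: eq_integral => z; rewrite inE => /andP[z0 z1].
apply: eq_integral => r; rewrite inE/= in_itv/= andbT => r0.
rewrite /g -scalerN !(gaugeZ oO cO _ _ r0) (enormZ r) enorm_dir// mulr1 (gtr0_norm r0).
by congr EFin; rewrite mulrCA -gt0_powRD.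
Qed.

End gauge_average.

Section weighted_gauge_integral.
Context {R : realType} (n : nat) (Omega : set 'rV[R]_n.+1).
Hypotheses (oO : open Omega) (cO : convex_set Omega) (bO : bounded_set Omega).
Local Notation N := n.+1.
Notation leb := (@lebesgue_rV R N).
Local Notation m := (gauge Omega).
Implicit Types (F G : R * R -> R) (x y : 'rV[R]_N).
Variable phi : 'rV[R]_N -> R.
Hypothesis mphi : measurable_fun setT phi.

Definition weighted_gauge F : \bar R :=
  (\int[leb]_(x in Omega) ((phi x ^+ 2)%:E * gauge_average Omega F x))%E.
Local Notation J := weighted_gauge.

Let mO : measurable Omega. Proof. exact: open_measurable_rV. Qed.

Let phi2_ge0 x : (0 <= (phi x ^+ 2)%:E)%E. Proof. by rewrite lee_fin sqr_ge0. Qed.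

Let mJ F (A : set 'rV[R]_N) : measurable_fun setT F -> (forall p, 0 <= F p) ->
  measurable_fun A (fun x => (phi x ^+ 2)%:E * gauge_average Omega F x)%E.
Proof.
move=> mF F0; apply: measurable_funTS; apply: emeasurable_funM.
  by apply/measurable_EFinP; exact: measurable_funX.
exact: measurable_gauge_average.
Qed.

Let J0 F x : (forall p, 0 <= F p) ->
  (0 <= (phi x ^+ 2)%:E * gauge_average Omega F x)%E.
Proof. by move=> F0; rewrite mule_ge0 ?gauge_average_ge0. Qed.

Lemma weighted_gauge_ge0 F : (forall p, 0 <= F p) -> (0 <= J F)%E.
Proof. by move=> F0; apply: integral_ge0 => x _; exact: J0. Qed.

Lemma weighted_gaugeC F : measurable_fun setT F -> (forall p, 0 <= F p) ->
  J (fun p => F (p.2, p.1)) = J F.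
Proof.
by move=> mF F0; apply: eq_integral => x _; rewrite gauge_averageC.
Qed.

Lemma weighted_gaugeD F G : measurable_fun setT F -> (forall p, 0 <= F p) ->
  measurable_fun setT G -> (forall p, 0 <= G p) ->
  J (fun p => F p + G p) = (J F + J G)%E.
Proof.
move=> mF F0 mG G0; rewrite /J -ge0_integralD//; last 4 first.
- by move=> x _; exact: J0.
- exact: mJ.
- by move=> x _; exact: J0.
- exact: mJ.
apply: eq_integral => x _; rewrite gauge_averageD// ge0_muleDr//;
  exact: gauge_average_ge0.
Qed.

Lemma weighted_gaugeZ k F : 0 <= k -> measurable_fun setT F -> (forall p, 0 <= F p) ->
  J (fun p => k * F p) = (k%:E * J F)%E.
Proof.
move=> k0 mF F0; rewrite /J -ge0_integralZl_EFin//; last 2 first.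
- by move=> x _; exact: J0.
- exact: mJ.
by apply: eq_integral => x _; rewrite gauge_averageZ// muleCA.
Qed.

Lemma le_weighted_gauge F G :
  measurable_fun setT F -> (forall p, 0 <= F p) ->
  measurable_fun setT G -> (forall p, 0 <= G p) ->
  (forall a b, 0 < a -> 0 < b -> a^-1 + b^-1 <= diam Omega -> F (a, b) <= G (a, b)) ->
  (J F <= J G)%E.
Proof.
move=> mF F0 mG G0 FG; apply: ge0_le_integral => //.
- by move=> x _; exact: J0.
- exact: mJ.
- exact: mJ.
- by move=> x Ox; rewrite lee_wpmul2l//; apply: le_gauge_average.
Qed.

(** On the support of [phi] the gauges in all directions are bounded by one constant. *)
Lemma weighted_gauge_fin_num F (K : set 'rV[R]_N) B :
  compact K -> K `<=` Omega -> (forall x, ~ K x -> phi x = 0) ->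
  (forall x, `|phi x| <= B) ->
  measurable_fun setT F -> (forall p, 0 <= F p) ->
  (forall C, exists D, forall a b, 0 <= a <= C -> 0 <= b <= C -> F (a, b) <= D) ->
  J F \is a fin_num.
Proof.
move=> cK KO K0 phiB mF F0 FB.
rewrite ge0_fin_numE ?weighted_gauge_ge0//.
have [C C0 mC] := gauge_compact_bound oO cO cK KO.
have [D FD] := FB C.
have D0 : 0 <= D by apply: (le_trans (F0 (0, 0))); apply: FD; rewrite lexx ltW.
have s0 : 0 <= sphere_moment n 0 :> R by rewrite ltW// sphere_moment_gt0.
apply: (@le_lt_trans _ _ (\int[leb]_(x in Omega) (B ^+ 2 * (sphere_moment n 0 * D))%:E)%E).
  apply: ge0_le_integral => //.
  - by move=> x _; exact: J0.
  - exact: mJ.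
  - move=> x _; have [Kx|nKx] := pselect (K x); last first.
      by rewrite K0// expr0n/= mul0e lee_fin mulr_ge0 ?sqr_ge0// mulr_ge0.
    rewrite [leRHS]EFinM; apply: lee_pmul => //; first exact: gauge_average_ge0.
      by rewrite lee_fin -real_normK ?num_real// lerXn2r ?nnegrE ?(le_trans _ (phiB x)).
    by apply: (gauge_average_bounded oO cO (C := C)) => // w; exact: mC.
rewrite integral_cst// lte_mul_pinfty//; last exact: lebesgue_rV_bounded.
by rewrite lee_fin mulr_ge0 ?sqr_ge0// mulr_ge0.
Qed.

End weighted_gauge_integral.

(** * The pair inequality and its integrated form *)

Section pair_inequality.
Context {R : realType} (n : nat) (Omega : set 'rV[R]_n.+1).
Hypotheses (oO : open Omega) (cO : convex_set Omega) (bO : bounded_set Omega).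
Local Notation N := n.+1.
Notation leb := (@lebesgue_rV R N).
Notation mu := (@lebesgue_measure R).
Local Notation m := (gauge Omega).
Implicit Types (F G : R * R -> R) (x y : 'rV[R]_N).
Variables (s Q : R) (phi : 'rV[R]_N -> R).
Hypothesis mphi : measurable_fun setT phi.
Hypotheses (s_gt : 1 / 2 < s) (s_lt : s < 1) (Q1 : 1 < Q).
Local Notation J := (weighted_gauge Omega phi).
Let b : R := N%:R + 2 * s.

Let mO : measurable Omega. Proof. exact: open_measurable_rV. Qed.

(** At the pair (M, M') of x and y, the first condition says that y is in Omega and the second is
    the cut-off q < Q. *)
Let cond (p : R * R) := (p.1 < 1) && (2 + p.2 - p.1 < Q * (p.1 + p.2)).
Let FK (p : R * R) : R := if cond p then 1 else 0.
Let rho (p : R * R) : R := ((1 - p.1) * (1 + p.2)) `^ (s - 1 / 2).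
Let FA (p : R * R) : R := if cond p then rho p else 0.
Let pr x y := (m x (y - x), m x (x - y)).

Let FK0 p : 0 <= FK p. Proof. by rewrite /FK; case: ifP. Qed.
Let FA0 p : 0 <= FA p. Proof. by rewrite /FA; case: ifP => // _; exact: powR_ge0. Qed.

Let mcond : measurable_fun setT cond.
Proof.
apply: measurable_and; apply: measurable_fun_ltr => //.
  by apply: measurable_funB => //; apply: measurable_funD.
by apply: measurable_funM => //; apply: measurable_funD.
Qed.

Let mFK : measurable_fun setT FK.
Proof. by apply: measurable_fun_ifT => //; exact: mcond. Qed.

Let mFA : measurable_fun setT FA.
Proof.
apply: measurable_fun_ifT => //.
apply: (measurableT_comp (measurable_powR _)); apply: measurable_funM.
  exact: measurable_funB.
exact: measurable_funD.
Qed.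

Let mpr : measurable_fun setT (fun z : 'rV[R]_N * 'rV[R]_N => pr z.1 z.2).
Proof.
rewrite (_ : (fun _ => _) = (fun z : 'rV[R]_N * 'rV[R]_N => (m z.1 (z.2 - z.1), m z.1 (- (z.2 - z.1))))).
  by apply: measurable_gauge_pair => //; exact: measurable_funB_rV.
by apply/funext => z; rewrite /pr opprB.
Qed.

(** From y, the point x lies backwards on the chord: its first coordinate comes from
    [gauge_backward] and its second from [gauge_forward]. *)
Let pr_swap x y : Omega x -> Omega y ->
  [/\ (pr x y).1 < 1, 0 <= (pr x y).2 &
    pr y x = ((pr x y).2 / (1 + (pr x y).2), (pr x y).1 / (1 - (pr x y).1))].
Proof.
move=> Ox Oy; have Oxy : Omega (x + (y - x)) by rewrite addrCA subrr addr0.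
split.
- by have := (gauge_ltP oO cO (y - x) Ox ltr01).2; rewrite mulr1 scale1r; exact.
- exact: gauge_ge0.
- have := gauge_backward oO cO Ox Oxy; have := gauge_forward oO cO Ox Oxy.
  by rewrite addrCA subrr addr0 opprB /pr => -> ->.
Qed.

Let cond_swap x y : Omega x -> Omega y -> cond (pr y x) = cond (pr x y).
Proof.
move=> Ox Oy; have [] := pr_swap Ox Oy; case: (pr x y) => M M' /= M1 M'0 ->.
have D1 : 0 < 1 + M' by rewrite ltr_wpDr.
have D2 : 0 < 1 - M by rewrite subr_gt0.
have D0 : 0 < (1 + M') * (1 - M) by rewrite mulr_gt0.
rewrite /cond/= M1 ltr_pdivrMr// mul1r ltrDr ltr01/=.
have e1 : (2 + M / (1 - M) - M' / (1 + M')) * ((1 + M') * (1 - M)) = 2 + M' - M.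
  by field; rewrite !gt_eqF.
have e2 : Q * (M' / (1 + M') + M / (1 - M)) * ((1 + M') * (1 - M)) = Q * (M + M').
  by field; rewrite !gt_eqF.
by rewrite -[LHS](ltr_pM2r D0) e1 e2.
Qed.

Let rho_swap x y : Omega x -> Omega y -> rho (pr y x) = (rho (pr x y))^-1.
Proof.
move=> Ox Oy; have [] := pr_swap Ox Oy; case: (pr x y) => M M' /= M1 M'0 ->.
have D1 : 0 < 1 + M' by rewrite ltr_wpDr.
have D2 : 0 < 1 - M by rewrite subr_gt0.
rewrite /rho/= -powRN -[- (s - 1 / 2)]mulN1r powRrM powR_inv1 ?mulr_ge0 ?ltW//.
by congr powR; field; rewrite !gt_eqF.
Qed.

Let rho_gt0 x y : Omega x -> Omega y -> 0 < rho (pr x y).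
Proof.
move=> Ox Oy; have [] := pr_swap Ox Oy; case: (pr x y) => M M' /= M1 M'0 _.
by rewrite powR_gt0// mulr_gt0 ?subr_gt0// ltr_wpDr.
Qed.

(** Under the cut-off, the difference of the two sides is the square (u rho - v)^2 / rho, where u
    and v are the values of [phi]; otherwise only (u - v)^2 remains. *)
Let pair_le x y : Omega x -> Omega y ->
  phi x ^+ 2 * FK (pr x y) + phi y ^+ 2 * FK (pr y x) <=
  (phi x - phi y) ^+ 2 + (phi x ^+ 2 * FA (pr x y) + phi y ^+ 2 * FA (pr y x)).
Proof.
move=> Ox Oy; rewrite /FK /FA cond_swap//; case: ifP => _; last first.
  by rewrite !mulr0 !addr0 sqr_ge0.
rewrite (rho_swap Ox Oy); have r0 := rho_gt0 Ox Oy.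
set r := rho _ in r0 *; rewrite !mulr1 -subr_ge0.
have -> : (phi x - phi y) ^+ 2 + (phi x ^+ 2 * r + phi y ^+ 2 / r) -
    (phi x ^+ 2 + phi y ^+ 2) = (phi x * r - phi y) ^+ 2 / r.
  by field; rewrite gt_eqF.
by rewrite divr_ge0 ?sqr_ge0 ?ltW.
Qed.

Let f F (z : 'rV[R]_N * 'rV[R]_N) : R :=
  phi z.1 ^+ 2 * (F (pr z.1 z.2) / enorm (z.1 - z.2) `^ b).

Let mker F : measurable_fun setT F -> measurable_fun setT
  (fun z : 'rV[R]_N * 'rV[R]_N => F (pr z.1 z.2) / enorm (z.1 - z.2) `^ b).
Proof.
move=> mF; apply: measurable_funM; first exact: (measurableT_comp mF mpr).
rewrite (_ : (fun _ => _) = (fun z : 'rV[R]_N * 'rV[R]_N => enorm (z.1 - z.2) `^ (- b))).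
  apply: (measurableT_comp (measurable_powR _)).
  apply: (measurableT_comp (@measurable_enorm R N)).
  exact: measurable_funB_rV.
by apply/funext => z; rewrite powRN.
Qed.

Let mf F : measurable_fun setT F -> measurable_fun setT (f F).
Proof.
move=> mF; apply: measurable_funM; last exact: mker.
by apply: measurable_funX; exact: (measurableT_comp mphi).
Qed.

Let mfs F : measurable_fun setT F -> measurable_fun setT (fun z => f F (z.2, z.1)).
Proof.
move=> mF; have msw : measurable_fun setT (fun z : 'rV[R]_N * 'rV[R]_N => (z.2, z.1)).
  by apply/measurable_fun_pairP; split; [exact: measurable_snd|exact: measurable_fst].
exact: (measurableT_comp (mf mF) msw).
Qed.

Let f_ge0 F z : (forall p, 0 <= F p) -> 0 <= f F z.
Proof. by move=> F0; rewrite mulr_ge0 ?sqr_ge0// divr_ge0// powR_ge0. Qed.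

Let I F := (\int[leb]_(x in Omega) ((phi x ^+ 2)%:E *
  \int[leb]_(y in Omega) (F (pr x y) / enorm (x - y) `^ b)%:E))%E.

Let I1 F : measurable_fun setT F -> (forall p, 0 <= F p) ->
  (\int[leb]_(x in Omega) \int[leb]_(y in Omega) (f F (x, y))%:E = I F)%E.
Proof.
move=> mF F0; apply: eq_integral => x _; rewrite -ge0_integralZl_EFin ?sqr_ge0//.
- by move=> y _; rewrite lee_fin divr_ge0// powR_ge0.
- apply/measurable_EFinP; apply: measurable_funTS.
  exact: (measurableT_comp (mker mF) (pair1_measurable x)).
Qed.

Let integral_f F : measurable_fun setT F -> (forall p, 0 <= F p) ->
  (\int[leb \x leb]_(z in Omega `*` Omega) (f F z)%:E = I F)%E.
Proof.
move=> mF F0; rewrite -I1//; apply: (tonelli_setX1 leb leb) => //.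
- by apply/measurable_EFinP; apply: measurable_funTS; exact: mf.
- by move=> z _; rewrite lee_fin f_ge0.
Qed.

Let integral_f_swap F : measurable_fun setT F -> (forall p, 0 <= F p) ->
  (\int[leb \x leb]_(z in Omega `*` Omega) (f F (z.2, z.1))%:E = I F)%E.
Proof.
move=> mF F0; rewrite -I1//; apply: (tonelli_setX2 leb leb) => //.
- apply/measurable_EFinP; apply: measurable_funTS.
  exact: mfs.
- by move=> z _; rewrite lee_fin f_ge0.
Qed.

Let energy0 := (\int[leb \x leb]_(z in Omega `*` Omega)
  ((phi z.1 - phi z.2) ^+ 2 / enorm (z.1 - z.2) `^ b)%:E)%E.

(** [pair_le] integrated against the symmetric kernel; by Tonelli in either order, the terms in phi
    x and in phi y have the same integral. *)
Let I_le : (I FK + I FK <= energy0 + (I FA + I FA))%E.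
Proof.
have mOO : measurable (Omega `*` Omega) by exact: measurableX.
have m1 F : measurable_fun setT F ->
    measurable_fun (Omega `*` Omega) (fun z => (f F z)%:E).
  by move=> mF; apply/measurable_EFinP; apply: measurable_funTS; exact: mf.
have m2 F : measurable_fun setT F ->
    measurable_fun (Omega `*` Omega) (fun z => (f F (z.2, z.1))%:E).
  move=> mF; apply/measurable_EFinP; apply: measurable_funTS.
  exact: mfs.
have m3 : measurable_fun (Omega `*` Omega) (fun z =>
    ((phi z.1 - phi z.2) ^+ 2 / enorm (z.1 - z.2) `^ b)%:E).
  apply/measurable_EFinP; apply: measurable_funTS.
  rewrite (_ : (fun _ => _) = (fun z : 'rV[R]_N * 'rV[R]_N =>
    (phi z.1 - phi z.2) ^+ 2 * (cst 1 (pr z.1 z.2) / enorm (z.1 - z.2) `^ b))).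
    apply: measurable_funM; last by apply: mker.
    apply: measurable_funX; apply: measurable_funB.
      exact: (measurableT_comp mphi).
    exact: (measurableT_comp mphi).
  by apply/funext => z; rewrite /cst div1r.
have p1 F z : (forall p, 0 <= F p) -> (0 <= (f F z)%:E)%E by move=> F0; rewrite lee_fin f_ge0.
have p3 (z : 'rV[R]_N * 'rV[R]_N) :
    (0 <= ((phi z.1 - phi z.2) ^+ 2 / enorm (z.1 - z.2) `^ b)%:E)%E.
  by rewrite lee_fin divr_ge0 ?sqr_ge0 ?powR_ge0.
rewrite -{1}integral_f// -{1}integral_f_swap//.
rewrite -{1}[I FA]integral_f// -{1}[I FA]integral_f_swap//.
rewrite -ge0_integralD//; [|by move=> z _; exact: p1|exact: m1|by move=> z _; exact: p1|exact: m2].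
rewrite -ge0_integralD//; [|by move=> z _; exact: p1|exact: m1|by move=> z _; exact: p1|exact: m2].
rewrite /energy0 -ge0_integralD//; last 2 first.
- by move=> z _; rewrite adde_ge0 ?p1.
- by apply: emeasurable_funD; [exact: m1|exact: m2].
apply: ge0_le_integral => //.
- by move=> z _; rewrite adde_ge0 ?p1.
- by apply: emeasurable_funD; [exact: m1|exact: m2].
- by apply: emeasurable_funD => //; apply: emeasurable_funD; [exact: m1|exact: m2].
move=> [x y] /= [Ox Oy]; rewrite -!EFinD lee_fin /f /=.
have -> : enorm (y - x) = enorm (x - y) by rewrite -enormN opprB.
rewrite !mulrA -!mulrDl ler_wpM2r ?invr_ge0 ?powR_ge0//.
exact: pair_le.
Qed.

(** The chord integral of the truncated kernel. The maximum with 0 changes nothing at the positive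
    gauges that occur, and makes the function nonnegative on all pairs, as the lemmas on
    [weighted_gauge] ask. *)
Let G1 (p : R * R) : R :=
  Num.max 0 ((((Q * (p.1 + p.2) + (p.1 - p.2)) / 2) `^ (2 * s) - p.1 `^ (2 * s)) / (2 * s)).
Let G2 (p : R * R) : R := ((Q * (p.1 + p.2) + (p.1 - p.2)) / 2) `^ (2 * s) / (2 * s).
Let H (p : R * R) : R := ((p.1 + p.2) / 2) `^ (2 * s).
Let U (p : R * R) : R := p.1 `^ (2 * s).

Let s0 : 0 < 2 * s. Proof. by move: s_gt; lra. Qed.

Let mD : measurable_fun setT (fun p : R * R => (Q * (p.1 + p.2) + (p.1 - p.2)) / 2).
Proof.
apply: measurable_funM => //; apply: measurable_funD; last exact: measurable_funB.
by apply: measurable_funM => //; exact: measurable_funD.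
Qed.

Let mU : measurable_fun setT U.
Proof. exact: (measurableT_comp (measurable_powR _)). Qed.

Let mH : measurable_fun setT H.
Proof.
apply: (measurableT_comp (measurable_powR _)); apply: measurable_funM => //.
exact: measurable_funD.
Qed.

Let mG2 : measurable_fun setT G2.
Proof.
by apply: measurable_funM => //; exact: (measurableT_comp (measurable_powR _)).
Qed.

Let mG1 : measurable_fun setT G1.
Proof.
apply: measurable_maxr => //; apply: measurable_funM => //; apply: measurable_funB => //.
exact: (measurableT_comp (measurable_powR _)).
Qed.

Let U0 p : 0 <= U p. Proof. exact: powR_ge0. Qed.
Let H0 p : 0 <= H p. Proof. exact: powR_ge0. Qed.
Let G10 p : 0 <= G1 p. Proof. by rewrite le_max lexx. Qed.
Let G20 p : 0 <= G2 p. Proof. by rewrite divr_ge0 ?powR_ge0 ?ltW. Qed.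

Let b_exp : N%:R - 1 - b = - (2 * s) - 1 :> R.
Proof. by rewrite /b; ring. Qed.

Let I_FK : I FK = J G1.
Proof.
apply: eq_integral => x; rewrite inE => Ox; congr (_ * _)%E.
rewrite (polar_gauge oO cO b mFK FK0)//; last by move=> a c a1; rewrite /FK /cond/= (negbTE a1).
congr (_ * _)%E; apply: eq_integral => z; rewrite inE => /andP[z0 z1].
have d1 := enorm_dir z0.
have [h1 _] := gauge_gt0_diam oO cO bO Ox d1.
have [h2 _] := gauge_gt0_diam oO cO bO Ox (etrans (enormN _) d1).
transitivity ((((Q * (m x (dir z) + m x (- dir z)) + (m x (dir z) - m x (- dir z))) / 2)
   `^ (2 * s) - m x (dir z) `^ (2 * s)) / (2 * s))%:E.
  rewrite -(line_integral_kernel h1 h2 Q1 s0); apply: eq_integral => r _.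
  by rewrite /FK /cond /= b_exp; case: ifP => _; rewrite ?mul1r ?mul0r.
congr EFin; rewrite /G1 /= max_r// divr_ge0 ?(ltW s0)// subr_ge0.
apply: ge0_ler_powR; rewrite ?nnegrE ?(ltW s0) ?(ltW h1)//.
  rewrite divr_ge0//; have : 0 <= (Q - 1) * (m x (dir z) + m x (- dir z)).
    by apply: mulr_ge0; [rewrite subr_ge0 ltW|rewrite addr_ge0 ?ltW].
  by move: h1 h2; lra.
have : 0 <= (Q - 1) * (m x (dir z) + m x (- dir z)).
  by apply: mulr_ge0; [rewrite subr_ge0 ltW|rewrite addr_ge0 ?ltW].
by move: h1 h2; lra.
Qed.

Let spi := shifted_power_integral s Q.

Let spi0 : 0 <= spi.
Proof. by apply: fine_ge0; apply: integral_ge0 => q _; rewrite lee_fin pospow_ge0. Qed.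

Let I_FA : (I FA <= spi%:E * J H)%E.
Proof.
rewrite -weighted_gaugeZ//; apply: ge0_le_integral_nonmeasurable => x Ox.
  rewrite mule_ge0 ?lee_fin ?sqr_ge0//; apply: integral_ge0 => y _.
  by rewrite lee_fin divr_ge0// powR_ge0.
rewrite lee_wpmul2l ?lee_fin ?sqr_ge0//.
rewrite (polar_gauge oO cO b mFA FA0)//; last by move=> a c a1; rewrite /FA /cond/= (negbTE a1).
rewrite lee_wpmul2l//; apply: ge0_le_integral_nonmeasurable => z /= /andP[z0 z1].
  by apply: integral_ge0 => r _; rewrite lee_fin mulr_ge0 ?powR_ge0.
have d1 := enorm_dir z0.
have [h1 _] := gauge_gt0_diam oO cO bO Ox d1.
have [h2 _] := gauge_gt0_diam oO cO bO Ox (etrans (enormN _) d1).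
rewrite mulrC; apply: le_trans (line_integral_weight h1 h2 Q1 s_gt s_lt).
rewrite le_eqVlt; apply/orP; left; apply/eqP; apply: eq_integral => r _.
by rewrite /FA /cond /rho /= b_exp; case: ifP => _; rewrite ?mul0r.
Qed.

(** All terms are on their positive side, since a subtraction would require finiteness; this is the
    form in which the limit in Q is taken. *)
Lemma pair_inequality :
  ((2 * (Q `^ (2 * s) / (2 * s)))%:E * J (fun p => ((p.1 + p.2) / 2) `^ (2 * s))%R <=
   \int[leb \x leb]_(z in Omega `*` Omega)
     ((phi z.1 - phi z.2) ^+ 2 / enorm (z.1 - z.2) `^ (N%:R + 2 * s))%:E +
   (2 * shifted_power_integral s Q)%:E * J (fun p => ((p.1 + p.2) / 2) `^ (2 * s))%R +
   (2 * (2 * s)^-1)%:E * J (fun p => p.1 `^ (2 * s))%R)%E.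
Proof.
rewrite -/energy0 -/spi -/H -/U.
have Q0 : 0 < Q by exact: lt_trans Q1.
have i0 : 0 <= (2 * s)^-1 by rewrite invr_ge0 ltW.
have mG2s : measurable_fun setT (fun p : R * R => G2 (p.2, p.1)).
  apply: (measurableT_comp mG2); apply/measurable_fun_pairP.
  by split; [exact: measurable_snd|exact: measurable_fst].
have c0 : 0 <= 2 * (Q `^ (2 * s) / (2 * s)) by rewrite mulr_ge0// mulr_ge0// powR_ge0.
have mZ k F : measurable_fun setT F -> measurable_fun setT (fun p : R * R => k * F p).
  by move=> mF; exact: measurable_funM.
(* Averaging over w and - w, the two arguments are Q (m + m') / 2 plus and minus (m - m') / 2, and
   midpoint convexity of the power 2s applies. *)
have stepA : ((2 * (Q `^ (2 * s) / (2 * s)))%:E * J H <= J G2 + J G2)%E.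
  rewrite -{2}(weighted_gaugeC _ _ _ mG2)// -weighted_gaugeD// -weighted_gaugeZ//.
  apply: le_weighted_gauge => //; try by [exact: mZ|exact: measurable_funD].
  - by move=> p; rewrite mulr_ge0.
  - by move=> p; rewrite addr_ge0.
  move=> a c a0 d0 _; rewrite /H /G2 /= -mulrDl.
  have -> : 2 * (Q `^ (2 * s) / (2 * s)) * ((a + c) / 2) `^ (2 * s) =
      2 * (Q `^ (2 * s) * ((a + c) / 2) `^ (2 * s)) / (2 * s) by ring.
  rewrite ler_wpM2r// -powRM ?(ltW Q0) ?divr_ge0 ?addr_ge0 ?(ltW a0) ?(ltW d0)//.
  have ss : 1 <= 2 * s by move: s_gt; lra.
  have q1 : 0 <= (Q - 1) * a by apply: mulr_ge0; [rewrite subr_ge0 ltW|exact: ltW].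
  have q2 : 0 <= (Q - 1) * c by apply: mulr_ge0; [rewrite subr_ge0 ltW|exact: ltW].
  have [ac|/ltW ca] := leP a c.
    have := @powR_midpoint R (2 * s) (Q * ((a + c) / 2)) ((c - a) / 2) ss.
    have -> : Q * ((a + c) / 2) - (c - a) / 2 = (Q * (a + c) + (a - c)) / 2 by field.
    have -> : Q * ((a + c) / 2) + (c - a) / 2 = (Q * (c + a) + (c - a)) / 2 by field.
    by apply; move: q1 q2 a0 d0 ac; lra.
  have := @powR_midpoint R (2 * s) (Q * ((a + c) / 2)) ((a - c) / 2) ss.
  have -> : Q * ((a + c) / 2) + (a - c) / 2 = (Q * (a + c) + (a - c)) / 2 by field.
  have -> : Q * ((a + c) / 2) - (a - c) / 2 = (Q * (c + a) + (c - a)) / 2 by field.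
  move=> h; rewrite [leRHS]addrC; apply: h; move: q1 q2 a0 d0 ca; lra.
(* [G2] exceeds the fraction inside the maximum of [G1] by exactly U / (2s). *)
have stepB : (J G2 <= J G1 + (2 * s)^-1%:E * J U)%E.
  have mV : measurable_fun setT (fun p => (2 * s)^-1 * U p) by exact: mZ.
  have V0 p : 0 <= (2 * s)^-1 * U p by rewrite mulr_ge0.
  rewrite -(weighted_gaugeZ oO cO mphi i0 mU U0) -(weighted_gaugeD oO cO mphi mG1 G10 mV V0).
  apply: le_weighted_gauge => //; first exact: measurable_funD.
    by move=> p; rewrite addr_ge0.
  move=> a c a0 d0 _; rewrite -lerBlDr /G1 /G2 /U /= [_^-1 * _]mulrC -mulrBl.
  by rewrite le_max lexx orbT.
have dbl (k : R) (X : \bar R) : 0 <= k -> ((2 * k)%:E * X = k%:E * X + k%:E * X)%E.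
  by move=> k0; rewrite mulrDl mul1r EFinD ge0_muleDl// lee_fin.
have gen (g2 g1 u e fa h lhs : \bar R) : (lhs <= g2 + g2 -> g2 <= g1 + u ->
    g1 + g1 <= e + (fa + fa) -> fa <= h -> lhs <= e + (h + h) + (u + u))%E.
  move=> A B C D; apply: (le_trans A); apply: (le_trans (leeD B B)).
  by rewrite addeACA; apply: leeD => //; apply: (le_trans C); rewrite leeD2l// leeD.
have C := I_le; rewrite I_FK in C.
rewrite (dbl spi)// (dbl (2 * s)^-1)//.
exact: (gen _ _ _ _ _ _ _ stepA stepB C I_FA).
Qed.

End pair_inequality.

(** * The pointwise lower bound of the weight *)

Section hardy_weight.
Context {R : realType}.
Implicit Types (s a b d : R) (p : R * R).

(* [kappa_{1,2s}] *)
Definition kappa1 s : R := 2 `^ (1 - 2 * s) * gap_const s - (2 * s)^-1.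

Lemma kappa1_ge0 s : 1 / 2 < s -> s < 1 -> 0 <= kappa1 s.
Proof.
move=> s_gt s_lt; have s0 : 0 < 2 * s by move: s_gt; lra.
rewrite subr_ge0; have := ler_wpM2l (powR_ge0 2 (1 - 2 * s)) (gap_const_ge s_gt s_lt).
rewrite mulrA -gt0_powRD// (_ : 1 - 2 * s + (2 * s - 1) = 0) ?powRr0 ?mul1r//.
by ring.
Qed.

Definition max_pow a p : R := Num.max p.1 p.2 `^ a.

(* [min(a, b)^(2s)] and [a^(2s-1)] for positive arguments, written as negative
   powers of the quantities whose averages are volumes. *)
Definition min_pow (n : nat) a p : R :=
  Num.max (p.1 `^ (- n%:R)) (p.2 `^ (- n%:R)) `^ (- (a / n%:R)).
Definition fst_pow (n : nat) a p : R := (p.1 `^ (- n%:R)) `^ (- (a / n%:R)).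

Lemma max_pow_ge0 a p : 0 <= max_pow a p. Proof. exact: powR_ge0. Qed.
Lemma min_pow_ge0 n a p : 0 <= min_pow n a p. Proof. exact: powR_ge0. Qed.
Lemma fst_pow_ge0 n a p : 0 <= fst_pow n a p. Proof. exact: powR_ge0. Qed.

Lemma measurable_max_pow a : measurable_fun setT (max_pow a).
Proof. by apply: (measurableT_comp (measurable_powR _)); exact: measurable_maxr. Qed.

Lemma measurable_min_pow n a : measurable_fun setT (min_pow n a).
Proof.
apply: (measurableT_comp (measurable_powR _)); apply: measurable_maxr.
  exact: (measurableT_comp (measurable_powR _)).
exact: (measurableT_comp (measurable_powR _)).
Qed.

Lemma measurable_fst_pow n a : measurable_fun setT (fst_pow n a).
Proof.
apply: (measurableT_comp (measurable_powR _)).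
exact: (measurableT_comp (measurable_powR _)).
Qed.

Lemma fst_powE n a p : (0 < n)%N -> 0 < p.1 -> fst_pow n a p = p.1 `^ a.
Proof.
move=> n0 p0; rewrite /fst_pow -powRrM mulrNN mulrCA divff ?mulr1//.
by rewrite pnatr_eq0 -lt0n.
Qed.

Lemma min_powE n a p : (0 < n)%N -> 0 < p.1 -> p.1 <= p.2 -> min_pow n a p = p.1 `^ a.
Proof.
move=> n0 p0 p12; rewrite -(fst_powE a n0 p0) /min_pow /fst_pow max_l//.
rewrite !powRN lef_pV2 ?posrE ?powR_gt0 ?(lt_le_trans p0)//.
by rewrite ge0_ler_powR// nnegrE ltW// (lt_le_trans p0).
Qed.

(** The three terms lead respectively to the distance term, to [a_const] and to [b_const]. *)
Definition hardy_weight n s d p : R :=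
  kappa1 s * max_pow (2 * s) p +
  (kappa1 s * (2 `^ (2 * s) - 1) * min_pow n (2 * s) p +
   (4 - 2 `^ (3 - 2 * s)) / (2 * s * d) * fst_pow n (2 * s - 1) p).

Lemma hardy_coef_ge0 s d : 1 / 2 < s -> s < 1 -> 0 <= d ->
  [/\ 0 <= kappa1 s * (2 `^ (2 * s) - 1) & 0 <= (4 - 2 `^ (3 - 2 * s)) / (2 * s * d)].
Proof.
move=> s_gt s_lt d0; have s0 : 0 < 2 * s by move: s_gt; lra.
split.
  rewrite mulr_ge0 ?kappa1_ge0// subr_ge0 -[leLHS](powRr0 2) ler_powR ?ler1n//.
  exact: ltW.
apply: divr_ge0; last by apply: mulr_ge0 => //; exact: ltW.
rewrite subr_ge0.
have -> : 4 = 2 `^ 2%:R :> R by rewrite powR_mulrn// -natrX.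
by rewrite ler_powR ?ler1n//; move: s_gt; lra.
Qed.

Lemma hardy_weight_ge0 n s d p : 1 / 2 < s -> s < 1 -> 0 <= d -> 0 <= hardy_weight n s d p.
Proof.
move=> s_gt s_lt d0; have [h1 h2] := hardy_coef_ge0 s_gt s_lt d0.
apply: addr_ge0; first by rewrite mulr_ge0 ?kappa1_ge0 ?max_pow_ge0.
by apply: addr_ge0; apply: mulr_ge0 => //; [exact: min_pow_ge0|exact: fst_pow_ge0].
Qed.

Lemma measurable_hardy_weight n s d : measurable_fun setT (hardy_weight n s d).
Proof.
apply: measurable_funD; first by apply: measurable_funM => //; exact: measurable_max_pow.
apply: measurable_funD; apply: measurable_funM => //; first exact: measurable_min_pow.
exact: measurable_fst_pow.
Qed.

(** The right side is (kappa1 + 1 / (2s)) (a + b)^(2s). The part with [kappa1] is bounded below by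
    [powRD_ge], the part with 1 / (2s) by [powRD_remainder]. *)
Lemma hardy_weight_le n s d a b : (0 < n)%N -> 1 / 2 < s -> s < 1 ->
  0 < a -> 0 < b -> a^-1 + b^-1 <= d ->
  hardy_weight n s d (a, b) + (2 * s)^-1 * (a `^ (2 * s) + b `^ (2 * s)) <=
  2 * gap_const s * ((a + b) / 2) `^ (2 * s).
Proof.
move=> n0 s_gt s_lt a0 b0 abd; have s0 : 0 < 2 * s by move: s_gt; lra.
have ab0 : 0 < a + b by rewrite addr_gt0.
have d0 : 0 < d by apply: lt_le_trans abd; rewrite addr_gt0 ?invr_gt0.
have -> : 2 * gap_const s * ((a + b) / 2) `^ (2 * s) =
    (kappa1 s + (2 * s)^-1) * (a + b) `^ (2 * s).
  rewrite /kappa1 subrK powRM ?(ltW ab0) ?invr_ge0//.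
  have -> : 2^-1 `^ (2 * s) = 2 `^ (- (2 * s)) :> R.
    by rewrite -powR_inv1// -powRrM mulN1r.
  have -> : 2 `^ (1 - 2 * s) = 2 * 2 `^ (- (2 * s)) :> R.
    by rewrite gt0_powRD// powRr1.
  by ring.
have [c1 c2] := hardy_coef_ge0 s_gt s_lt (ltW d0).
have k0 := kappa1_ge0 s_gt s_lt.
have ss : 1 <= 2 * s by move: s_gt; lra.
have main : max_pow (2 * s) (a, b) + (2 `^ (2 * s) - 1) * min_pow n (2 * s) (a, b) <=
    (a + b) `^ (2 * s).
  have [ab|/ltW ba] := leP a b.
    rewrite min_powE// /max_pow /= max_r//.
    by apply: powRD_ge => //; rewrite (ltW a0).
  have -> : min_pow n (2 * s) (a, b) = min_pow n (2 * s) (b, a).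
    by rewrite /min_pow /= maxC.
  rewrite min_powE// /max_pow /= max_l// [a + b]addrC.
  by apply: powRD_ge => //; rewrite (ltW b0).
have rem : (4 - 2 `^ (3 - 2 * s)) / d * fst_pow n (2 * s - 1) (a, b) +
    (a `^ (2 * s) + b `^ (2 * s)) <= (a + b) `^ (2 * s).
  rewrite fst_powE//=; have ss2 : 1 < 2 * s < 2.
    by apply/andP; split; move: s_gt s_lt; lra.
  have := powRD_remainder ss2 a0 b0.
  have c4 : 0 <= 4 - 2 `^ (3 - 2 * s) :> R.
    have := c2; rewrite pmulr_lge0// invr_gt0 mulr_gt0//.
  (* The quotient a b / (a + b) is the inverse of 1 / a + 1 / b, the chord length, which is at most
     d. *)
  have h1 : d^-1 <= a * b / (a + b).
    have -> : a * b / (a + b) = (a^-1 + b^-1)^-1.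
      rewrite -invf_div; congr GRing.inv; rewrite invfM mulrDl mulrA divff ?gt_eqF//.
      by rewrite mul1r mulrCA divff ?gt_eqF// mulr1 addrC.
    by rewrite lef_pV2 ?posrE// addr_gt0 ?invr_gt0.
  have h2 : a `^ (2 * s - 1) <= (a + b) `^ (2 * s - 1).
    apply: ge0_ler_powR; rewrite ?nnegrE ?(ltW a0) ?(ltW ab0)//.
      by rewrite subr_ge0.
    by rewrite lerDl ltW.
  have h3 : (4 - 2 `^ (3 - 2 * s)) / d * a `^ (2 * s - 1) <=
      (4 - 2 `^ (3 - 2 * s)) * (a * b / (a + b)) * (a + b) `^ (2 * s - 1).
    apply: ler_pM => //; [|exact: powR_ge0|].
      by apply: mulr_ge0 => //; rewrite invr_ge0 ltW.
    exact: ler_wpM2l.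
  by move: h3; set X := _ * a `^ _; set Y := _ * (a + b) `^ _ => h3; lra.
have := ler_wpM2l k0 main.
have i0 : 0 <= (2 * s)^-1 by rewrite invr_ge0 ltW.
have := ler_wpM2l i0 rem.
rewrite /hardy_weight [(2 * s * d)^-1]invfM.
set A := max_pow _ _; set B := min_pow _ _ _; set C := fst_pow _ _ _.
set D := (a + b) `^ _; set c4 := 4 - _; set E := 2 `^ _ - 1.
set P := a `^ _ + b `^ _; set i := (2 * s)^-1; set k := kappa1 s.
move=> e1 e2; rewrite [leRHS]mulrDl; apply: le_trans (lerD e2 e1).
by rewrite le_eqVlt; apply/orP; left; apply/eqP; ring.
Qed.

End hardy_weight.

Section energy_inequality.
Context {R : realType} (n : nat) (Omega : set 'rV[R]_n.+1).
Hypotheses (oO : open Omega) (cO : convex_set Omega) (bO : bounded_set Omega).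
Local Notation N := n.+1.
Notation leb := (@lebesgue_rV R N).
Variables (s : R) (phi : 'rV[R]_N -> R) (K : set 'rV[R]_N) (B : R).
Hypothesis mphi : measurable_fun setT phi.
Hypotheses (s_gt : 1 / 2 < s) (s_lt : s < 1).
Hypotheses (cK : compact K) (KO : K `<=` Omega) (phiK : forall x, ~ K x -> phi x = 0)
  (phiB : forall x, `|phi x| <= B) (d0 : 0 <= diam Omega).
Local Notation J := (weighted_gauge Omega phi).

Let H (p : R * R) : R := ((p.1 + p.2) / 2) `^ (2 * s).
Let U (p : R * R) : R := p.1 `^ (2 * s).
Let U' (p : R * R) : R := p.2 `^ (2 * s).

Let s0 : 0 < 2 * s. Proof. by move: s_gt; lra. Qed.

Let mU : measurable_fun setT U.
Proof. exact: (measurableT_comp (measurable_powR _)). Qed.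

Let mU' : measurable_fun setT U'.
Proof. exact: (measurableT_comp (measurable_powR _)). Qed.

Let mH : measurable_fun setT H.
Proof.
apply: (measurableT_comp (measurable_powR _)); apply: measurable_funM => //.
exact: measurable_funD.
Qed.

Let U0 p : 0 <= U p. Proof. exact: powR_ge0. Qed.
Let U'0 p : 0 <= U' p. Proof. exact: powR_ge0. Qed.
Let H0 p : 0 <= H p. Proof. exact: powR_ge0. Qed.

Let JH_fin : J H \is a fin_num.
Proof.
apply: (weighted_gauge_fin_num oO cO bO mphi cK KO phiK phiB mH H0) => C.
exists (C `^ (2 * s)) => a b /andP[a0 aC] /andP[b0 bC]; rewrite /H /=.
apply: ge0_ler_powR; rewrite ?nnegrE ?(ltW s0)//; move: a0 b0 aC bC; lra.
Qed.

Let JU_fin : J U \is a fin_num.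
Proof.
apply: (weighted_gauge_fin_num oO cO bO mphi cK KO phiK phiB mU U0) => C.
exists (C `^ (2 * s)) => a b /andP[a0 aC] /andP[b0 bC]; rewrite /U /=.
by apply: ge0_ler_powR; rewrite ?nnegrE ?(ltW s0)//; exact: le_trans aC.
Qed.

Let W := hardy_weight N s (diam Omega).
Let mW : measurable_fun setT W. Proof. exact: measurable_hardy_weight. Qed.
Let W0 p : 0 <= W p. Proof. exact: hardy_weight_ge0. Qed.

Let gap0 : 0 <= gap_const s.
Proof.
by apply: le_trans (gap_const_ge s_gt s_lt); rewrite divr_ge0 ?powR_ge0 ?(ltW s0).
Qed.

Let weight_le : (J W + ((2 * s)^-1)%:E * (J U + J U) <= (2 * gap_const s)%:E * J H)%E.
Proof.
have i0 : 0 <= (2 * s)^-1 by rewrite invr_ge0 ltW.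
have mUU : measurable_fun setT (fun p => U p + U' p) by exact: measurable_funD.
have UU0 p : 0 <= U p + U' p by rewrite addr_ge0.
have miU : measurable_fun setT (fun p => (2 * s)^-1 * (U p + U' p)).
  exact: measurable_funM.
have iU0 p : 0 <= (2 * s)^-1 * (U p + U' p) by rewrite mulr_ge0.
have mgH : measurable_fun setT (fun p => 2 * gap_const s * H p).
  exact: measurable_funM.
have gH0 p : 0 <= 2 * gap_const s * H p by rewrite mulr_ge0// mulr_ge0.
have mWU : measurable_fun setT (fun p => W p + (2 * s)^-1 * (U p + U' p)).
  exact: measurable_funD.
have WU0 p : 0 <= W p + (2 * s)^-1 * (U p + U' p) by rewrite addr_ge0.
have g0 : 0 <= 2 * gap_const s by rewrite mulr_ge0.
have := le_weighted_gauge oO cO bO mphi mWU WU0 mgH gH0.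
rewrite (weighted_gaugeZ oO cO mphi g0 mH H0).
rewrite (weighted_gaugeD oO cO mphi mW W0 miU iU0).
rewrite (weighted_gaugeZ oO cO mphi i0 mUU UU0).
rewrite (weighted_gaugeD oO cO mphi mU U0 mU' U'0).
rewrite (weighted_gaugeC oO cO phi mU U0 : J U' = J U).
by apply => a b a0 b0 abd; exact: hardy_weight_le.
Qed.

(** The limit in Q on extended reals: an infinite E is trivial, and otherwise every term is finite
    and can be moved across the inequality. *)
Let limit_gap (JH JU JW E : \bar R) : JH \is a fin_num -> JU \is a fin_num ->
  (0 <= JH)%E -> (0 <= JU)%E -> (0 <= JW)%E -> (0 <= E)%E ->
  (forall Q, 1 < Q -> ((2 * (Q `^ (2 * s) / (2 * s)))%:E * JH <=
    E + (2 * shifted_power_integral s Q)%:E * JH + (2 * (2 * s)^-1)%:E * JU)%E) ->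
  (JW + ((2 * s)^-1)%:E * (JU + JU) <= (2 * gap_const s)%:E * JH)%E -> (JW <= E)%E.
Proof.
case: JH => // h; case: JU => // u; case: E => // [e|] _ _; last by move=> *; exact: leey.
rewrite !lee_fin => h0 u0 JW0 _ pQ wle.
have JWf : JW \is a fin_num.
  rewrite ge0_fin_numE//; apply: le_lt_trans (ltry (2 * gap_const s * h)).
  apply: le_trans wle; rewrite leeDl// -EFinD -EFinM lee_fin.
  by apply: mulr_ge0; [rewrite invr_ge0 ltW|exact: addr_ge0].
move: JWf wle {JW0}; case: JW => // w _.
rewrite -?EFinD -?EFinM -?EFinD !lee_fin => wle.
suff key : 2 * gap_const s * h <= e + 2 / (2 * s) * u.
  have eu : (2 * s)^-1 * (u + u) = 2 / (2 * s) * u by ring.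
  by move: wle key; rewrite eu; lra.
apply/ler_addgt0Pr => eps eps0.
have D0 : 0 < 2 * h + 1 by rewrite ltr_wpDl// mulr_ge0.
(* The error in [gap_const_approx] is multiplied by 2 h; dividing by 2 h + 1 keeps it below eps and
   stays meaningful for h = 0. *)
have e'0 : 0 < eps / (2 * h + 1) by rewrite divr_gt0.
have [Q Q1 gQ] := gap_const_approx s_gt s_lt e'0.
have := pQ Q Q1; rewrite -?EFinM -?EFinD lee_fin.
set q := Q `^ _ / _ in gQ *; set sp := shifted_power_integral s Q in gQ *.
set e' := eps / _ in gQ e'0 => hQ.
have he' : 2 * h * e' <= eps.
  rewrite /e' mulrA ler_pdivrMr// mulrC ler_wpM2l ?(ltW eps0)//.
  by rewrite lerDl.
have := ler_wpM2r h0 (ltW gQ).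
by move: hQ he'; lra.
Qed.

Lemma energy_inequality :
  (J (hardy_weight N s (diam Omega)) <=
   \int[leb \x leb]_(z in Omega `*` Omega)
     ((phi z.1 - phi z.2) ^+ 2 / enorm (z.1 - z.2) `^ (N%:R + 2 * s))%:E)%E.
Proof.
have E00 : (0 <= \int[leb \x leb]_(z in Omega `*` Omega)
     ((phi z.1 - phi z.2) ^+ 2 / enorm (z.1 - z.2) `^ (N%:R + 2 * s))%:E)%E.
  by apply: integral_ge0 => z _; rewrite lee_fin divr_ge0 ?sqr_ge0 ?powR_ge0.
exact: (limit_gap JH_fin JU_fin (weighted_gauge_ge0 _ _ H0) (weighted_gauge_ge0 _ _ U0)
  (weighted_gauge_ge0 _ _ W0) E00
  (fun Q Q1 => pair_inequality oO cO bO mphi s_gt s_lt Q1) weight_le).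
Qed.

End energy_inequality.

(** * Lower bounds for the weight *)

Section lower_bounds.
Context {R : realType} (n : nat) (Omega : set 'rV[R]_n.+1).
Hypotheses (oO : open Omega) (cO : convex_set Omega) (bO : bounded_set Omega).
Local Notation N := n.+1.
Notation leb := (@lebesgue_rV R N).
Notation mu := (@lebesgue_measure R).
Local Notation m := (gauge Omega).
Local Notation A := (gauge_average Omega).
Implicit Types (F G : R * R -> R) (x y : 'rV[R]_N).

Let mball := @measurable_pball R N.

Let bdist_ge0 x : 0 <= bdist Omega x.
Proof.
rewrite /bdist /dist; have [E|/nonemptyPn E] := pselect (boundary Omega !=set0).
  apply: lb_le_inf => [|_ [y _ <-]]; last exact: enorm_ge0.
  by case: E => y by_; exists (enorm (x - y)); exists y.
by rewrite E image_set0 inf0.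
Qed.

(** For e from [gauge_boundary], |w.e| is at most d times the larger gauge of w and - w. Integrating
    the power a over the sphere gives the moment. *)
Let moment_le a d x : 0 < a -> Omega x -> boundary Omega !=set0 -> bdist Omega x < d ->
  ((sphere_moment n a)%:E <= (d `^ a)%:E * A (max_pow a) x)%E.
Proof.
move=> a0 Ox bne xd; have [e e1 he] := gauge_boundary oO cO bO Ox bne xd.
have d0 : 0 <= d by apply: le_trans (ltW xd); exact: bdist_ge0.
rewrite -(integral_dir_dotp (ltW a0) e1).
rewrite -(gauge_averageZ oO cO x (powR_ge0 d a) (measurable_max_pow a) (max_pow_ge0 a)).
apply: lee_wpmul2l => //; apply: ge0_le_integral_nonmeasurable => z /= /andP[z0 _].
  by rewrite lee_fin powR_ge0.
rewrite lee_fin /max_pow -powRM ?le_max ?(gauge_ge0 oO)//.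
apply: ge0_ler_powR; rewrite ?nnegrE ?(ltW a0)//.
  by rewrite mulr_ge0// le_max (gauge_ge0 oO).
have h1 := he (dir z); have h2 := he (- dir z); rewrite dotpNl in h2.
rewrite ler_norml lerNl; apply/andP; split.
  by apply: (le_trans h2); apply: ler_wpM2l => //=; rewrite le_max lexx orbT.
by apply: (le_trans h1); apply: ler_wpM2l => //=; rewrite le_max lexx.
Qed.

Lemma gauge_average_max_pow a x : 0 < a -> Omega x ->
  ((sphere_moment n a / bdist Omega x `^ a)%:E <= A (max_pow a) x)%E.
Proof.
move=> a0 Ox; have A0 : (0 <= A (max_pow a) x)%E.
  by apply: gauge_average_ge0; exact: max_pow_ge0.
(* Division by 0 gives 0 on the left. An empty boundary falls under this case, since the infimum of
   the empty set is 0. *)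
have [->|dn0] := eqVneq (bdist Omega x) 0.
  by rewrite powR0 ?gt_eqF// invr0 mulr0.
have d0 : 0 < bdist Omega x by rewrite lt_neqAle eq_sym dn0 bdist_ge0.
have bne : boundary Omega !=set0.
  apply/set0P/eqP => b0; move: dn0.
  by rewrite /bdist /dist b0 image_set0 inf0 eqxx.
have key d := @moment_le a d x a0 Ox bne.
case: (A (max_pow a) x) A0 key => [r r0 key|_ _|//]; last exact: leey.
rewrite lee_fin in r0; rewrite lee_fin leNgt; apply/negP.
rewrite ltr_pdivlMr ?powR_gt0// => lt.
set s0 := sphere_moment n a in lt key; set d := bdist Omega x in d0 lt key.
have s00 : 0 < s0 by apply: sphere_moment_gt0; exact: ltW.
have [r1|rn] := ltP 0 r; last first.
  have := key _ (ltr_pwDr ltr01 (lexx d)); rewrite -EFinM lee_fin leNgt => /negP; apply.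
  by apply: le_lt_trans s00; rewrite mulr_ge0_le0 ?powR_ge0.
(* The radius at which d1^a r equals the moment. If the bound failed, it would exceed the distance,
   and [moment_le] would fail at the midpoint. *)
pose d1 := (s0 / r) `^ a^-1.
have d1a : d1 `^ a = s0 / r.
  by rewrite /d1 -powRrM mulVf ?gt_eqF// powRr1// divr_ge0 ?ltW.
have d10 : 0 <= d1 by exact: powR_ge0.
have dd1 : d < d1.
  rewrite ltNge; apply/negP => /(ge0_ler_powR (ltW a0)); rewrite !nnegrE => /(_ d10 (ltW d0)).
  by rewrite d1a ler_pdivrMr// leNgt mulrC lt.
have := key ((d + d1) / 2) (midf_lt dd1).1.
rewrite -EFinM lee_fin leNgt => /negP; apply.
rewrite -ltr_pdivlMr// -d1a; apply: gt0_ltr_powR => //; rewrite ?nnegrE//.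
  by rewrite divr_ge0// addr_ge0// ltW.
exact: (midf_lt dd1).2.
Qed.

(** A convex function lies above its tangent at t. Here it follows from expR x >= 1 + x and ln x <=
    x - 1. *)
Let powRN_tangent (b t y : R) : 0 < b -> 0 < t -> 0 < y ->
  (1 + b) * t `^ (- b) <= y `^ (- b) + b * t `^ (- b - 1) * y.
Proof.
move=> b0 t0 y0; have r0 : 0 < y / t by rewrite divr_gt0.
have h : 1 - b * (y / t - 1) <= (y / t) `^ (- b).
  rewrite /powR (gt_eqF r0); apply: le_trans (expR_ge1Dx _).
  rewrite lerD2l mulNr lerN2 ler_wpM2l ?(ltW b0)//.
  have := @le_ln1Dx R (y / t - 1); rewrite [1 + _]addrC subrK; apply.
  by rewrite ltrBrDr addrC subrr.
have e1 : y `^ (- b) = t `^ (- b) * (y / t) `^ (- b).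
  by rewrite -powRM ?(ltW t0) ?(ltW r0)// mulrCA divff ?mulr1// gt_eqF.
have e2 : t `^ (- b - 1) = t `^ (- b) * t^-1.
  by rewrite gt0_powRD// powR_inv1// ltW.
rewrite e1 e2; have := ler_wpM2l (powR_ge0 t (- b)) h.
set u := y / t; have -> : b * (t `^ (- b) / t) * y = b * t `^ (- b) * u.
  by rewrite /u; ring.
by set p := t `^ _; set q := u `^ _; lra.
Qed.

Lemma gauge_average_cst (c : R) x : 0 <= c -> A (fun=> c) x = (sphere_moment n 0 * c)%:E.
Proof.
move=> c0; rewrite EFinM -lebesgue_pball -muleA /gauge_average; congr (_ * _)%E.
by rewrite integral_cst// muleC.
Qed.

(* Jensen's inequality for a negative power, through its tangent line. *)
Lemma gauge_average_powRN F b V x : 0 < b -> 0 < V -> Omega x ->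
  measurable_fun setT F -> (forall p, 0 <= F p) ->
  (forall a c, 0 < a -> 0 < c -> 0 < F (a, c)) -> (A F x <= V%:E)%E ->
  ((sphere_moment n 0 * (V / sphere_moment n 0) `^ (- b))%:E <=
   A (fun p => F p `^ (- b))%R x)%E.
Proof.
move=> b0 V0 Ox mF F0 F1 FV.
have s00 : 0 < sphere_moment n 0 :> R by apply: sphere_moment_gt0.
(* The point of tangency is the upper bound for the mean of [F] over the sphere; there the linear
   term integrates to at most b s0 t^(-b). *)
set s0 := sphere_moment n 0 in s00 *; pose t := V / s0.
have t0 : 0 < t by rewrite divr_gt0.
have mP : measurable_fun setT (fun p => F p `^ (- b)).
  exact: (measurableT_comp (measurable_powR _)).
have P0 p : 0 <= F p `^ (- b) by exact: powR_ge0.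
pose k := b * t `^ (- b - 1).
have k0 : 0 <= k by rewrite mulr_ge0 ?powR_ge0// ltW.
have mkF : measurable_fun setT (fun p => k * F p) by exact: measurable_funM.
have kF0 p : 0 <= k * F p by rewrite mulr_ge0.
have mS : measurable_fun setT (fun p => F p `^ (- b) + k * F p) by exact: measurable_funD.
have S0 p : 0 <= F p `^ (- b) + k * F p by rewrite addr_ge0.
have c0 : 0 <= (1 + b) * t `^ (- b).
  by rewrite mulr_ge0 ?powR_ge0// addr_ge0// ltW.
have := @le_gauge_average R n Omega oO cO (fun=> (1 + b) * t `^ (- b)) _ x bO Ox
  (measurable_cst _) (fun=> c0) mS S0.
move=> /(_ (fun a c a0 c0 _ => powRN_tangent b0 t0 (F1 _ _ a0 c0))).
rewrite (gauge_average_cst x c0) (gauge_averageD oO cO x mP P0 mkF kF0).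
rewrite (gauge_averageZ oO cO x k0 mF F0) -/s0.
have A0 : (0 <= A F x)%E by exact: gauge_average_ge0.
have AP0 : (0 <= A (fun p => F p `^ (- b))%R x)%E by exact: gauge_average_ge0.
case: (A F x) A0 FV => // f; rewrite !lee_fin => f0 fV.
case: (A (fun p => F p `^ (- b))%R x) AP0 => [g| |] //; last by move=> *; exact: leey.
rewrite -?EFinM -?EFinD !lee_fin => g0 h.
have kf : k * f <= k * V by exact: ler_wpM2l.
have kV : k * V = b * s0 * t `^ (- b).
  rewrite /k gt0_powRD// powR_inv1 ?(ltW t0)//.
  have -> : V = s0 * t by rewrite /t mulrCA divff ?mulr1// gt_eqF.
  by field; rewrite gt_eqF.
rewrite -/t; move: h kf kV; set p := t `^ _; set kk := k * V; lra.
Qed.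

(** Polar coordinates around x for the indicator of Omega: in each direction, r^(N-1) is integrated
    up to 1 / m, which gives m^(-N) / N. *)
Lemma gauge_average_volume x : Omega x ->
  A (fun p => p.1 `^ (- N%:R))%R x = (N%:R * vol Omega)%:E.
Proof.
move=> Ox; have mO : measurable Omega by exact: open_measurable_rV.
have Of : leb Omega \is a fin_num.
  by rewrite ge0_fin_numE// lebesgue_rV_bounded.
pose F (p : R * R) : R := if p.1 < 1 then 1 else 0.
have mF : measurable_fun setT F.
  by apply: measurable_fun_ifT => //; exact: measurable_fun_ltr.
have F0 p : 0 <= F p by rewrite /F; case: ifP.
have F1 (a c : R) : ~~ (a < 1) -> F (a, c) = 0 by rewrite /F/= => /negbTE ->.
have := polar_gauge oO cO 0 mF F0 F1 Ox.
have -> : (\int[leb]_(y in Omega) (F (m x (y - x), m x (x - y)) / enorm (x - y) `^ 0)%:E =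
    leb Omega)%E.
  transitivity (\int[leb]_(y in Omega) (cst 1%E y))%E; last by rewrite integral_cst// mul1e.
  apply: eq_integral => y; rewrite inE => Oy; rewrite powRr0 divr1 /F /=.
  have Oxy : Omega (x + 1 *: (y - x)) by rewrite scale1r addrCA subrr addr0.
  by have := (gauge_ltP oO cO (y - x) Ox ltr01).2 Oxy; rewrite mulr1 => ->.
rewrite /vol => e; rewrite EFinM fineK// e; congr (_ * _)%E.
have N0 : 0 < N%:R :> R by rewrite ltr0n.
rewrite -ge0_integralZl_EFin//; last 2 first.
- move=> z _; apply: integral_ge0 => r _; rewrite lee_fin mulr_ge0 ?powR_ge0//.
- apply: (@measurable_fun_tonelli_set1 _ _ _ _ _ mu pball (`]0%R, +oo[%classic) (fun t : 'rV[R]_N * measurableTypeR R =>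
    (F (t.2 * m x (dir t.1), t.2 * m x (- dir t.1)) * t.2 `^ (N%:R - 1 - 0))%:E)) => //.
    apply/measurable_EFinP; apply: measurable_funTS; apply: measurable_funM; last first.
      exact: (measurableT_comp (measurable_powR _)).
    apply: (measurableT_comp mF).
    have mp : measurable_fun setT (fun t : 'rV[R]_N * measurableTypeR R =>
        (m x (dir t.1), m x (- dir t.1))).
      apply: (@measurable_gauge_pair _ _ _ oO cO _ _ (cst x) (fun t => dir t.1)) => //.
      exact: (measurableT_comp (@measurable_dir R N)).
    apply/measurable_fun_pairP; split; apply: measurable_funM => //.
      exact: (measurableT_comp measurable_fst mp).
    exact: (measurableT_comp measurable_snd mp).
  by move=> t _; rewrite lee_fin mulr_ge0 ?powR_ge0.
apply: eq_integral => z; rewrite inE => /andP[z0 z1].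
have [h1 _] := gauge_gt0_diam oO cO bO Ox (enorm_dir z0).
set mm := m x (dir z) in h1 *.
have -> : (\int[mu]_(r in `]0%R, +oo[) (F (r * mm, r * m x (- dir z)) * r `^ (N%:R - 1 - 0))%:E =
    \int[mu]_(r in `]0%R, +oo[) (if (r * mm < 1)%R then (r `^ (N%:R - 1))%:E else 0))%E.
  apply: eq_integral => r _; rewrite /F/= subr0.
  by case: ifP => _; rewrite ?mul1r ?mul0r.
rewrite integral_if (_ : _ `&` _ = `]0%R, (mm^-1)%R[%classic); last first.
  apply/seteqP; split=> r /=; rewrite !in_itv/= ?andbT.
    by move=> [-> ]; rewrite -ltr_pdivlMr// div1r.
  by move=> /andP[-> ]; rewrite -ltr_pdivlMr// div1r.
rewrite integral_itv_bndo_bndc; last first.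
  apply/measurable_EFinP; apply: measurable_funTS; exact: measurable_powR.
rewrite integral_powR_oc ?invr_gt0// -EFinM mulrCA divff ?gt_eqF// mulr1.
by rewrite -powR_inv1 ?(ltW h1)// -powRrM mulN1r.
Qed.

Lemma gauge_average_fst_pow a x : 0 < a -> Omega x -> 0 < vol Omega ->
  ((sphere_moment n 0 * (N%:R * vol Omega / sphere_moment n 0) `^ (- (a / N%:R)))%:E <=
   A (fst_pow N a) x)%E.
Proof.
move=> a0 Ox v0; apply: gauge_average_powRN => //.
- by rewrite divr_gt0// ltr0n.
- by rewrite mulr_gt0// ltr0n.
- exact: (measurableT_comp (measurable_powR _)).
- by move=> p; exact: powR_ge0.
- by move=> b c b0 _; exact: powR_gt0.
- by rewrite gauge_average_volume.
Qed.

(** The maximum of m^(-N) and m'^(-N) is at most their sum, whose average is 2 N |Omega|. The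
    resulting factor 2^(-a/N) is at least 2^(-a), the origin of 2^(-2s) in [a_const]. *)
Lemma gauge_average_min_pow a x : 0 < a -> Omega x -> 0 < vol Omega ->
  ((2 `^ (- a) * (sphere_moment n 0 *
     (N%:R * vol Omega / sphere_moment n 0) `^ (- (a / N%:R))))%:E <=
   A (min_pow N a) x)%E.
Proof.
move=> a0 Ox v0; have N0 : 0 < N%:R :> R by rewrite ltr0n.
have s00 : 0 < sphere_moment n 0 :> R by apply: sphere_moment_gt0.
have mf : measurable_fun setT (fun p : R * R => p.1 `^ (- N%:R)).
  exact: (measurableT_comp (measurable_powR _)).
have mg : measurable_fun setT (fun p : R * R => p.2 `^ (- N%:R)).
  exact: (measurableT_comp (measurable_powR _)).
have f0 (p : R * R) : 0 <= p.1 `^ (- N%:R) by exact: powR_ge0.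
have g0 (p : R * R) : 0 <= p.2 `^ (- N%:R) by exact: powR_ge0.
have mM : measurable_fun setT (fun p : R * R => Num.max (p.1 `^ (- N%:R)) (p.2 `^ (- N%:R))).
  exact: measurable_maxr.
have M0 (p : R * R) : 0 <= Num.max (p.1 `^ (- N%:R)) (p.2 `^ (- N%:R)) by rewrite le_max f0.
have mD : measurable_fun setT (fun p : R * R => p.1 `^ (- N%:R) + p.2 `^ (- N%:R)).
  exact: measurable_funD.
have D0 (p : R * R) : 0 <= p.1 `^ (- N%:R) + p.2 `^ (- N%:R) by rewrite addr_ge0.
have b0 : 0 < a / N%:R by rewrite divr_gt0.
have V0 : 0 < 2 * (N%:R * vol Omega) by rewrite !mulr_gt0.
apply: (@le_trans _ _ (sphere_moment n 0 *
    (2 * (N%:R * vol Omega) / sphere_moment n 0) `^ (- (a / N%:R)))%:E).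
  have q0 : 0 <= N%:R * vol Omega / sphere_moment n 0.
    by apply: divr_ge0; [apply: mulr_ge0; exact: ltW|exact: ltW].
  rewrite lee_fin mulrCA ler_wpM2l ?(ltW s00)// -[2 * _ / _]mulrA.
  move: q0; set q := N%:R * _ / _ => q0.
  have -> : (2 * q) `^ (- (a / N%:R)) = 2 `^ (- (a / N%:R)) * q `^ (- (a / N%:R)).
    by rewrite powRM.
  rewrite ler_wpM2r ?powR_ge0// ler_powR ?ler1n// lerN2 ler_pdivrMr//.
  by rewrite ler_peMr ?(ltW a0)// ler1n.
apply: (gauge_average_powRN b0 V0 Ox mM M0).
  by move=> c d c0 d0; rewrite lt_max powR_gt0.
apply: (@le_trans _ _ (A (fun p => p.1 `^ (- N%:R) + p.2 `^ (- N%:R))%R x)).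
  apply: (le_gauge_average oO cO bO Ox mM M0 mD D0) => c d c0 d0 _ /=.
  by rewrite ge_max lerDl lerDr !powR_ge0.
rewrite (gauge_averageD oO cO x mf f0 mg g0).
rewrite (gauge_averageC oO cO x mf f0) gauge_average_volume// -EFinD lee_fin.
by rewrite mulrDl !mul1r.
Qed.

End lower_bounds.

(** * Identification of the constants *)

Section constants.
Context {R : realType} (n : nat) (s : R).
Local Notation N := n.+1.
Hypotheses (s_gt : 1 / 2 < s) (s_lt : s < 1).

Let P : R := Num.sqrt pi.
Let P0 : 0 < P. Proof. by rewrite sqrtr_gt0 pi_gt0. Qed.
Let s0 : 0 < s. Proof. by move: s_gt; lra. Qed.
Let N0 : 0 < N%:R :> R. Proof. by rewrite ltr0n. Qed.

Let powR_pi k : pi `^ (k%:R / 2) = P ^+ k :> R.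
Proof. by rewrite mulrC powRrM powR12_sqrt ?pi_ge0// powR_mulrn. Qed.

Lemma c_constE : c_const N s =
  2 `^ (2 * s) / P ^+ N * s * Gamma ((N%:R + 2 * s) / 2) / Gamma (1 - s).
Proof. by rewrite /c_const powRN powR_pi. Qed.

Let G1 : R := Gamma ((1 + 2 * s) / 2).
Let G2 : R := Gamma ((N%:R + 2 * s) / 2).
Let GN : R := Gamma (N%:R / 2).
Let Gs : R := Gamma (1 - s).
Let G10 : 0 < G1. Proof. by apply: Gamma_gt0; move: s0; lra. Qed.
Let G20 : 0 < G2. Proof. by apply: Gamma_gt0; rewrite divr_gt0// addr_gt0// mulr_gt0. Qed.
Let GN0 : 0 < GN. Proof. by apply: Gamma_gt0; rewrite divr_gt0. Qed.
Let Gs0 : 0 < Gs. Proof. by apply: Gamma_gt0; rewrite subr_gt0. Qed.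

Lemma c_const_gt0 : 0 < c_const N s.
Proof.
have p0 : 0 < P ^+ N by exact: exprn_gt0.
rewrite c_constE -/G2 -/Gs; apply: divr_gt0 => //; apply: mulr_gt0 => //.
by apply: mulr_gt0 => //; apply: divr_gt0 => //; exact: powR_gt0.
Qed.

Let moment_s : sphere_moment n (2 * s) = 2 * P ^+ n * G1 / G2.
Proof. by []. Qed.

Let moment_0 : sphere_moment n 0 = 2 * P ^+ N / GN.
Proof.
rewrite /sphere_moment !addr0 Gamma_half -/P -/GN exprSr mulrA //.
Qed.

Let kappaE : kappa1 s = (2 * s)^-1 * (2 `^ (1 - 2 * s) / P * Gs * G1 - 1).
Proof.
rewrite /kappa1 /gap_const (_ : s + 1 / 2 = (1 + 2 * s) / 2); last by field.
rewrite -/G1 -/Gs -/P; set T := 2 `^ _.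
by field; rewrite !gt_eqF.
Qed.

Lemma h_constE : h_const N s = c_const N s / 2 * (kappa1 s * sphere_moment n (2 * s)).
Proof.
rewrite /h_const /kappa_const kappaE moment_s -/G1 -/G2 -/P -/Gs.
have -> : (N%:R - 1) / 2 = n%:R / 2 :> R by rewrite -natr1 addrK.
rewrite powR_pi; set c := c_const N s; set k := _ - 1; set p := P ^+ n.
by field; rewrite !gt_eqF.
Qed.

(** The two spherical lower bounds carry |Omega|^(-2s/N) and |Omega|^(-(2s-1)/N); factoring out the
    first leaves the quotient |Omega|^(1/N) / diam. *)
Lemma C_constE (Omega : set 'rV[R]_N) : 0 < vol Omega ->
  C_const s Omega = c_const N s / 2 *
    (kappa1 s * (2 `^ (2 * s) - 1) * (2 `^ (- (2 * s)) * (sphere_moment n 0 *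
       (N%:R * vol Omega / sphere_moment n 0) `^ (- (2 * s / N%:R)))) +
     (4 - 2 `^ (3 - 2 * s)) / (2 * s * diam Omega) * (sphere_moment n 0 *
       (N%:R * vol Omega / sphere_moment n 0) `^ (- ((2 * s - 1) / N%:R)))).
Proof.
move=> v0; have S0 : 0 < sphere_moment n 0 :> R by apply: sphere_moment_gt0.
have q0 : 0 < N%:R / sphere_moment n 0 :> R by rewrite divr_gt0.
have e b : (N%:R * vol Omega / sphere_moment n 0) `^ b =
    (N%:R / sphere_moment n 0) `^ b * vol Omega `^ b.
  by rewrite mulrAC powRM ?(ltW q0) ?(ltW v0).
rewrite !e /C_const /a_const /b_const sphere_areaE h_constE moment_s.
rewrite -/G1 -/G2 -/GN -/Gs -/P.
have -> : vol Omega `^ (- ((2 * s - 1) / N%:R)) =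
    vol Omega `^ (N%:R^-1) * vol Omega `^ (- (2 * s / N%:R)).
  by rewrite -gt0_powRD//; congr powR; field; rewrite gt_eqF.
set X1 := (N%:R / _) `^ (- (2 * s / _)); set X2 := (N%:R / _) `^ (- ((2 * s - 1) / _)).
set V1 := vol Omega `^ (- (2 * s / _)); set V2 := vol Omega `^ (_^-1).
rewrite [(2 * s * diam Omega)^-1]invfM; set d := (diam Omega)^-1.
rewrite moment_0 mulrDl [in RHS]mulrDr; congr (_ + _).
  set c := c_const N s; set k := kappa1 s; set t := 2 `^ (- _); set E := 2 `^ (2 * s) - 1.
  rewrite exprSr; move: G10 G20 GN0 P0; move: (P) (G1) (G2) (GN) (X1) (V1) => q g1 g2 g3 x v.
  move=> h1 h2 h3 h4; move: (c) (k) (t) (E) (q ^+ n) => c' k' t' E' p.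
  by field; rewrite !gt_eqF.
rewrite c_constE -/G2 -/Gs.
have -> : 2 `^ (2 * s) = 2 * 2 `^ (2 * s - 1) :> R.
  have e2 : 2 `^ (1 + (2 * s - 1)) = 2 `^ 1 * 2 `^ (2 * s - 1) :> R by rewrite gt0_powRD.
  by move: e2; rewrite powRr1// (_ : 1 + (2 * s - 1) = 2 * s)//; ring.
have p0 : 0 < P ^+ N by exact: exprn_gt0.
set c4 := 4 - _; set t := 2 `^ _; set p := P ^+ N in p0 *.
by field; rewrite !gt_eqF.
Qed.

End constants.

(** * Approximation by test functions *)

(** The difference is (t b - d)^2 / t. A small t keeps the coefficient of the main term near 1. *)
Lemma young {R : realFieldType} (t b d : R) : 0 < t ->
  (b + d) ^+ 2 <= (1 + t) * b ^+ 2 + (1 + t^-1) * d ^+ 2.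
Proof.
move=> t0; rewrite -subr_ge0.
have -> : (1 + t) * b ^+ 2 + (1 + t^-1) * d ^+ 2 - (b + d) ^+ 2 = (t * b - d) ^+ 2 / t.
  by field; rewrite gt_eqF.
by rewrite divr_ge0 ?sqr_ge0 ?ltW.
Qed.

Lemma ge0_le_integral_comb d (T : measurableType d) (R : realType)
    (mu : {measure set T -> \bar R}) (D : set T) (f g h : T -> \bar R) (b c : R) :
  measurable D -> 0 <= b -> 0 <= c ->
  measurable_fun D g -> measurable_fun D h ->
  (forall x, D x -> 0 <= f x)%E -> (forall x, D x -> 0 <= g x)%E ->
  (forall x, D x -> 0 <= h x)%E ->
  (forall x, D x -> f x <= b%:E * g x + c%:E * h x)%E ->
  (\int[mu]_(x in D) f x <= b%:E * \int[mu]_(x in D) g x + c%:E * \int[mu]_(x in D) h x)%E.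
Proof.
move=> mD b0 c0 mg mh f0 g0 h0 fgh.
rewrite -ge0_integralZl_EFin// -[X in (_ <= _ + X)%E]ge0_integralZl_EFin//.
rewrite -ge0_integralD//; last 4 first.
- by move=> x Dx; rewrite mule_ge0// g0.
- exact: measurable_funeM.
- by move=> x Dx; rewrite mule_ge0// h0.
- exact: measurable_funeM.
exact: ge0_le_integral_nonmeasurable.
Qed.

Section approximation.
Context {R : realType} (n : nat) (Omega : set 'rV[R]_n.+1).
Hypotheses (oO : open Omega) (cO : convex_set Omega) (bO : bounded_set Omega).
Hypothesis ne : Omega !=set0.
Local Notation N := n.+1.
Notation leb := (@lebesgue_rV R N).
Variable s : R.
Hypotheses (s_gt : 1 / 2 < s) (s_lt : s < 1).
Implicit Types (u v w phi : 'rV[R]_N -> R).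

Definition gagliardo v : \bar R := (\int[leb \x leb]_(z in Omega `*` Omega)
  ((v z.1 - v z.2) ^+ 2 / enorm (z.1 - z.2) `^ (N%:R + 2 * s))%:E)%E.

Let W := hardy_weight N s (diam Omega).
Let A := gauge_average Omega W.
Local Notation J := (weighted_gauge Omega).

Let mO : measurable Omega. Proof. exact: open_measurable_rV. Qed.
Let mOO : measurable (Omega `*` Omega). Proof. exact: measurableX. Qed.

Lemma diam_ge0 : 0 <= diam Omega.
Proof.
by have [x Ox] := ne; apply: le_trans (enorm_le_diam bO Ox Ox); exact: enorm_ge0.
Qed.

Let W0 p : 0 <= W p. Proof. by apply: hardy_weight_ge0 => //; exact: diam_ge0. Qed.
Let mW : measurable_fun setT W. Proof. exact: measurable_hardy_weight. Qed.
Let A0 x : (0 <= A x)%E. Proof. exact: gauge_average_ge0. Qed.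
Let mA : measurable_fun setT A. Proof. exact: measurable_gauge_average. Qed.

Let measurable_gagliardo v : measurable_fun setT v ->
  measurable_fun (Omega `*` Omega) (fun z : 'rV[R]_N * 'rV[R]_N =>
    ((v z.1 - v z.2) ^+ 2 / enorm (z.1 - z.2) `^ (N%:R + 2 * s))%:E).
Proof.
move=> mv; apply/measurable_EFinP; apply: measurable_funTS.
rewrite (_ : (fun _ => _) = (fun z : 'rV[R]_N * 'rV[R]_N =>
  (v z.1 - v z.2) ^+ 2 * enorm (z.1 - z.2) `^ (- (N%:R + 2 * s)))).
  apply: measurable_funM.
    apply: measurable_funX; apply: measurable_funB; exact: (measurableT_comp mv).
  apply: (measurableT_comp (measurable_powR _)).
  apply: (measurableT_comp (@measurable_enorm R N)).
  exact: measurable_funB_rV.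
by apply/funext => z; rewrite powRN.
Qed.

Let gagliardo_ge0 v (z : 'rV[R]_N * 'rV[R]_N) :
  (0 <= ((v z.1 - v z.2) ^+ 2 / enorm (z.1 - z.2) `^ (N%:R + 2 * s))%:E)%E.
Proof. by rewrite lee_fin divr_ge0 ?sqr_ge0 ?powR_ge0. Qed.

Let gagliardo_young t u w : 0 < t -> measurable_fun setT u -> measurable_fun setT w ->
  (gagliardo (u \- w)%R <= (1 + t)%:E * gagliardo u + (1 + t^-1)%:E * gagliardo w)%E.
Proof.
move=> t0 mu mw; have ti0 : 0 < t^-1 by rewrite invr_gt0.
apply: ge0_le_integral_comb => //; try exact: measurable_gagliardo.
- by rewrite addr_ge0 ?ltW.
- by rewrite addr_ge0 ?ltW.
move=> z _; rewrite -!EFinM -EFinD lee_fin /= !mulrA -mulrDl ler_wpM2r ?invr_ge0 ?powR_ge0//.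
have -> : u z.1 - w z.1 - (u z.2 - w z.2) = (u z.1 - u z.2) + - (w z.1 - w z.2) by ring.
have := young (u z.1 - u z.2) (- (w z.1 - w z.2)) t0; rewrite sqrrN => /le_trans; apply.
by rewrite le_eqVlt; apply/orP; left; apply/eqP; ring.
Qed.

Let test_energy phi : Cc_infty Omega phi ->
  measurable_fun setT phi /\ (J phi W <= gagliardo phi)%E.
Proof.
move=> [sphi cK KO]; have cphi : continuous phi by exact: (sphi [::]).1.
have mphi : measurable_fun setT phi by exact: continuous_measurable_rV.
split=> //; have K0 x : ~ Defs.support phi x -> phi x = 0.
  move=> nx; apply/eqP; apply: contra_notT nx => nx.
  by apply: subset_closure; exact: nx.
have [M [_ /(_ (M + 1))]] : bounded_set (phi @` Defs.support phi).
  by apply: compact_bounded; apply: continuous_compact => //; exact: continuous_subspaceT.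
rewrite ltrDl ltr01 => /(_ isT) hM.
have phiB x : `|phi x| <= `|M + 1|.
  have [Kx|/K0 ->] := pselect (Defs.support phi x); last by rewrite normr0.
  by apply: le_trans (ler_norm _); apply: hM; exists x.
exact: (energy_inequality oO cO bO mphi s_gt s_lt cK KO K0 phiB diam_ge0).
Qed.

(** [hardy_weight_le] bounds the weight by a power of the mean gauge, and the gauges at a single
    point are bounded by [gauge_compact_bound] for K = {x}. *)
Let A_fin x : Omega x -> (A x < +oo)%E.
Proof.
move=> Ox; pose H (p : R * R) : R := ((p.1 + p.2) / 2) `^ (2 * s).
have s0 : 0 < 2 * s by move: s_gt; lra.
have mH : measurable_fun setT H.
  apply: (measurableT_comp (measurable_powR _)); apply: measurable_funM => //.
  exact: measurable_funD.
have H0 p : 0 <= H p by exact: powR_ge0.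
have g0 : 0 <= 2 * gap_const s.
  rewrite mulr_ge0//; apply: le_trans (gap_const_ge s_gt s_lt).
  by rewrite divr_ge0 ?powR_ge0 ?(ltW s0).
have mgH : measurable_fun setT (fun p => 2 * gap_const s * H p).
  exact: measurable_funM.
have gH0 p : 0 <= 2 * gap_const s * H p by rewrite mulr_ge0.
have h : (A x <= gauge_average Omega (fun p => 2 * gap_const s * H p)%R x)%E.
  apply: (le_gauge_average oO cO bO Ox mW W0 mgH gH0) => a b a0 b0 abd.
  apply: le_trans (hardy_weight_le (ltn0Sn n) s_gt s_lt a0 b0 abd).
  by rewrite lerDl mulr_ge0 ?invr_ge0 ?(ltW s0)// addr_ge0 ?powR_ge0.
have xO : [set x] `<=` Omega by move=> y ->.
have [C C0 mC] := gauge_compact_bound oO cO (@compact_set1 _ x) xO.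
apply: (le_lt_trans h).
apply: (@le_lt_trans _ _ (sphere_moment n 0 * (2 * gap_const s * C `^ (2 * s)))%:E); last exact: ltry.
apply: (gauge_average_bounded oO cO (C := C)) => //.
  by move=> w w1; exact: mC.
move=> a b /andP[a0 aC] /andP[b0 bC]; apply: ler_wpM2l => //.
apply: ge0_ler_powR; rewrite ?nnegrE ?(ltW s0) ?(ltW C0)//.
  by rewrite /=; move: a0 b0; lra.
by rewrite /=; move: aC bC; lra.
Qed.

(** On this set the weight is at most k, so an error that is small in L^2 remains small after
    weighting. *)
Let D (k : nat) : set 'rV[R]_N := Omega `&` [set x | (A x <= k%:R%:E)%E].

Let mD k : measurable (D k).
Proof.
apply: measurableI => //.
by rewrite -[X in measurable X]setTI; exact: emeasurable_fun_infty_c.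
Qed.

Let mint v (F : R * R -> R) (E : set 'rV[R]_N) : measurable_fun setT v -> measurable_fun setT F ->
  (forall p, 0 <= F p) ->
  measurable_fun E (fun x => (v x ^+ 2)%:E * gauge_average Omega F x)%E.
Proof.
move=> mv mF F0; apply: measurable_funTS; apply: emeasurable_funM.
  by apply/measurable_EFinP; exact: measurable_funX.
exact: measurable_gauge_average.
Qed.

Let bigcup_D : \bigcup_k D k = Omega.
Proof.
apply/seteqP; split=> [x [k _ []]//|x Ox].
exists (Num.truncn (fine (A x))).+1 => //; split=> //=.
have Af : A x \is a fin_num by rewrite ge0_fin_numE// A_fin.
by rewrite -(fineK Af) lee_fin ltW// truncnS_gt.
Qed.

Section limit.
Variable u : 'rV[R]_N -> R.
Hypothesis mu : measurable_fun setT u.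
Hypothesis uE : (gagliardo u < +oo)%E.
Hypothesis approx : forall e : R, 0 < e -> exists2 phi, Cc_infty Omega phi &
  (L2_normsq Omega (u \- phi)%R <= e%:E)%E /\ (gagliardo (u \- phi)%R <= e%:E)%E.

(** Young's inequality is used twice: to pass from u to a test function under the bounded weight,
    and from the Gagliardo integral of the test function back to that of u. *)
Let truncated_le k : (\int[leb]_(x in D k) ((u x ^+ 2)%:E * A x) <= gagliardo u)%E.
Proof.
have E0 : (0 <= gagliardo u)%E by apply: integral_ge0 => z _; exact: gagliardo_ge0.
have Efin : gagliardo u \is a fin_num by rewrite ge0_fin_numE.
set E := fine (gagliardo u); have E0' : 0 <= E by exact: fine_ge0.
apply/lee_addgt0Pr => eps eps0.
(* This gives t <= 1 and 6 t E <= eps, so the excess 2 t E + t^2 E is at most eps / 2. *)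
pose t := eps / (6 * E + eps).
have T0 : 0 < 6 * E + eps by rewrite ltr_wpDl// mulr_ge0.
have t0 : 0 < t by rewrite divr_gt0.
have t1 : t <= 1 by rewrite ler_pdivrMr// mul1r lerDr mulr_ge0.
have tE : 6 * (t * E) <= eps.
  rewrite /t mulrCA mulrAC ler_pdivrMr// mulrDr; have : 0 <= eps * eps by rewrite mulr_ge0 ?ltW.
  by lra.
pose c1 := 1 + t^-1; have c10 : 0 < c1 by rewrite addr_gt0// invr_gt0.
have ct0 : 0 <= 1 + t by rewrite addr_ge0// ltW.
have k0 : 0 <= k%:R :> R by [].
(* The total coefficient of the approximation error e, increased by 1 to be positive; with e = eps /
   (2 K) that error contributes at most eps / 2. *)
pose K := (1 + t) * c1 + c1 * k%:R + 1.
have K0 : 0 < K.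
  by rewrite ltr_wpDl// addr_ge0// mulr_ge0// ltW.
pose e := eps / (2 * K); have e0 : 0 < e by rewrite divr_gt0// mulr_gt0.
have [phi Cphi [L2w Ew]] := approx e0.
have [mphi Jphi] := test_energy Cphi.
have mw : measurable_fun setT (u \- phi) by exact: measurable_funB.
have Ephi : (gagliardo phi <= (1 + t)%:E * gagliardo u + c1%:E * gagliardo (u \- phi)%R)%E.
  have -> : phi = (u \- (u \- phi))%R.
    by apply/funext => x /=; rewrite opprB addrC subrK.
  have -> : (u \- (u \- (u \- phi)) = u \- phi :> ('rV[R]_N -> R))%R.
    by apply/funext => x /=; ring.
  exact: gagliardo_young.
have step : (\int[leb]_(x in D k) ((u x ^+ 2)%:E * A x) <=
    (1 + t)%:E * \int[leb]_(x in D k) ((phi x ^+ 2)%:E * A x) +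
    (c1 * k%:R)%:E * \int[leb]_(x in D k) ((u x - phi x) ^+ 2)%:E)%E.
  apply: ge0_le_integral_comb => //.
  - by rewrite mulr_ge0// ltW.
  - exact: mint.
  - apply/measurable_EFinP; apply: measurable_funTS; exact: (measurable_funX 2 mw).
  - by move=> x _; rewrite mule_ge0// lee_fin sqr_ge0.
  - by move=> x _; rewrite mule_ge0// lee_fin sqr_ge0.
  - by move=> x _; rewrite lee_fin sqr_ge0.
  move=> x [Ox /=]; case: (A x) (A0 x) => // a; rewrite !lee_fin => a0 ak.
  have := young (phi x) (u x - phi x) t0; rewrite [phi x + _]addrC subrK -/c1 => y.
  have h := ler_wpM2r a0 y.
  have h2 : c1 * (u x - phi x) ^+ 2 * a <= c1 * (u x - phi x) ^+ 2 * k%:R.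
    by rewrite ler_wpM2l// mulr_ge0 ?sqr_ge0// ltW.
  by move: h h2; set X := (u x - phi x) ^+ 2; lra.
have I1 : (\int[leb]_(x in D k) ((phi x ^+ 2)%:E * A x) <= J phi W)%E.
  apply: ge0_subset_integral => //; first exact: mint.
    by move=> x _; rewrite mule_ge0// lee_fin sqr_ge0.
  by move=> x [].
have I2 : (\int[leb]_(x in D k) ((u x - phi x) ^+ 2)%:E <= L2_normsq Omega (u \- phi)%R)%E.
  apply: ge0_subset_integral => //.
  - apply/measurable_EFinP; apply: measurable_funTS; exact: (measurable_funX 2 mw).
  - by move=> x _; rewrite lee_fin sqr_ge0.
  - by move=> x [].
have c1k : (0 <= (c1 * k%:R)%:E)%E by rewrite lee_fin mulr_ge0// ltW.
apply: (le_trans step).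
apply: (@le_trans _ _ ((1 + t)%:E * ((1 + t)%:E * E%:E + c1%:E * e%:E) + (c1 * k%:R)%:E * e%:E)%E).
  apply: leeD; last by apply: lee_wpmul2l => //; exact: le_trans I2 L2w.
  apply: lee_wpmul2l; first by rewrite lee_fin.
  apply: (le_trans I1); apply: (le_trans Jphi); apply: (le_trans Ephi).
  rewrite -(fineK Efin) -/E; apply: leeD => //.
  by apply: lee_wpmul2l => //; rewrite lee_fin ltW.
rewrite -(fineK Efin) -/E -?EFinM -?EFinD ?lee_fin.
have eK : e * K = eps / 2 by rewrite /e; field; rewrite gt_eqF.
have e1 : e * ((1 + t) * c1 + c1 * k%:R) <= eps / 2.
  by rewrite -eK ler_wpM2l ?(ltW e0)// lerDl.
have tt : t * t * E <= t * E.
  by apply: ler_wpM2r => //; rewrite ler_piMl// ltW.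
have -> : (1 + t) * ((1 + t) * E + c1 * e) + c1 * k%:R * e =
    E + 2 * (t * E) + t * t * E + e * ((1 + t) * c1 + c1 * k%:R) by ring.
by move: e1 tt tE; move: (t * E) (t * t * E) (e * _) => a b f; lra.
Qed.

(** The average [A] is finite on Omega, so the sets [D k] exhaust it and monotone convergence
    applies. *)
Lemma weighted_gauge_le_gagliardo : (J u W <= gagliardo u)%E.
Proof.
have cv : (\int[leb]_(x in D k) ((u x ^+ 2)%:E * A x) @[k --> \oo] --> J u W)%E.
  rewrite /weighted_gauge -/A -[in X in _ --> X]bigcup_D.
  apply: ge0_nondecreasing_set_cvg_integral => //.
  - move=> i j ij; apply/subsetPset => x [Ox /= h]; split=> //=.
    by apply: (le_trans h); rewrite lee_fin ler_nat.
  - by move=> i; exact: mint.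
  - by move=> i x _; rewrite mule_ge0// lee_fin sqr_ge0.
rewrite -(cvg_lim _ cv)//; apply: lime_le; first by apply/cvg_ex; eexists; exact: cv.
by apply: nearW => k; exact: truncated_le.
Qed.

End limit.

End approximation.

(** * From the weighted average to the Hardy inequality *)

Section hardy.
Context {R : realType} (n : nat) (Omega : set 'rV[R]_n.+1).
Hypotheses (oO : open Omega) (cO : convex_set Omega) (bO : bounded_set Omega).
Hypothesis ne : Omega !=set0.
Local Notation N := n.+1.
Notation leb := (@lebesgue_rV R N).
Variables (s : R) (u : 'rV[R]_N -> R).
Hypotheses (s_gt : 1 / 2 < s) (s_lt : s < 1).
Hypothesis mu : measurable_fun setT u.
Hypothesis JE : (weighted_gauge Omega u (hardy_weight N s (diam Omega)) <=
  gagliardo Omega s u)%E.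
Local Notation J := (weighted_gauge Omega u).

Let s0 : 0 < 2 * s. Proof. by move: s_gt; lra. Qed.
Let mO : measurable Omega. Proof. exact: open_measurable_rV. Qed.

Let vol_gt0 : 0 < vol Omega.
Proof.
apply: fine_gt0; rewrite lebesgue_rV_open_gt0//=.
exact: lebesgue_rV_bounded.
Qed.

Let usq_ge0 x : (0 <= (u x ^+ 2)%:E)%E. Proof. by rewrite lee_fin sqr_ge0. Qed.

Let musq (E : set 'rV[R]_N) : measurable_fun E (fun x => (u x ^+ 2)%:E).
Proof.
by apply/measurable_EFinP; apply: measurable_funTS; exact: measurable_funX.
Qed.

Let distance_le : ((sphere_moment n (2 * s))%:E *
    \int[leb]_(x in Omega) (u x ^+ 2 / bdist Omega x `^ (2 * s))%:E <=
  J (max_pow (2 * s)))%E.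
Proof.
have S0 : 0 < sphere_moment n (2 * s) :> R by apply: sphere_moment_gt0; exact: ltW.
set S := sphere_moment _ _ in S0 *.
have Si0 : 0 <= S^-1 by rewrite invr_ge0 ltW.
have mM := @measurable_max_pow R (2 * s); have M0 := @max_pow_ge0 R (2 * s).
(* The moment is placed on the side of the measurable average, where a constant can be moved through
   the integral; the side with [bdist] is compared by monotonicity alone. *)
have h : (\int[leb]_(x in Omega) (u x ^+ 2 / bdist Omega x `^ (2 * s))%:E <=
    S^-1%:E * J (max_pow (2 * s)))%E.
  rewrite -(weighted_gaugeZ oO cO mu Si0 mM M0).
  apply: ge0_le_integral_nonmeasurable => x Ox.
    by rewrite lee_fin divr_ge0 ?sqr_ge0 ?powR_ge0.
  rewrite EFinM; apply: lee_wpmul2l => //.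
  rewrite (gauge_averageZ oO cO x Si0 mM M0).
  have := gauge_average_max_pow oO cO bO s0 Ox; rewrite -/S => hx.
  have Si0' : (0 <= (S^-1)%:E)%E by rewrite lee_fin.
  apply: le_trans (lee_wpmul2l Si0' hx).
  by rewrite -EFinM lee_fin mulrA mulVf ?mul1r// gt_eqF.
have S0' : (0 <= S%:E)%E by rewrite lee_fin ltW.
apply: (le_trans (lee_wpmul2l S0' h)).
by rewrite muleA -EFinM divff ?mul1e// gt_eqF.
Qed.

Let L2 : \bar R := (\int[leb]_(x in Omega) (u x ^+ 2)%:E)%E.
Let L20 : (0 <= L2)%E. Proof. exact: integral_ge0. Qed.

Let constant_le (F : R * R -> R) (c : R) : 0 <= c -> measurable_fun setT F -> (forall p, 0 <= F p) ->
  (forall x, Omega x -> (c%:E <= gauge_average Omega F x)%E) -> (c%:E * L2 <= J F)%E.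
Proof.
move=> c0 mF F0 h; rewrite -ge0_integralZl_EFin//.
apply: ge0_le_integral_nonmeasurable => x Ox; first by rewrite mule_ge0.
by rewrite muleC lee_wpmul2l// h.
Qed.

Let mF1 := @measurable_max_pow R (2 * s).
Let F10 := @max_pow_ge0 R (2 * s).
Let mF2 := @measurable_min_pow R N (2 * s).
Let F20 := @min_pow_ge0 R N (2 * s).
Let mF3 := @measurable_fst_pow R N (2 * s - 1).
Let F30 := @fst_pow_ge0 R N (2 * s - 1).

Let JWE : J (hardy_weight N s (diam Omega)) =
  ((kappa1 s)%:E * J (max_pow (2 * s)) +
   ((kappa1 s * (2 `^ (2 * s) - 1))%:E * J (min_pow N (2 * s)) +
    ((4 - 2 `^ (3 - 2 * s)) / (2 * s * diam Omega))%:E * J (fst_pow N (2 * s - 1))))%E.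
Proof.
have [a20 a30] := hardy_coef_ge0 s_gt s_lt (diam_ge0 bO ne).
have k0 := kappa1_ge0 s_gt s_lt.
have mZ (b : R) (F : R * R -> R) : measurable_fun setT F ->
  measurable_fun setT (fun p => b * F p) by move=> mF; exact: measurable_funM.
have Z0 (b : R) (F : R * R -> R) : 0 <= b -> (forall p, 0 <= F p) ->
  forall p, 0 <= b * F p by move=> b0 F0 p; exact: mulr_ge0.
have mD (F G : R * R -> R) : measurable_fun setT F -> measurable_fun setT G ->
  measurable_fun setT (fun p => F p + G p) by move=> mF mG; exact: measurable_funD.
have D0 (F G : R * R -> R) : (forall p, 0 <= F p) -> (forall p, 0 <= G p) ->
  forall p, 0 <= F p + G p by move=> F0 G0 p; exact: addr_ge0.
have m1 := mZ (kappa1 s) _ mF1; have n1 := Z0 _ _ k0 F10.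
have m2 := mZ _ _ mF2 : measurable_fun setT
  (fun p => kappa1 s * (2 `^ (2 * s) - 1) * min_pow N (2 * s) p).
have n2 := Z0 _ _ a20 F20.
have m3 := mZ _ _ mF3 : measurable_fun setT
  (fun p => (4 - 2 `^ (3 - 2 * s)) / (2 * s * diam Omega) * fst_pow N (2 * s - 1) p).
have n3 := Z0 _ _ a30 F30.
apply: (etrans (weighted_gaugeD oO cO mu m1 n1 (mD _ _ m2 m3) (D0 _ _ n2 n3))).
apply: (f_equal2 adde (weighted_gaugeZ oO cO mu k0 mF1 F10)).
apply: (etrans (weighted_gaugeD oO cO mu m2 n2 m3 n3)).
exact: (f_equal2 adde (weighted_gaugeZ oO cO mu a20 mF2 F20)
  (weighted_gaugeZ oO cO mu a30 mF3 F30)).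
Qed.

(** All coefficients and terms are nonnegative, so the products distribute over sums even if the
    integrals are infinite. *)
Let combine (I L J1 J2 J3 E : \bar R) (c k S a2 a3 m2 m3 : R) :
  0 <= c -> 0 <= k -> 0 <= S -> 0 <= a2 -> 0 <= a3 -> 0 <= m2 -> 0 <= m3 ->
  (0 <= I -> 0 <= L -> S%:E * I <= J1 -> m2%:E * L <= J2 -> m3%:E * L <= J3 ->
   k%:E * J1 + (a2%:E * J2 + a3%:E * J3) <= E ->
   (c * (k * S))%:E * I + (c * (a2 * m2 + a3 * m3))%:E * L <= c%:E * E)%E.
Proof.
move=> c0 k0 S0 a20 a30 m20 m30 I0 L0 h1 h2 h3 JW.
have c0' : (0 <= c%:E)%E by rewrite lee_fin.
apply: le_trans (lee_wpmul2l c0' JW).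
have -> : ((c * (a2 * m2 + a3 * m3))%:E * L =
    c%:E * (a2%:E * (m2%:E * L) + a3%:E * (m3%:E * L)))%E.
  rewrite EFinM -muleA EFinD ge0_muleDl ?lee_fin ?mulr_ge0//.
  by rewrite (EFinM a2) (EFinM a3) -!muleA.
have -> : ((c * (k * S))%:E * I = c%:E * (k%:E * (S%:E * I)))%E.
  by rewrite EFinM (EFinM k) -!muleA.
rewrite -ge0_muleDr; last 2 first.
- by rewrite !mule_ge0 ?lee_fin.
- by rewrite adde_ge0// !mule_ge0 ?lee_fin.
apply: lee_wpmul2l => //; apply: leeD; first by apply: lee_wpmul2l; rewrite ?lee_fin.
by apply: leeD; apply: lee_wpmul2l; rewrite ?lee_fin.
Qed.

Lemma hardy_of_weighted_gauge :
  ((h_const N s)%:E *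
     (\int[leb]_(x in Omega) (u x ^+ 2 / bdist Omega x `^ (2 * s))%:E)
   + (C_const s Omega)%:E * (\int[leb]_(x in Omega) (u x ^+ 2)%:E)
   <= (c_const N s / 2)%:E * gagliardo Omega s u)%E.
Proof.
have S0 : 0 < sphere_moment n 0 :> R by apply: sphere_moment_gt0.
have S1 : 0 <= sphere_moment n (2 * s) :> R.
  by apply: ltW; apply: sphere_moment_gt0; exact: ltW.
have c0 : 0 <= c_const N s / 2.
  by apply: divr_ge0; [exact/ltW/(c_const_gt0 n s_gt s_lt)|].
have [a20 a30] := hardy_coef_ge0 s_gt s_lt (diam_ge0 bO ne).
have s1 : 0 < 2 * s - 1 by move: s_gt; lra.
have m30 (b : R) : 0 <= sphere_moment n 0 * (N%:R * vol Omega / sphere_moment n 0) `^ b.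
  by apply: mulr_ge0; [exact: ltW|exact: powR_ge0].
have m20 (b : R) : 0 <= 2 `^ (- (2 * s)) *
    (sphere_moment n 0 * (N%:R * vol Omega / sphere_moment n 0) `^ b).
  by apply: mulr_ge0; [exact: powR_ge0|exact: m30].
have I0 : (0 <= \int[leb]_(x in Omega) (u x ^+ 2 / bdist Omega x `^ (2 * s))%:E)%E.
  by apply: integral_ge0 => x _; rewrite lee_fin divr_ge0 ?sqr_ge0 ?powR_ge0.
have h2 := constant_le (m20 _) mF2 F20
  (fun x Ox => gauge_average_min_pow oO cO bO s0 Ox vol_gt0).
have h3 := constant_le (m30 _) mF3 F30
  (fun x Ox => gauge_average_fst_pow oO cO bO s1 Ox vol_gt0).
have JW := JE; rewrite JWE in JW.
rewrite (h_constE n s_gt) (C_constE s_gt s_lt vol_gt0).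
exact: (combine c0 (kappa1_ge0 s_gt s_lt) S1 a20 a30 (m20 _) (m30 _) I0 L20
  distance_le h2 h3 JW).
Qed.

End hardy.

Theorem theorem1p6 (R : realType) (N : nat) (s : R) (Omega : set 'rV[R]_N)
    (N_gt0 : (0 < N)%N) (s_gt : 1 / 2 < s) (s_lt : s < 1)
    (Omega_open : open Omega) (Omega_bounded : bounded_set Omega)
    (Omega_convex : convex_set Omega)
    (u : 'rV[R]_N -> R) (uHs0 : Hs0 s Omega u) :
  ((h_const N s)%:E *
     (\int[lebesgue_rV N]_(x in Omega) (u x ^+ 2 / bdist Omega x `^ (2 * s))%:E)
   + (C_const s Omega)%:E * (\int[lebesgue_rV N]_(x in Omega) (u x ^+ 2)%:E)
   <= (c_const N s / 2)%:E *
      (\int[lebesgue_rV N \x lebesgue_rV N]_(z in Omega `*` Omega)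
         ((u z.1 - u z.2) ^+ 2 / enorm (z.1 - z.2) `^ (N%:R + 2 * s))%:E))%E.
Proof.
case: N N_gt0 Omega Omega_open Omega_bounded Omega_convex u uHs0 => // n _.
move=> Omega oO bO cO u0 [[mu0 _ Efin] approx].
have [->|/set0P ne] := eqVneq Omega set0.
  by rewrite setX0 !integral_set0 !mule0 adde0.
have mO : measurable Omega by exact: open_measurable_rV.
(* Membership in [Hs] gives measurability on Omega only; the extension by zero is measurable
   everywhere and has the same integrals over Omega. *)
pose u : 'rV[R]_n.+1 -> R := u0 \_ Omega.
have mu : measurable_fun setT u by apply/(measurable_restrictT _ mO).
have uE x : x \in Omega -> u x = u0 x by move=> Ox; rewrite /u patchE Ox.
have c0 : 0 < c_const n.+1 s / 2 by rewrite divr_gt0// c_const_gt0.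
have gE v v' : (forall x, x \in Omega -> v x = v' x) ->
    gagliardo Omega s v = gagliardo Omega s v'.
  move=> vv; apply: eq_integral => z; rewrite in_setX => /andP[z1 z2].
  by rewrite !vv.
have energyE v : energy s Omega v = ((c_const n.+1 s / 2)%:E * gagliardo Omega s v)%E by [].
have g0 v : (0 <= gagliardo Omega s v)%E.
  by apply: integral_ge0 => z _; rewrite lee_fin divr_ge0 ?sqr_ge0 ?powR_ge0.
have uEE : gagliardo Omega s u = gagliardo Omega s u0 by exact: gE.
have Eu : (gagliardo Omega s u < +oo)%E.
  rewrite uEE; move: Efin; rewrite energyE.
  case: (gagliardo Omega s u0) (g0 u0) => [r _ _|_|//]; first exact: ltry.
  by rewrite gt0_muley ?lte_fin.
have approx' e : 0 < e -> exists2 phi, Cc_infty Omega phi &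
    (L2_normsq Omega (u \- phi)%R <= e%:E)%E /\ (gagliardo Omega s (u \- phi)%R <= e%:E)%E.
  (* The squared norm contains the Gagliardo integral with the factor c / 2, so both bounds are
     built into d; the square root matches the squared tolerance in [Hs0]. *)
  move=> e0; pose d := Num.min e (c_const n.+1 s / 2 * e).
  have d0 : 0 < d by rewrite lt_min e0 mulr_gt0.
  have [phi Cphi] := approx (Num.sqrt d) (etrans (sqrtr_gt0 d) d0).
  rewrite sqr_sqrtr ?(ltW d0)// /Hs_normsq => /ltW lt; exists phi => //.
  have L0 : (0 <= L2_normsq Omega (u0 \- phi)%R)%E.
    by apply: integral_ge0 => x _; rewrite lee_fin sqr_ge0.
  have En0 : (0 <= energy s Omega (u0 \- phi)%R)%E.
    by rewrite energyE mule_ge0// lee_fin ltW.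
  have -> : L2_normsq Omega (u \- phi)%R = L2_normsq Omega (u0 \- phi)%R.
    by apply: eq_integral => x Ox /=; rewrite uE.
  have -> : gagliardo Omega s (u \- phi)%R = gagliardo Omega s (u0 \- phi)%R.
    by apply: gE => x Ox /=; rewrite uE.
  have h1 := le_trans (leeDl _ En0) lt; have h2 := le_trans (leeDr _ L0) lt.
  split; first by apply: (le_trans h1); rewrite lee_fin ge_min lexx.
  rewrite -(lee_pmul2l _ _ (x := (c_const n.+1 s / 2)%:E)) ?lte_fin//.
  by rewrite -energyE; apply: (le_trans h2); rewrite -EFinM lee_fin ge_min lexx orbT.
have JE := weighted_gauge_le_gagliardo oO cO bO ne s_gt s_lt mu Eu approx'.
have := hardy_of_weighted_gauge oO cO bO ne s_gt s_lt mu JE.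
rewrite uEE; apply: le_trans; rewrite le_eqVlt; apply/orP; left; apply/eqP.
by congr (_ * _ + _ * _)%E; apply: eq_integral => x Ox; rewrite uE.
Qed.
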